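(* Let $k\in\mathbb R$, $K\in\mathbb Z$, $n\ge0$. Every $L\in \mathrm{MLDO}^{(\le n)}_{k,k+K}(\Gamma_1)$ has unique expansions $$L=\sum_{r=0}^n b_r\,\vartheta_k^r=\sum_{r=0}^n c_r\,\mathcal K_k^r=\sum_{r=0}^n d_r\,\vartheta_k^{[r]}$$ with $b_r,c_r,d_r\in M_{K-2r}(\Gamma_1)$, and each of the three maps $L\mapsto(b_0,\dots,b_n)$, $L\mapsto(c_0,\dots,c_n)$, $L\mapsto(d_0,\dots,d_n)$ is an isomorphism $\mathrm{MLDO}^{(\le n)}_{k,k+K}(\Gamma_1)\xrightarrow{\sim}\bigoplus_{r=0}^n M_{K-2r}(\Gamma_1)$.
   Context: $\Gamma_1=SL_2(\mathbb Z)$, $\mathfrak H$ the upper half-plane, $(f|_k\gamma)(\tau)=(c\tau+d)^{-k}f(\gamma\tau)$ for $\gamma=\begin{pmatrix}a&b\\c&d\end{pmatrix}$, $D=\frac1{2\pi i}\frac d{d\tau}$, $q=e^{2\pi i\tau}$. $M_k(\Gamma_1)$: holomorphic modular forms of weight $k$ (zero for $k<0$). An MLDO of type $(k,k+K)$ on $\Gamma_1$ is a linear differential operator $\sum_r a_r(\tau)D^r$ of finite order, coefficients holomorphic on $\mathfrak H$ and at the cusp, with $L(f|_k\gamma)=L(f)|_{k+K}\gamma$ for all holomorphic $f$ and all $\gamma\in\Gamma_1$; $\mathrm{MLDO}^{(\le n)}_{k,k+K}(\Gamma_1)$ are those of order $\le n$. $E_2=1-24\sum\frac{nq^n}{1-q^n}$,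 $E_4=1+240\sum\frac{n^3q^n}{1-q^n}$. Serre derivative $\vartheta_j(g)=Dg-\frac j{12}E_2g$; iterated $\vartheta_k^r=\vartheta_{k+2r-2}\circ\cdots\circ\vartheta_{k+2}\circ\vartheta_k$ ($\vartheta_k^0=\mathrm{id}$). Canonical higher Serre derivatives: $\vartheta_k^{[0]}=\mathrm{id}$, $\vartheta_k^{[1]}=\vartheta_k$, $\vartheta_k^{[n+1]}(f)=\vartheta_{k+2n}(\vartheta_k^{[n]}f)-\frac{n(n+k-1)}{144}E_4\vartheta_k^{[n-1]}f$. Rankin–Cohen bracket $[f,g]_n^{(k,\ell)}=\sum_{i=0}^n(-1)^i\binom{n+k-1}{n-i}\binom{n+\ell-1}{i}D^if\,D^{n-i}g$; Kaneko–Koike operator $\mathcal K_k^n(f)=D^nf-\frac{k+n-1}{12}[f,E_2]^{(k,2)}_{n-1}$ ($n\ge1$), $\mathcal K_k^0=\mathrm{id}$.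
   Formalization: The Kaneko–Koike operator is taken as D^n f − (k+n−1)/12 [E_2,f]^{(2,k)}_{n−1}, i.e. with an extra sign (−1)^{n−1} before [f,E_2]^{(k,2)}_{n−1}; with the printed sign it is not equivariant for n=2, k≠−1, and the claim fails (K=4, L=ϑ_k^2). *)

(* Defs.v *)
From Stdlib Require Import Reals Lra Lia ZArith ProofIrrelevance FunctionalExtensionality.
From Stdlib Require Import ssreflect ssrfun.
From Coquelicot Require Import Coquelicot.
Open Scope R_scope.

Section FunctionSpace.
Variables (X : Type) (V : ModuleSpace C_Ring).

Definition fct_AbelianMonoid_mixin : AbelianMonoid.mixin_of (X -> V).
Proof.
apply (AbelianMonoid.Mixin (X -> V) (fun f g x => plus (f x) (g x)) (fun _ => zero)).
- by move=> f g; apply: functional_extensionality => x; apply: plus_comm.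
- by move=> f g h; apply: functional_extensionality => x; apply: plus_assoc.
- by move=> f; apply: functional_extensionality => x; apply: plus_zero_r.
Defined.

Definition fct_AbelianGroup_mixin :
  AbelianGroup.mixin_of (AbelianMonoid.Pack (X -> V) fct_AbelianMonoid_mixin (X -> V)).
Proof.
apply (AbelianGroup.Mixin
  (AbelianMonoid.Pack (X -> V) fct_AbelianMonoid_mixin (X -> V)) (fun f x => opp (f x))).
by move=> f; apply: functional_extensionality => x; apply: plus_opp_r.
Defined.

Definition fct_AbelianGroup_class : AbelianGroup.class_of (X -> V) :=
  AbelianGroup.Class _ fct_AbelianMonoid_mixin fct_AbelianGroup_mixin.

Definition fct_ModuleSpace_mixin :
  ModuleSpace.mixin_of C_Ring (AbelianGroup.Pack (X -> V) fct_AbelianGroup_class (X -> V)).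
Proof.
apply (ModuleSpace.Mixin C_Ring
  (AbelianGroup.Pack (X -> V) fct_AbelianGroup_class (X -> V)) (fun a f x => scal a (f x))).
- by move=> a b f; apply: functional_extensionality => x; apply: scal_assoc.
- by move=> f; apply: functional_extensionality => x; apply: scal_one.
- by move=> a f g; apply: functional_extensionality => x; apply: scal_distr_l.
- by move=> a b f; apply: functional_extensionality => x; apply: scal_distr_r.
Defined.

Definition fct_ModuleSpace : ModuleSpace C_Ring :=
  ModuleSpace.Pack C_Ring (X -> V)
    (ModuleSpace.Class C_Ring (X -> V) fct_AbelianGroup_class fct_ModuleSpace_mixin) (X -> V).

End FunctionSpace.

Record is_subspace {V : ModuleSpace C_Ring} (P : V -> Prop) : Prop := {
  subspace_zero : P zero;
  subspace_plus : forall x y, P x -> P y -> P (plus x y);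
  subspace_scal : forall a x, P x -> P (scal a x) }.

Section Subspace.
Variables (V : ModuleSpace C_Ring) (P : V -> Prop) (HP : is_subspace P).

Lemma sub_eq (x y : {v : V | P v}) : proj1_sig x = proj1_sig y -> x = y.
Proof.
case: x => x px; case: y => y py /= e; subst y.
by rewrite (proof_irrelevance _ px py).
Qed.

Lemma subspace_opp x : P x -> P (opp x).
Proof. by move=> px; rewrite -scal_opp_one; apply: subspace_scal. Qed.

Definition sub_AbelianMonoid_mixin : AbelianMonoid.mixin_of {v : V | P v}.
Proof.
apply (AbelianMonoid.Mixin {v : V | P v}
  (fun x y => exist P (plus (proj1_sig x) (proj1_sig y))
                (subspace_plus P HP _ _ (proj2_sig x) (proj2_sig y)))
  (exist P zero (subspace_zero P HP))).
- by move=> x y; apply: sub_eq; apply: plus_comm.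
- by move=> x y z; apply: sub_eq; apply: plus_assoc.
- by move=> x; apply: sub_eq; apply: plus_zero_r.
Defined.

Definition sub_AbelianGroup_mixin : AbelianGroup.mixin_of
  (AbelianMonoid.Pack {v : V | P v} sub_AbelianMonoid_mixin {v : V | P v}).
Proof.
apply (AbelianGroup.Mixin
  (AbelianMonoid.Pack {v : V | P v} sub_AbelianMonoid_mixin {v : V | P v})
  (fun x => exist P (opp (proj1_sig x)) (subspace_opp _ (proj2_sig x)))).
by move=> x; apply: sub_eq; apply: plus_opp_r.
Defined.

Definition sub_AbelianGroup_class : AbelianGroup.class_of {v : V | P v} :=
  AbelianGroup.Class _ sub_AbelianMonoid_mixin sub_AbelianGroup_mixin.

Definition sub_ModuleSpace_mixin : ModuleSpace.mixin_of C_Ring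
  (AbelianGroup.Pack {v : V | P v} sub_AbelianGroup_class {v : V | P v}).
Proof.
apply (ModuleSpace.Mixin C_Ring
  (AbelianGroup.Pack {v : V | P v} sub_AbelianGroup_class {v : V | P v})
  (fun a x => exist P (scal a (proj1_sig x))
                (subspace_scal P HP a _ (proj2_sig x)))).
- by move=> a b x; apply: sub_eq; apply: scal_assoc.
- by move=> x; apply: sub_eq; apply: scal_one.
- by move=> a x y; apply: sub_eq; apply: scal_distr_l.
- by move=> a b x; apply: sub_eq; apply: scal_distr_r.
Defined.

Definition sub_ModuleSpace : ModuleSpace C_Ring :=
  ModuleSpace.Pack C_Ring {v : V | P v}
    (ModuleSpace.Class C_Ring {v : V | P v} sub_AbelianGroup_class sub_ModuleSpace_mixin)
    {v : V | P v}.

End Subspace.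

Definition linear_isomorphism {V W : ModuleSpace C_Ring} (phi : V -> W) : Prop :=
  (forall x y, phi (plus x y) = plus (phi x) (phi y)) /\
  (forall a x, phi (scal a x) = scal a (phi x)) /\
  bijective phi.

Definition Cexp (z : C) : C := (exp (Re z) * cos (Im z), exp (Re z) * sin (Im z)).

(* The argument in (-PI, PI]; the value at 0 is irrelevant. *)
Definition Carg (z : C) : R :=
  match Rlt_dec 0 (Im z), Rlt_dec (Im z) 0, Rlt_dec (Re z) 0 with
  | left _, _, _ => PI / 2 - atan (Re z / Im z)
  | _, left _, _ => - (PI / 2) - atan (Re z / Im z)
  | _, _, left _ => PI
  | _, _, _ => 0
  end.

Definition Clog (z : C) : C := (ln (Cmod z), Carg z).

Definition Crpow (z : C) (s : R) : C := Cexp (s * Clog z).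

Record UHP := mkUHP { uhp_val :> C; uhp_im : 0 < Im uhp_val }.

Definition fun_UHP : ModuleSpace C_Ring := fct_ModuleSpace UHP C_ModuleSpace.

(* Derivatives at a point of the open set UHP do not see the junk value
   outside of it. *)
Definition ext (f : UHP -> C) (z : C) : C :=
  match Rlt_dec 0 (Im z) with
  | left h => f (mkUHP z h)
  | right _ => 0
  end.

Definition holomorphic (f : UHP -> C) : Prop :=
  forall tau : UHP, @ex_derive C_AbsRing C_NormedModule (ext f) (uhp_val tau).

Definition Hol : Type := {f : UHP -> C | holomorphic f}.

Definition hol_fun (f : Hol) : UHP -> C := proj1_sig f.
Coercion hol_fun : Hol >-> Funclass.

Definition Dq (f : UHP -> C) : UHP -> C :=
  fun tau => (C_derive (ext f) tau / (2 * PI * Ci))%C.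

Definition Dqn (r : nat) (f : UHP -> C) : UHP -> C := Nat.iter r Dq f.

Definition qpar (tau : UHP) : C := Cexp (2 * PI * Ci * tau).

(* As a function of q, f extends holomorphically to q = 0; this includes
   invariance under tau |-> tau + 1. *)
Definition holomorphic_at_cusp (f : UHP -> C) : Prop :=
  exists g : C -> C,
    (forall z, Cmod z < 1 -> @ex_derive C_AbsRing C_NormedModule g z) /\
    (forall tau, f tau = g (qpar tau)).

Record SL2Z := mkSL2Z {
  sa : Z; sb : Z; sc : Z; sd : Z;
  sl2_det : (sa * sd - sb * sc = 1)%Z }.

Definition autj (g : SL2Z) (z : C) : C := (IZR (sc g) * z + IZR (sd g))%C.

Definition mobius (g : SL2Z) (z : C) : C :=
  ((IZR (sa g) * z + IZR (sb g)) / autj g z)%C.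

Lemma sl2_detR (g : SL2Z) :
  IZR (sa g) * IZR (sd g) - IZR (sb g) * IZR (sc g) = 1.
Proof. by rewrite -!mult_IZR -minus_IZR sl2_det. Qed.

Lemma autj_neq0 (g : SL2Z) (z : C) : 0 < Im z -> autj g z <> 0.
Proof.
move: (sl2_detR g); case: z => x y; rewrite /autj /Im /= => hd hy e.
have e1 := f_equal fst e; have e2 := f_equal snd e; simpl in e1, e2.
have hc : IZR (sc g) = 0 by apply: (Rmult_eq_reg_r y); lra.
rewrite hc in e1 hd; nra.
Qed.

Lemma mobius_im (g : SL2Z) (z : C) : 0 < Im z -> 0 < Im (mobius g z).
Proof.
move=> hz; have hj := autj_neq0 g z hz.
have hm : 0 < Re (autj g z) ^ 2 + Im (autj g z) ^ 2.
  apply: Rnot_le_lt => h; apply: hj.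
  have h1 := pow2_ge_0 (Re (autj g z)); have h2 := pow2_ge_0 (Im (autj g z)).
  have e1 : Re (autj g z) = 0 by apply: Rsqr_0_uniq; rewrite Rsqr_pow2; lra.
  have e2 : Im (autj g z) = 0 by apply: Rsqr_0_uniq; rewrite Rsqr_pow2; lra.
  by move: e1 e2; case: (autj g z) => u v /= -> ->.
have -> : Im (mobius g z) = Im z / (Re (autj g z) ^ 2 + Im (autj g z) ^ 2).
  move: hm (sl2_detR g); rewrite /mobius /autj; case: z {hz hj} => x y /=.
  rewrite /Im /Re /= => hm hd.
  field_simplify_eq; last by simpl in hm; lra.
  transitivity (y * (IZR (sa g) * IZR (sd g) - IZR (sb g) * IZR (sc g))); first by ring.
  by rewrite hd; ring.
by apply: Rdiv_lt_0_compat.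
Qed.

Definition act (g : SL2Z) (tau : UHP) : UHP :=
  mkUHP (mobius g tau) (mobius_im g tau (uhp_im tau)).

(* For k not an integer the power is the principal branch; another holomorphic branch
   multiplies both sides of the equivariance condition below by the same
   constant. *)
Definition slash (k : R) (g : SL2Z) (f : UHP -> C) : UHP -> C :=
  fun tau => (Crpow (autj g tau) (- k) * f (act g tau))%C.

Local Notation isD := (@is_derive C_AbsRing C_NormedModule).
Local Notation isDK := (@is_derive C_AbsRing (AbsRing_NormedModule C_AbsRing)).
Lemma isDE f z l : isD f z l <-> isDK f z l.
Proof. split; case=> h1 h2; split; try exact h2.
case: h1 => a b c; split => //.
case: h1 => a b c; split => //.
Qed.

Lemma isD_eps f (z l : C) : (forall eps : posreal, locally z (fun w : C => Cmod (f w - f z - (w - z) * l) <= eps * Cmod (w - z))) -> isD f z l.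
Proof.
move=> h; split.
 apply: is_linear_scal_l.
move=> x hx. 
have -> : x = z by symmetry; apply: (is_filter_lim_locally_unique (K:=C_AbsRing) (V:=AbsRing_NormedModule C_AbsRing)) hx.
move=> eps. 
have h1 := h eps.

apply/locally_C. exact h1.
Qed.
Lemma isD_CR (u v : R -> R -> R) (z : C) a b :
 differentiable_pt_lim u (Re z) (Im z) a (- b) ->
 differentiable_pt_lim v (Re z) (Im z) b a ->
 isD (fun w : C => (u (Re w) (Im w), v (Re w) (Im w))) z (a, b).
Proof.
move=> hu hv; apply: isD_eps => eps.
have he : 0 < eps / 2 by case: eps => e he /=; lra.
have [d1 h1] := hu (mkposreal _ he); have [d2 h2] := hv (mkposreal _ he).
exists (mkposreal _ (Rmin_stable_in_posreal d1 d2)) => w [hw1 hw2].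
have hr : Rmax (Rabs (Re w - Re z)) (Rabs (Im w - Im z)) <= Cmod (w - z).
  exact: (Rmax_Cmod (w - z)%C).
have hc : forall p : C, Cmod p <= Rabs (fst p) + Rabs (snd p).
  move=> [p1 p2]; rewrite {1}(_ : (p1, p2) = (RtoC p1 + RtoC p2 * Ci)%C); last first.
    by rewrite /Cplus /Cmult /=; f_equal; ring.
  apply: Rle_trans (Cmod_triangle _ _) _.
  rewrite Cmod_mult Cmod_Ci !Cmod_R /=; lra.
apply: Rle_trans (hc _) _.
have k1 : Rabs (Re w - Re z) < d1. { apply: Rlt_le_trans hw1 (Rmin_l _ _). }
have k2 : Rabs (Im w - Im z) < d1. { apply: Rlt_le_trans hw2 (Rmin_l _ _). }
have k3 : Rabs (Re w - Re z) < d2. { apply: Rlt_le_trans hw1 (Rmin_r _ _). }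
have k4 : Rabs (Im w - Im z) < d2. { apply: Rlt_le_trans hw2 (Rmin_r _ _). }
have l1 := h1 _ _ k1 k2. have l2 := h2 _ _ k3 k4. simpl in l1, l2.
apply: Rle_trans (_ : eps/2 * Cmod (w-z) + eps/2 * Cmod (w-z) <= _); last by lra.
apply: Rplus_le_compat.
 apply: Rle_trans (Rle_trans _ _ _ l1 _); last by apply: Rmult_le_compat_l => //; lra.
 apply: Req_le; f_equal. rewrite /Re /Im /=; ring.
 apply: Rle_trans (Rle_trans _ _ _ l2 _); last by apply: Rmult_le_compat_l => //; lra.
 apply: Req_le; f_equal. rewrite /Re /Im /=; ring.
Qed.

Lemma diff2 (f : R -> R -> R) (fx : R -> R -> R) x y fy :
  locally_2d (fun u v => is_derive (fun t => f t v) u (fx u v)) x y ->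
  is_derive (fun t => f x t) y fy ->
  continuous (fun p : R * R => fx (fst p) (snd p)) (x, y) ->
  differentiable_pt_lim f x y (fx x y) fy.
Proof.
move=> /locally_2d_locally h1 h2 h3.
apply/filterdiff_differentiable_pt_lim.
exact: is_derive_filterdiff h1 h2 h3.
Qed.

Lemma cont1 (h : R -> R) (g : R * R -> R) (p : R * R) :
  continuous g p -> ex_derive h (g p) -> continuous (fun p => h (g p)) p.
Proof. move=> hg hh; apply: continuous_comp hg _. exact: ex_derive_continuous. Qed.
Lemma cfst (p : R * R) : continuous (fun p : R * R => fst p) p.
Proof. exact: continuous_fst. Qed.
Lemma csnd (p : R * R) : continuous (fun p : R * R => snd p) p.
Proof. exact: continuous_snd. Qed.
Lemma cmul (f g : R * R -> R) p : continuous f p -> continuous g p -> continuous (fun p => f p * g p) p.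
Proof. move=> hf hg. exact: (continuous_mult (K:=R_AbsRing) f g p hf hg). Qed.
Lemma cadd (f g : R * R -> R) p : continuous f p -> continuous g p -> continuous (fun p => f p + g p) p.
Proof. move=> hf hg. exact: (continuous_plus (V:=R_NormedModule) f g p hf hg). Qed.
Lemma cinv (f : R * R -> R) p : f p <> 0 -> continuous f p -> continuous (fun p => / f p) p.
Proof. move=> h hf. apply: cont1 => //. by auto_derive. Qed.

Lemma isD_exp (z : C) : isD Cexp z (Cexp z).
Proof.
apply: (isD_CR (fun x y => exp x * cos y) (fun x y => exp x * sin y) z).
- apply: (diff2 _ (fun x y => exp x * cos y)).
  + apply: locally_2d_forall => u v; auto_derive => //; ring.
  + auto_derive => //; ring.
  + apply: cmul. apply: cont1 (cfst _) _; by auto_derive.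
    apply: cont1 (csnd _) _; by auto_derive.
- apply: (diff2 _ (fun x y => exp x * sin y)).
  + apply: locally_2d_forall => u v; auto_derive => //; ring.
  + auto_derive => //; ring.
  + apply: cmul. apply: cont1 (cfst _) _; by auto_derive.
    apply: cont1 (csnd _) _; by auto_derive.
Qed.

Lemma loc_im_neq0 (x y : R) : y <> 0 -> locally_2d (fun u v => 0 < v * y) x y.
Proof.
move=> hy. exists (mkposreal (Rabs y) (Rabs_pos_lt _ hy)) => u v _ /= hv.
move: hv; rewrite /Rabs; case: Rcase_abs; case: Rcase_abs => *; nra.
Qed.

Lemma isD_log (z : C) : Im z <> 0 -> exists l, isD Clog z l.
Proof.
case: z => x y; rewrite /Im /= => hy.
pose s := match Rlt_dec 0 y with left _ => PI / 2 | right _ => - (PI / 2) end.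
have pos : forall u v, 0 < v * y -> 0 < u ^ 2 + v ^ 2 by move=> u v h; nra.
eexists; apply: (is_derive_ext_loc (V:=C_NormedModule) (fun w : C => (ln (sqrt ((Re w)^2 + (Im w)^2)), s - atan (Re w / Im w)))).
  apply/locally_C.
  apply: (filter_imp (fun p : R * R => Clog (fst p, snd p) = (ln (sqrt (fst p ^ 2 + snd p ^ 2)), s - atan (fst p / snd p)))).
    by case=> u v /= ->.
  apply: (proj1 (locally_2d_locally (fun u v => Clog (u, v) = (ln (sqrt (u ^ 2 + v ^ 2)), s - atan (u / v))) x y)).
  apply: locally_2d_impl (loc_im_neq0 x y hy); apply: locally_2d_forall => u v h.
  rewrite /Clog /Cmod /Carg /Re /Im /s /=; f_equal.
  by case: Rlt_dec => h1; case: Rlt_dec => h2 //; try case: Rlt_dec => h3 //; nra.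
apply: (isD_CR (fun u v => ln (sqrt (u^2+v^2))) (fun u v => s - atan (u/v)) (x,y) (x/(x^2+y^2)) (- y/(x^2+y^2))).
- rewrite /Re /Im /=. apply: (diff2 _ (fun x y => x / (x^2+y^2))).
  + apply: locally_2d_impl (loc_im_neq0 x y hy); apply: locally_2d_forall => u v h.
    have hp := pos u v h. have hs := sqrt_lt_R0 _ hp. have hss := sqrt_sqrt _ (Rlt_le _ _ hp).
    auto_derive; first by rewrite /= in hp hs; repeat split => //; lra.
    rewrite -{3}hss. simpl in *. field. simpl; lra.
  + have hp : 0 < x^2+y^2 by apply: pos; nra.
    have hs := sqrt_lt_R0 _ hp. have hss := sqrt_sqrt _ (Rlt_le _ _ hp).
    auto_derive; first by rewrite /= in hp hs; repeat split => //; lra.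
    rewrite -{3}hss. simpl in *. field. simpl; lra.
  + apply: cmul. apply: cfst. apply: cinv => /=. nra.
    apply: cadd; [apply: (cont1 (fun t => t ^ 2) _ _ (cfst _)) | apply: (cont1 (fun t => t ^ 2) _ _ (csnd _))]; by auto_derive.
- rewrite /Re /Im /=. have -> : x/(x^2+y^2) = x / y^2 / (1 + (x/y)^2) by field; nra.
  apply: (diff2 _ (fun x y => - y/(x^2+y^2))).
  + apply: locally_2d_impl (loc_im_neq0 x y hy); apply: locally_2d_forall => u v h.
    have hp := pos u v h. have hv : v <> 0 by nra.
    auto_derive => //. field. repeat split; nra.
  + auto_derive => //. field. repeat split; nra.
  + apply: cmul. apply: (cont1 Ropp _ _ (csnd _)); by auto_derive. apply: cinv => /=. nra.
    apply: cadd; [apply: (cont1 (fun t => t ^ 2) _ _ (cfst _)) | apply: (cont1 (fun t => t ^ 2) _ _ (csnd _))]; by auto_derive.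
Qed.

Lemma isD_comp f g (z l m : C) : isD f (g z) l -> isD g z m -> isD (fun w => f (g w)) z (m * l)%C.
Proof. move=> hf /isDE hg. exact: (is_derive_comp f g z l m hf hg). Qed.
Lemma isD_mult f g (z l m : C) : isD f z l -> isD g z m -> isD (fun w => f w * g w)%C z (l * g z + f z * m)%C.
Proof. move=> /isDE hf /isDE hg. apply/isDE. apply: (is_derive_mult f g z l m hf hg). exact: Cmult_comm. Qed.
Lemma isD_lin (a b z : C) : isD (fun w => a * w + b)%C z a.
Proof.
apply: isD_eps => eps; exists eps => w _.
have -> : (a * w + b - (a * z + b) - (w - z) * a = 0)%C by ring.
rewrite Cmod_0. apply: Rmult_le_pos (Cmod_ge_0 _). by case: eps => e /=; lra.
Qed.

Lemma isD_inv (z : C) : z <> 0 -> exists l, isD Cinv z l.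
Proof.
case: z => x y hz.
have hp : 0 < x ^ 2 + y ^ 2.
  apply: Rnot_le_lt => h; apply: hz; rewrite /RtoC; f_equal; nra.
have near : locally_2d (fun u v => 0 < u ^ 2 + v ^ 2) x y.
  apply/locally_2d_locally.
  have hc : continuous (fun p : R * R => fst p ^ 2 + snd p ^ 2) (x, y).
    apply: cadd; [apply: (cont1 (fun t => t ^ 2) _ _ (cfst _)) | apply: (cont1 (fun t => t ^ 2) _ _ (csnd _))]; by auto_derive.
  exact: (hc _ (open_gt 0 _ hp)).
exists ((y ^ 2 - x ^ 2) / (x ^ 2 + y ^ 2) ^ 2, 2 * x * y / (x ^ 2 + y ^ 2) ^ 2).
apply: (isD_CR (fun u v => u / (u ^ 2 + v ^ 2)) (fun u v => - v / (u ^ 2 + v ^ 2)) (x, y)).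
- rewrite /Re /Im /=; apply: (diff2 _ (fun x y => (y ^ 2 - x ^ 2) / (x ^ 2 + y ^ 2) ^ 2)).
  + apply: locally_2d_impl near; apply: locally_2d_forall => u v h.
    auto_derive; first by simpl in h; lra.
    by field; simpl in h; lra.
  + auto_derive; first by simpl in hp; lra.
    by field; simpl in hp; lra.
  + apply: cmul.
      apply: cadd; [apply: (cont1 (fun t => t ^ 2) _ _ (csnd _)) | apply: (cont1 (fun t => - t ^ 2) _ _ (cfst _))]; by auto_derive.
    apply: cinv => /=; first by nra.
    apply: (cont1 (fun t => t ^ 2)); last by auto_derive.
    apply: cadd; [apply: (cont1 (fun t => t ^ 2) _ _ (cfst _)) | apply: (cont1 (fun t => t ^ 2) _ _ (csnd _))]; by auto_derive.
- rewrite /Re /Im /=; apply: (diff2 _ (fun x y => 2 * x * y / (x ^ 2 + y ^ 2) ^ 2)).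
  + apply: locally_2d_impl near; apply: locally_2d_forall => u v h.
    auto_derive; first by simpl in h; lra.
    by field; simpl in h; lra.
  + auto_derive; first by simpl in hp; lra.
    by field; simpl in hp; lra.
  + apply: cmul.
      apply: cmul; last exact: csnd.
      by apply: (cont1 (fun t => 2 * t) _ _ (cfst _)); auto_derive.
    apply: cinv => /=; first by nra.
    apply: (cont1 (fun t => t ^ 2)); last by auto_derive.
    apply: cadd; [apply: (cont1 (fun t => t ^ 2) _ _ (cfst _)) | apply: (cont1 (fun t => t ^ 2) _ _ (csnd _))]; by auto_derive.
Qed.

Lemma isD_mobius g (z : C) : 0 < Im z -> exists l, isD (mobius g) z l.
Proof.
move=> hz; have [l hl] := isD_inv _ (autj_neq0 g z hz).
eexists; apply: isD_mult; first exact: isD_lin.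
apply: (isD_comp Cinv (autj g) z l); first exact: hl.
exact: isD_lin.
Qed.

Lemma isD_autj_pow g s (z : C) : 0 < Im z -> exists l, isD (fun w => Crpow (autj g w) s) z l.
Proof.
move=> hz; case: (Req_dec (IZR (sc g)) 0) => hc.
  exists (@zero C_NormedModule).
  apply: (is_derive_ext (V:=C_NormedModule) (fun _ => Crpow (IZR (sd g)) s)).
    by move=> t; rewrite /autj hc; f_equal; ring.
  exact: is_derive_const.
have hj : Im (autj g z) <> 0.
  rewrite /autj /Im /=; move: hz; rewrite /Im => hz.
  have -> : IZR (sc g) * snd z + 0 * fst z + 0 = IZR (sc g) * snd z by ring.
  by apply: Rmult_integral_contrapositive; split => //; lra.
have [l hl] := isD_log _ hj.
eexists; apply: (isD_comp Cexp (fun w => s * Clog (autj g w))%C); first exact: isD_exp.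
apply: (isD_comp (fun t => s * t)%C (fun w => Clog (autj g w))).
  apply: (is_derive_ext (V:=C_NormedModule) (fun t => s * t + 0)%C); last exact: isD_lin.
  by move=> t; apply: Cplus_0_r.
apply: (isD_comp Clog (autj g)); first exact: hl.
exact: isD_lin.
Qed.

Lemma ext_in (f : UHP -> C) (z : C) (h : 0 < Im z) : ext f z = f (mkUHP z h).
Proof. by rewrite /ext; case: Rlt_dec => // h'; rewrite (proof_irrelevance _ h h'). Qed.

Lemma near_UHP (tau : UHP) : locally (T:=AbsRing_UniformSpace C_AbsRing) (uhp_val tau) (fun z : C => 0 < Im z).
Proof.
apply/locally_C; case: tau => [[x y] hy].
exact: (csnd (x, y) _ (open_gt 0 _ hy)).
Qed.

Lemma slash_holomorphic k g f : holomorphic f -> holomorphic (slash k g f).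
Proof.
move=> hf tau; have ht := uhp_im tau.
have [l hl] := isD_autj_pow g (- k) _ ht.
have [m hm] := isD_mobius g _ ht.
have [p hp] := hf (act g tau).
eexists; apply: (is_derive_ext_loc (V:=C_NormedModule)
  (fun z => Crpow (autj g z) (- k) * ext f (mobius g z))%C).
  apply: filter_imp (near_UHP tau) => z hz.
  by rewrite (ext_in _ z hz) (ext_in _ (mobius g z) (mobius_im g z hz)).
apply: isD_mult; first exact: hl.
apply: (isD_comp (ext f) (mobius g)); [exact: hp | exact: hm].
Qed.

Definition slash_Hol (k : R) (g : SL2Z) (f : Hol) : Hol :=
  exist _ (slash k g f) (slash_holomorphic k g f (proj2_sig f)).

Definition modular_form (w : Z) (f : fun_UHP) : Prop :=
  holomorphic f /\
  (forall g tau, slash (IZR w) g f tau = f tau) /\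
  holomorphic_at_cusp f.

Lemma ext_zero (z : C) : ext (@zero fun_UHP) z = 0.
Proof. by rewrite /ext; case: Rlt_dec. Qed.

Lemma ext_plus (f g : fun_UHP) (z : C) : ext (plus f g) z = (ext f z + ext g z)%C.
Proof. by rewrite /ext; case: Rlt_dec => // _; rewrite Cplus_0_r. Qed.

Lemma ext_scal (a : C) (f : fun_UHP) (z : C) : ext (scal a f) z = (a * ext f z)%C.
Proof. by rewrite /ext; case: Rlt_dec => // _; rewrite Cmult_0_r. Qed.

Definition holomorphic_with_cusp (f : fun_UHP) : Prop :=
  holomorphic f /\ holomorphic_at_cusp f.

Lemma holomorphic_with_cusp_subspace : is_subspace holomorphic_with_cusp.
Proof.
split.
- split.
    move=> tau; exists (@zero C_NormedModule).
    apply: (is_derive_ext (V:=C_NormedModule) (fun _ => RtoC 0)).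
      by move=> t; rewrite ext_zero.
    exact: is_derive_const.
  by exists (fun _ => RtoC 0); split => // z _; exact: ex_derive_const.
- move=> f1 f2 [h1 [g1 [d1 e1]]] [h2 [g2 [d2 e2]]]; split.
    move=> tau; apply: (ex_derive_ext (V:=C_NormedModule) (fun z => plus (ext f1 z) (ext f2 z))).
      by move=> t; rewrite ext_plus.
    by apply: (ex_derive_plus (V:=C_NormedModule)).
  exists (fun z => plus (g1 z) (g2 z)); split.
    by move=> z hz; apply: (ex_derive_plus (V:=C_NormedModule)); [exact: d1 | exact: d2].
  by move=> tau; rewrite -e1 -e2.
- move=> a f [h [g [d e]]]; split.
    move=> tau; have [l hl] := h tau; eexists.
    apply: (is_derive_ext (V:=C_NormedModule) (fun z => a * ext f z)%C).
      by move=> t; rewrite ext_scal.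
    by apply: isD_mult; [exact: is_derive_const | exact: hl].
  exists (fun z => a * g z)%C; split.
    move=> z hz; have [l hl] := d z hz; eexists.
    by apply: isD_mult; [exact: is_derive_const | exact: hl].
  by move=> tau; rewrite -e.
Qed.

Lemma modular_form_subspace (w : Z) : is_subspace (modular_form w).
Proof.
have [h0 hp hs] := holomorphic_with_cusp_subspace.
split.
- have [h c] := h0; split=> //; split=> // g tau; exact: Cmult_0_r.
- move=> f1 f2 [a1 [b1 c1]] [a2 [b2 c2]].
  have [h c] := hp _ _ (conj a1 c1) (conj a2 c2); split=> //; split=> // g tau.
  rewrite -[in RHS](_ : (slash (IZR w) g f1 tau + slash (IZR w) g f2 tau)%C = plus f1 f2 tau).
    exact: Cmult_plus_distr_l.
  by rewrite b1 b2.
- move=> a f [a1 [b1 c1]].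
  have [h c] := hs a _ (conj a1 c1); split=> //; split=> // g tau.
  rewrite -[in RHS](_ : (a * slash (IZR w) g f tau)%C = scal a f tau); last by rewrite b1.
  rewrite /slash (_ : scal a f (act g tau) = a * f (act g tau))%C //.
  by change (Crpow (autj g tau) (- IZR w) * (a * f (act g tau))
    = a * (Crpow (autj g tau) (- IZR w) * f (act g tau)))%C; ring.
Qed.

(* The families (b_0, ..., b_n) with b_r of weight K - 2 r, extended by 0 to
   all r. *)
Definition in_direct_sum (n : nat) (K : Z) (b : fct_ModuleSpace nat fun_UHP) : Prop :=
  (forall r, (r <= n)%nat -> modular_form (K - 2 * Z.of_nat r) (b r)) /\
  (forall r, (n < r)%nat -> b r = zero).

Lemma direct_sum_subspace (n : nat) (K : Z) : is_subspace (in_direct_sum n K).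
Proof.
split.
- by split=> // r _; apply: subspace_zero (modular_form_subspace _).
- move=> x y [x1 x2] [y1 y2]; split=> r hr.
    by apply: (subspace_plus _ (modular_form_subspace _)); [exact: x1 | exact: y1].
  have -> : plus x y r = plus (x r) (y r) by [].
  by rewrite x2 // y2 //; apply: plus_zero_r.
- move=> a x [x1 x2]; split=> r hr.
    by apply: (subspace_scal _ (modular_form_subspace _)); exact: x1.
  have -> : scal a x r = scal a (x r) by [].
  by rewrite x2 //; apply: scal_zero_r.
Qed.

Definition direct_sum (n : nat) (K : Z) : ModuleSpace C_Ring :=
  sub_ModuleSpace _ (in_direct_sum n K) (direct_sum_subspace n K).

Definition family {n : nat} {K : Z} (b : direct_sum n K) : nat -> UHP -> C := proj1_sig b.

Definition operators : ModuleSpace C_Ring := fct_ModuleSpace Hol fun_UHP.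

Definition is_MLDO (n : nat) (k : R) (K : Z) (L : operators) : Prop :=
  (exists a : nat -> UHP -> C,
     (forall r, (r <= n)%nat -> holomorphic_with_cusp (a r)) /\
     (forall (f : Hol) (tau : UHP),
        L f tau = sum_n (fun r => (a r tau * Dqn r f tau)%C) n)) /\
  (forall (g : SL2Z) (f : Hol) (tau : UHP),
     L (slash_Hol k g f) tau = slash (k + IZR K) g (L f) tau).

Lemma MLDO_subspace (n : nat) (k : R) (K : Z) : is_subspace (is_MLDO n k K).
Proof.
have [h0 hp hs] := holomorphic_with_cusp_subspace.
split.
- split; last by move=> g f tau; symmetry; exact: Cmult_0_r.
  exists (fun _ => @zero fun_UHP); split; first by move=> r _; exact: h0.
  move=> f tau; rewrite (sum_n_ext _ (fun _ => mult (@zero C_Ring) (@zero C_Ring))).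
    by rewrite sum_n_mult_l mult_zero_l.
  by move=> r; rewrite mult_zero_l; exact: Cmult_0_l.
- move=> L1 L2 [[a1 [r1 e1]] q1] [[a2 [r2 e2]] q2]; split.
    exists (fun r => @plus fun_UHP (a1 r) (a2 r)); split.
      by move=> r hr; apply: hp; [exact: r1 | exact: r2].
    move=> f tau; rewrite (_ : plus L1 L2 f tau = plus (L1 f tau) (L2 f tau)) // e1 e2 -sum_n_plus.
    by apply: sum_n_ext => r; symmetry; exact: Cmult_plus_distr_r.
  move=> g f tau; symmetry.
  rewrite (_ : plus L1 L2 (slash_Hol k g f) tau
             = L1 (slash_Hol k g f) tau + L2 (slash_Hol k g f) tau)%C // q1 q2.
  exact: Cmult_plus_distr_l.
- move=> c L [[a [ra e]] q]; split.
    exists (fun r => @scal _ fun_UHP c (a r)); split.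
      by move=> r hr; apply: hs; exact: ra.
    move=> f tau; rewrite (_ : scal c L f tau = mult (c : C_Ring) (L f tau)) // e -sum_n_mult_l.
    by apply: sum_n_ext => r; exact: Cmult_assoc.
  move=> g f tau.
  rewrite (_ : scal c L (slash_Hol k g f) tau = c * L (slash_Hol k g f) tau)%C // q.
  rewrite /slash (_ : scal c L f (act g tau) = c * L f (act g tau))%C //.
  by change (c * (Crpow (autj g tau) (- (k + IZR K)) * L f (act g tau))
    = Crpow (autj g tau) (- (k + IZR K)) * (c * L f (act g tau)))%C; ring.
Qed.

Definition MLDO (n : nat) (k : R) (K : Z) : ModuleSpace C_Ring :=
  sub_ModuleSpace _ (is_MLDO n k K) (MLDO_subspace n k K).

Definition operator {n : nat} {k : R} {K : Z} (L : MLDO n k K) : Hol -> UHP -> C :=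
  proj1_sig L.

(* The sum of an absolutely convergent complex series. *)
Definition CSeries (a : nat -> C) : C :=
  (Series (fun m => Re (a m)), Series (fun m => Im (a m))).

Definition E2 : UHP -> C := fun tau =>
  (1 - 24 * CSeries (fun m =>
     INR (S m) * qpar tau ^ S m / (1 - qpar tau ^ S m)))%C.

Definition E4 : UHP -> C := fun tau =>
  (1 + 240 * CSeries (fun m =>
     INR (S m) ^ 3 * qpar tau ^ S m / (1 - qpar tau ^ S m)))%C.

Definition serre (j : R) (g : UHP -> C) : UHP -> C :=
  fun tau => (Dq g tau - (j / 12)%R * E2 tau * g tau)%C.

Fixpoint serre_iter (k : R) (r : nat) (f : UHP -> C) : UHP -> C :=
  match r with
  | O => f
  | S m => serre (k + 2 * INR m) (serre_iter k m f)
  end.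

Fixpoint serre_canonical (k : R) (r : nat) (f : UHP -> C) : UHP -> C :=
  match r with
  | O => f
  | S O => serre k f
  | S (S m as n) => fun tau =>
      (serre (k + 2 * INR n) (serre_canonical k n f) tau
       - (INR n * (INR n + k - 1) / 144)%R * E4 tau * serre_canonical k m f tau)%C
  end.

(* x (x - 1) ... (x - m + 1) / m! *)
Fixpoint gbinom (x : R) (m : nat) : R :=
  match m with
  | O => 1
  | S m' => gbinom x m' * (x - INR m') / INR (S m')
  end.

Definition rankin_cohen (k l : R) (n : nat) (f g : UHP -> C) : UHP -> C := fun tau =>
  sum_n (fun i =>
    (((-1) ^ i * gbinom (INR n + k - 1) (n - i) * gbinom (INR n + l - 1) i)%R
      * Dqn i f tau * Dqn (n - i) g tau)%C) n.

(* D^n f - (k+n-1)/12 [E2, f]_{n-1}^{(2,k)}.  The order of the two arguments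
   matters: [f, E2]_{n-1}^{(k,2)} = (-1)^(n-1) [E2, f]_{n-1}^{(2,k)}, and with
   the sign convention of rankin_cohen only the order E2, f makes the operator
   equivariant for even n; for n = 2 it is
   D^2 f - (k+1)/6 E2 Df + k(k+1)/12 (D E2) f. *)
Definition kaneko_koike (k : R) (n : nat) (f : UHP -> C) : UHP -> C :=
  match n with
  | O => f
  | S m => fun tau =>
      (Dqn n f tau - ((k + INR n - 1) / 12)%R * rankin_cohen 2 k m E2 f tau)%C
  end.

Definition is_expansion (T : nat -> (UHP -> C) -> UHP -> C) {n : nat} {k : R} {K : Z}
    (L : MLDO n k K) (b : direct_sum n K) : Prop :=
  forall (f : Hol) (tau : UHP),
    operator L f tau = sum_n (fun r => (family b r tau * T r f tau)%C) n.

Definition expansion_isomorphism (T : nat -> (UHP -> C) -> UHP -> C)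
    (n : nat) (k : R) (K : Z) : Prop :=
  (forall L : MLDO n k K, exists! b : direct_sum n K, is_expansion T L b) /\
  (exists phi : MLDO n k K -> direct_sum n K,
     (forall L, is_expansion T L (phi L)) /\ linear_isomorphism phi).

(* Main.v *)
(** An operator [sum_r a_r D^r] acts on polynomials in [tau], so its coefficients are
    determined by the operator.  Each of the three families [T_r] has the form
    [D^r + lower order terms] with coefficients that are power series in [q], and maps
    weight [k] to weight [k + 2r] equivariantly.  Testing an equivariant [L] of order [n]
    on [f = (tau - gamma tau_0)^n], which the slash action sends to
    [(tau - tau_0)^n] times a nonvanishing function, shows that the leading coefficient
    [a_n] is a modular form of weight [K - 2n]; subtracting [a_n T_n] lowers the order.

    Equivariance of the families rests on [E2|gamma = E2 + 12 X] and [E4|gamma = E4], with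
    [X = c / (2 pi i (c tau + d))].  Under [S] these come from the lattice sums
    [sum_{n >= 1} sum_m (n tau + m)^-s], [s = 2, 4], obtained by partial fractions; for
    [s = 2] the order of summation matters, and the defect [pi i / tau] is found by
    subtracting a second difference of [log (n tau + m)], which makes the double sum
    absolutely convergent and telescopes in both directions.

    Holomorphic means here complex differentiable, so iterating [D] needs Goursat's theorem
    and Cauchy's formula. *)
Require Import Defs.
From Stdlib Require Import Reals ZArith Lra Lia ProofIrrelevance ssreflect ssrfun.
From Stdlib Require Import FunctionalExtensionality ClassicalEpsilon.
From Coquelicot Require Import Coquelicot.
Open Scope R_scope.

(** * Complex derivatives *)

(** Equivariance has two non-formal inputs, the laws of [E2] and [E4] under $\tau\mapsto-1/\tau$.
    Both rest on the duplication formula $2^sG(w)=G(w/2)+G(w/2+1/2)$ of $G(w)=\sum_j(w+j)^{-s}$: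
    iterated, it writes a rational function of $e^{2\pi iw}$ as a lattice row without residues, and
    $\zeta(2)$, $\zeta(4)$ come out of the same series at $w=1/2$.

    The Kaneko-Koike operators are the family whose equivariance does not follow a recursion. There
    $(D^nf)|\gamma$ is treated as a polynomial in a free variable $x$; $x=X$ gives the slash and
    $x=0$ gives $D^n(f|\gamma)$. The derivative in $x$ lowers $n$, a Rankin-Cohen bracket is built
    to kill it, and the extra term $12x$ carried by [E2] cancels the derivative of $D^nf$ itself:
    this fixes the factor $(k+n-1)/12$.

    Because the weight $k$ is real, powers of $c\tau+d$ depend on a branch and need not form a
    cocycle in $\gamma$. The arguments in weight $k$ therefore use one $\gamma$ at a time; only the
    integer-weight laws of [E2] and [E4] are composed. *)

Notation isD := (@is_derive C_AbsRing C_NormedModule).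
Notation isDR := (@is_derive R_AbsRing C_R_NormedModule).

Lemma isD_epsE f (z l : C) : isD f z l <->
  (forall eps, 0 < eps -> exists del, 0 < del /\ forall w : C, Cmod (w - z) < del ->
     Cmod (f w - f z - (w - z) * l) <= eps * Cmod (w - z)).
Proof.
split.
- case=> _ h eps he.
  have h1 := h z (fun P h => h) (mkposreal _ he).
  have [d hd] := h1; exists d; split; first by case: d {hd}.
  by move=> w hw; apply: hd.
- move=> h; apply: isD_eps => eps; have [d [hd h1]] := h eps (cond_pos eps).
  (* Neighbourhoods of the product uniform structure are squares; halving the radius puts the square
     inside the disc. *)
  exists (mkposreal _ (Rdiv_lt_0_compat _ _ hd (Rlt_0_2))) => w [hw1 hw2]; apply: h1.
  have hc : Cmod (w - z)%C <= Rabs (fst (w - z)%C) + Rabs (snd (w - z)%C).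
    move: (w - z)%C => [p1 p2]; rewrite {1}(_ : (p1, p2) = (RtoC p1 + RtoC p2 * Ci)%C); last first.
      by rewrite /Cplus /Cmult /=; f_equal; ring.
    apply: Rle_trans (Cmod_triangle _ _) _.
    rewrite Cmod_mult Cmod_Ci !Cmod_R /=; lra.
  have k1 : Rabs (fst (w - z)%C) < d / 2 by exact: hw1.
  have k2 : Rabs (snd (w - z)%C) < d / 2 by exact: hw2.
  lra.
Qed.

Lemma normCR (x : C) : @norm R_AbsRing C_R_NormedModule x = Cmod x.
Proof.
case: x => x y; rewrite /norm /= /prod_norm /Cmod /= /norm /= /abs /=.
by rewrite !Rmult_1_r -!Rabs_mult !Rabs_pos_eq //; apply: Rle_0_sqr.
Qed.

Lemma scalCR (r : R) (l : C) : @scal R_Ring C_R_NormedModule r l = (RtoC r * l)%C.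
Proof. by case: l => x y; rewrite /scal /= /prod_scal /Cmult /scal /= /mult /=; f_equal; ring. Qed.

Lemma isDR_epsE (f : R -> C) (t : R) (l : C) : isDR f t l <->
  (forall eps, 0 < eps -> exists del, 0 < del /\ forall s, Rabs (s - t) < del ->
     Cmod (f s - f t - RtoC (s - t) * l) <= eps * Rabs (s - t)).
Proof.
split.
- case=> _ h eps he.
  have h1 := h t (fun P h => h) (mkposreal _ he).
  have [d hd] := h1; exists d; split; first by case: d {hd}.
  by move=> s hs; have := hd s hs; rewrite scalCR normCR.
- move=> h; split; first exact: is_linear_scal_l.
  move=> x hx.
  have -> : x = t by symmetry; apply: (is_filter_lim_locally_unique (K:=R_AbsRing) (V:=AbsRing_NormedModule R_AbsRing)) hx.
  move=> eps; have [d [hd h1]] := h eps (cond_pos eps).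
  by exists (mkposreal _ hd) => s hs; rewrite scalCR normCR; apply: h1.
Qed.

Lemma isD_C_derive f (z l : C) : isD f z l -> C_derive f z = l.
Proof. exact: is_C_derive_unique. Qed.

Lemma isD_unique f (z l m : C) : isD f z l -> isD f z m -> l = m.
Proof. by move=> /isD_C_derive <- /isD_C_derive. Qed.

Lemma isD_const (c z : C) : isD (fun _ => c) z (RtoC 0).
Proof. exact: is_derive_const. Qed.

Lemma isD_id (z : C) : isD (fun w => w) z (RtoC 1).
Proof.
apply: (is_derive_ext (V:=C_NormedModule) (fun w => 1 * w + 0)%C); last exact: isD_lin.
by move=> w; rewrite Cmult_1_l Cplus_0_r.
Qed.

Lemma isD_plus f g (z l m : C) : isD f z l -> isD g z m -> isD (fun w => f w + g w)%C z (l + m)%C.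
Proof. exact: (is_derive_plus (V:=C_NormedModule)). Qed.

Lemma isD_minus f g (z l m : C) : isD f z l -> isD g z m -> isD (fun w => f w - g w)%C z (l - m)%C.
Proof. exact: (is_derive_minus (V:=C_NormedModule)). Qed.

Lemma isD_val f (z l m : C) : isD f z l -> l = m -> isD f z m.
Proof. by move=> h <-. Qed.

Lemma isD_ext (f g : C -> C) (z l : C) : (forall w : C, f w = g w) -> isD f z l -> isD g z l.
Proof. exact: (is_derive_ext (V:=C_NormedModule)). Qed.

Lemma isD_scal (c : C) f (z l : C) : isD f z l -> isD (fun w => c * f w)%C z (c * l)%C.
Proof. move=> h; apply: (isD_val _ _ _ _ (isD_mult _ _ _ _ _ (isD_const c z) h)); ring. Qed.

Lemma isD_pow n (z : C) : isD (fun w => w ^ n)%C z (INR n * z ^ (n - 1))%C.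
Proof.
elim: n => [|n IH]; first by apply: (isD_val _ _ _ _ (isD_const 1 z)); rewrite /=; ring.
apply: (isD_val _ _ _ _ (isD_mult _ _ _ _ _ (isD_id z) IH)).
rewrite S_INR RtoC_plus /= Nat.sub_0_r; case: n {IH} => [|n]; first by rewrite /=; ring.
by rewrite [(S n - 1)%nat]/= Nat.sub_0_r [(z ^ S n)%C]/=; ring.
Qed.

Lemma isD_cont f (z l : C) : isD f z l ->
  forall eps, 0 < eps -> exists del, 0 < del /\ forall w : C, Cmod (w - z) < del -> Cmod (f w - f z) < eps.
Proof.
move=> /isD_epsE h eps he; have [d [hd h1]] := h 1 Rlt_0_1.
have hm := Cmod_ge_0 l.
have hp : 0 < eps / (2 + Cmod l) by apply: Rdiv_lt_0_compat; lra.
exists (Rmin d (eps / (2 + Cmod l))); split; first exact: Rmin_pos.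
move=> w hw; have h2 := h1 w (Rlt_le_trans _ _ _ hw (Rmin_l _ _)).
have h3 := Rlt_le_trans _ _ _ hw (Rmin_r _ _).
have -> : (f w - f z = (f w - f z - (w - z) * l) + (w - z) * l)%C by ring.
apply: Rle_lt_trans (Cmod_triangle _ _) _; rewrite Cmod_mult.
have h4 : Cmod (w - z) * (2 + Cmod l) < eps.
  by apply (Rmult_lt_compat_r (2 + Cmod l)) in h3; [rewrite /Rdiv Rmult_assoc Rinv_l in h3; lra | lra].
have := Cmod_ge_0 (w - z)%C; nra.
Qed.

Lemma isD_local f g (z l : C) (d : R) : 0 < d ->
  (forall w, Cmod (w - z) < d -> f w = g w) -> isD f z l -> isD g z l.
Proof.
move=> hd e /isD_epsE h; apply/isD_epsE => eps he; have [d1 [hd1 h1]] := h eps he.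
exists (Rmin d d1); split; first exact: Rmin_pos.
move=> w hw; rewrite -!e; first by apply: h1; apply: Rlt_le_trans hw (Rmin_r _ _).
  by rewrite (_ : z - z = 0)%C; [rewrite Cmod_0 | ring].
by apply: Rlt_le_trans hw (Rmin_l _ _).
Qed.

(** [isD_inv] supplies some derivative $l$; its value follows from differentiating $w\cdot
    w^{-1}=1$, which holds near $z$ because $w\ne0$ there. *)
Lemma isD_Cinv (z : C) : z <> 0 -> isD Cinv z (- / (z * z))%C.
Proof.
move=> hz; have [l hl] : exists l : C, isD Cinv z l := isD_inv z hz.
have hm : 0 < Cmod z by apply/Cmod_gt_0.
have h1 : isD (fun w => w * / w)%C z (RtoC 1 * / z + z * l)%C by apply: isD_mult; [exact: isD_id | exact: hl].
have h2 : isD (fun w => w * / w)%C z (RtoC 0).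
  apply: (isD_local (fun _ => RtoC 1) _ _ _ _ hm) (isD_const _ _) => w hw.
  rewrite Cinv_r // => e; move: hw; rewrite e -Cmod_opp (_ : - (0 - z) = z)%C; [lra | ring].
have e := isD_unique _ _ _ _ h1 h2; apply: (isD_val _ _ _ _ hl).
have -> : l = (/ z * (1 * / z + z * l) - / z * / z)%C by field.
by rewrite e; field.
Qed.

(** Chain rule across scalar fields: a complex derivative is composed with a real one, so the two
    error terms are combined by hand. *)
Lemma isD_path (f : C -> C) (p : R -> C) (t : R) (l m : C) :
  isD f (p t) l -> isDR p t m -> isDR (fun s => f (p s)) t (m * l)%C.
Proof.
move=> /isD_epsE hf /isDR_epsE hp; apply/isDR_epsE => eps he.
have hm := Cmod_ge_0 m; have hl := Cmod_ge_0 l.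
have he1 : 0 < eps / (2 * (1 + Cmod m)) by apply: Rdiv_lt_0_compat; lra.
(* The bound 1 on the error rate of $p$ gives $|p(s)-p(t)|\le(1+|m|)|s-t|$; the other bound keeps
   the share of this error in the total at most half of [eps]. *)
have he2 : 0 < Rmin 1 (eps / (2 * (1 + Cmod l))).
  by apply: Rmin_pos; [lra | apply: Rdiv_lt_0_compat; lra].
have [d1 [hd1 h1]] := hf _ he1; have [d2 [hd2 h2]] := hp _ he2.
have hd3 : 0 < d1 / (1 + Cmod m) by apply: Rdiv_lt_0_compat; lra.
exists (Rmin d2 (d1 / (1 + Cmod m))); split; first exact: Rmin_pos.
move=> s hs; have a2 := h2 s (Rlt_le_trans _ _ _ hs (Rmin_l _ _)).
have a3 := Rlt_le_trans _ _ _ hs (Rmin_r _ _).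
set e2 := Rmin _ _ in he2 a2.
have b1 : e2 <= 1 by exact: Rmin_l.
have b2 : e2 * (2 * (1 + Cmod l)) <= eps.
  have := Rmin_r 1 (eps / (2 * (1 + Cmod l))); rewrite -/e2 => b.
  apply: (Rmult_le_reg_r (/ (2 * (1 + Cmod l)))); first by apply: Rinv_0_lt_compat; lra.
  by rewrite Rmult_assoc Rinv_r; [rewrite Rmult_1_r | lra].
have b3 : eps / (2 * (1 + Cmod m)) * (1 + Cmod m) = eps / 2 by field; lra.
have pa : 0 <= Rabs (s - t) by exact: Rabs_pos.
have c1 : Cmod (p s - p t) <= (1 + Cmod m) * Rabs (s - t).
  have -> : (p s - p t = (p s - p t - RtoC (s - t) * m) + RtoC (s - t) * m)%C by ring.
  apply: Rle_trans (Cmod_triangle _ _) _; rewrite Cmod_mult Cmod_R; nra.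
have c2 : Cmod (p s - p t) < d1.
  apply: Rle_lt_trans c1 _.
  apply (Rmult_lt_compat_l (1 + Cmod m)) in a3; last by lra.
  by move: a3; rewrite (_ : (1 + Cmod m) * (d1 / (1 + Cmod m)) = d1); last by field; lra.
have a1 := h1 _ c2.
have -> : (f (p s) - f (p t) - RtoC (s - t) * (m * l) =
  (f (p s) - f (p t) - (p s - p t) * l) + (p s - p t - RtoC (s - t) * m) * l)%C by ring.
apply: Rle_trans (Cmod_triangle _ _) _; rewrite Cmod_mult.
set k := eps / (2 * (1 + Cmod m)) in he1 a1 b3.
have g1 : k * Cmod (p s - p t) <= eps / 2 * Rabs (s - t).
  rewrite -b3 Rmult_assoc; apply: Rmult_le_compat_l => //; lra.
have g2 : Cmod (p s - p t - RtoC (s - t) * m) * Cmod l <= eps / 2 * Rabs (s - t).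
  apply: Rle_trans (_ : e2 * Rabs (s - t) * Cmod l <= _); first exact: Rmult_le_compat_r.
  nra.
lra.
Qed.

(** * Integrals of complex functions along segments *)

Notation is_CInt := (@is_RInt C_R_NormedModule).
Notation CInt := (@RInt C_R_CompleteNormedModule).

Lemma is_derive_Re (g : R -> C) (t : R) (l : C) : isDR g t l -> is_derive (fun s => Re (g s)) t (Re l).
Proof.
move=> /isDR_epsE h; split; first exact: is_linear_scal_l.
move=> x hx.
have -> : x = t by symmetry; apply: (is_filter_lim_locally_unique (K:=R_AbsRing) (V:=AbsRing_NormedModule R_AbsRing)) hx.
move=> eps; have [d [hd h1]] := h eps (cond_pos eps).
exists (mkposreal _ hd) => s hs; apply: Rle_trans (h1 s hs).
have <- : Re (g s - g t - RtoC (s - t) * l)%C = minus (minus (Re (g s)) (Re (g t))) (scal (minus s t) (Re l)).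
  by rewrite /minus /plus /opp /scal /= /mult /=; rewrite /Re /=; ring.
exact: re_le_Cmod.
Qed.

Lemma isDR_scal (c : C) (g : R -> C) (t : R) (l : C) : isDR g t l -> isDR (fun s => c * g s)%C t (c * l)%C.
Proof.
move=> h; rewrite Cmult_comm; apply: (isD_path (fun w => c * w)%C g) h.
apply: (isD_val _ _ _ _ (isD_scal c _ _ _ (isD_id _))); ring.
Qed.

(** For complex values an intermediate point need not exist. The real function $\mathrm{Re}(\bar
    v\,g)$ with $v=g(1)-g(0)$ has increment $|v|^2$, and the real mean value theorem applied to it
    gives $|v|^2\le|v|K$. *)
Lemma isDR_MVT (g g' : R -> C) (K : R) :
  (forall t, 0 <= t <= 1 -> isDR g t (g' t)) -> (forall t, 0 <= t <= 1 -> Cmod (g' t) <= K) ->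
  Cmod (g 1 - g 0)%C <= K.
Proof.
move=> hd hb; set v := (g 1 - g 0)%C.
case: (Req_dec (Cmod v) 0) => [->|hv]; first by apply: Rle_trans (hb 0 _); [exact: Cmod_ge_0 | lra].
have hv1 := Cmod_ge_0 v.
have [c [hc1 hc2]] : exists c, Rabs (Re (Cconj v * g 1)%C - Re (Cconj v * g 0)%C) =
    Rabs (Re (Cconj v * g' c)%C) * Rabs (1 - 0) /\ Rmin 0 1 <= c <= Rmax 0 1.
  apply: (MVT_abs (fun s => Re (Cconj v * g s)%C) (fun s => Re (Cconj v * g' s)%C)) => c hc.
  rewrite Rmin_left ?Rmax_right in hc; try lra.
  by apply/is_derive_Reals; apply: is_derive_Re; apply: isDR_scal; apply: hd.
rewrite Rmin_left ?Rmax_right in hc2; try lra.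
have e : Re (Cconj v * g 1)%C - Re (Cconj v * g 0)%C = Cmod v * Cmod v.
  have -> : Re (Cconj v * g 1)%C - Re (Cconj v * g 0)%C = Re (Cconj v * v)%C.
    by rewrite /v /Re /=; ring.
  rewrite -{2 3}/v; rewrite Cmult_comm -Cmod2_conj RtoC_pow /=; ring.
rewrite e in hc1.
have h1 : Rabs (Re (Cconj v * g' c)%C) <= Cmod v * K.
  apply: Rle_trans (re_le_Cmod _) _; rewrite Cmod_mult Cmod_conj.
  by apply: Rmult_le_compat_l => //; apply: hb.
rewrite Rabs_pos_eq in hc1; last by nra.
rewrite (_ : Rabs (1 - 0) = 1) in hc1; last by rewrite Rabs_pos_eq; lra.
by apply: (Rmult_le_reg_l (Cmod v)); [lra | nra].
Qed.

Definition seg (a b : C) (t : R) : C := (a + RtoC t * (b - a))%C.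

Lemma seg0 a b : seg a b 0 = a. Proof. rewrite /seg; ring. Qed.
Lemma seg1 a b : seg a b 1 = b. Proof. rewrite /seg; ring. Qed.

Lemma isDR_seg a b t : isDR (seg a b) t (b - a)%C.
Proof.
apply/isDR_epsE => eps he; exists 1; split; first lra.
move=> s _; rewrite (_ : seg a b s - seg a b t - RtoC (s - t) * (b - a) = 0)%C.
  rewrite Cmod_0; have := Rabs_pos (s - t); nra.
rewrite /seg RtoC_minus; ring.
Qed.

Lemma seg_MVT (f f' : C -> C) (a b : C) (K : R) :
  (forall t, 0 <= t <= 1 -> isD f (seg a b t) (f' (seg a b t))) ->
  (forall t, 0 <= t <= 1 -> Cmod (f' (seg a b t)) <= K) ->
  Cmod (f b - f a)%C <= K * Cmod (b - a)%C.
Proof.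
move=> hd hb; rewrite -{1}(seg1 a b) -{2}(seg0 a b).
apply: (isDR_MVT (fun t => f (seg a b t)) (fun t => (b - a) * f' (seg a b t))%C) => t ht.
  by apply: isD_path (isDR_seg a b t); apply: hd.
rewrite Cmod_mult Rmult_comm; apply: Rmult_le_compat_r; [exact: Cmod_ge_0 | exact: hb].
Qed.

Lemma isDR_continuous (g : R -> C) t l : isDR g t l -> continuous (U:=C_R_NormedModule) g t.
Proof. by move=> h; apply: ex_derive_continuous; exists l. Qed.

Lemma is_CInt_FTC (g g' : R -> C) (a b : R) : a <= b ->
  (forall t, a <= t <= b -> isDR g t (g' t)) ->
  (forall t, a <= t <= b -> continuous (U:=C_R_NormedModule) g' t) ->
  is_CInt g' a b (g b - g a)%C.
Proof.
move=> hab h1 h2; apply: (is_RInt_derive (V:=C_R_CompleteNormedModule) g g' a b) => x hx;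
  rewrite Rmin_left ?Rmax_right // in hx; [exact: h1 | exact: h2].
Qed.

Lemma ex_CInt (g : R -> C) (a b : R) : a <= b ->
  (forall t, a <= t <= b -> continuous (U:=C_R_NormedModule) g t) -> is_CInt g a b (CInt g a b).
Proof.
move=> hab h; apply: (RInt_correct (V:=C_R_CompleteNormedModule)).
apply: ex_RInt_continuous => t ht; rewrite Rmin_left ?Rmax_right // in ht; exact: h.
Qed.

Lemma is_CInt_unique (g : R -> C) a b l : is_CInt g a b l -> CInt g a b = l.
Proof. exact: (is_RInt_unique (V:=C_R_CompleteNormedModule)). Qed.

Lemma is_CInt_bound (g : R -> C) (a b M : R) l : a <= b ->
  (forall t, a <= t <= b -> Cmod (g t) <= M) -> is_CInt g a b l -> Cmod l <= (b - a) * M.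
Proof.
move=> hab hb hi; rewrite -normCR; apply: (norm_RInt_le_const g a b l M hab _ hi) => t ht.
by rewrite normCR; apply: hb.
Qed.

Lemma is_CInt_val (g : R -> C) (a b : R) (l m : C) : is_CInt g a b l -> l = m -> is_CInt g a b m.
Proof. by move=> h <-. Qed.

Definition seg_int (f : C -> C) (a b : C) : C := CInt (fun t => (b - a) * f (seg a b t))%C 0 1.

Definition convex (S : C -> Prop) := forall a b t, S a -> S b -> 0 <= t <= 1 -> S (seg a b t).

Section SegInt.
Variables (S : C -> Prop) (f : C -> C).
Hypothesis hS : convex S.
Hypothesis hf : forall z, S z -> exists l : C, isD f z l.

Lemma path_cont (c a b : C) t : S a -> S b -> 0 <= t <= 1 ->
  continuous (U:=C_R_NormedModule) (fun t => c * f (seg a b t))%C t.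
Proof.
move=> ha hb ht; have [l hl] := hf _ (hS _ _ _ ha hb ht).
exact: isDR_continuous (isDR_scal c _ _ _ (isD_path _ _ _ _ _ hl (isDR_seg a b t))).
Qed.

Lemma seg_int_is a b : S a -> S b -> is_CInt (fun t => (b - a) * f (seg a b t))%C 0 1 (seg_int f a b).
Proof. by move=> ha hb; apply: ex_CInt; [lra | move=> t ht; apply: path_cont]. Qed.

Lemma seg_int_bound a b M : S a -> S b -> (forall t, 0 <= t <= 1 -> Cmod (f (seg a b t)) <= M) ->
  Cmod (seg_int f a b) <= M * Cmod (b - a)%C.
Proof.
move=> ha hb h.
have h1 : forall t, 0 <= t <= 1 -> Cmod ((b - a) * f (seg a b t))%C <= Cmod (b - a)%C * M.
  by move=> t ht; rewrite Cmod_mult; apply: Rmult_le_compat_l; [exact: Cmod_ge_0 | exact: h].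
have := is_CInt_bound _ 0 1 _ _ Rle_0_1 h1 (seg_int_is a b ha hb); lra.
Qed.

Lemma seg_int_FTC F a b : (forall z, S z -> isD F z (f z)) -> S a -> S b -> seg_int f a b = (F b - F a)%C.
Proof.
move=> hF ha hb; apply: is_CInt_unique.
apply: (is_CInt_val _ _ _ (F (seg a b 1) - F (seg a b 0))%C); last by rewrite seg0 seg1.
apply: (is_CInt_FTC (fun t => F (seg a b t))); [lra | |].
- move=> t ht; apply: isD_path (isDR_seg a b t); apply: hF; exact: hS.
- by move=> t ht; apply: path_cont.
Qed.

(** Affine substitution $t\mapsto ut+v$. It serves both the splitting at the midpoint, $u=1/2$, and
    the reversal, $u=-1$. *)
Lemma seg_int_lin (u v : R) a b c d : S a -> S b -> S c -> S d -> seg a b v = c -> seg a b (u + v) = d ->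
  0 <= v <= 1 -> 0 <= u + v <= 1 ->
  is_CInt (fun t => (b - a) * f (seg a b t))%C v (u + v) (seg_int f c d).
Proof.
move=> ha hb hc hd ec ed hv huv.
have hex : ex_RInt (V:=C_R_CompleteNormedModule) (fun t => (b - a) * f (seg a b t))%C (u * 0 + v) (u * 1 + v).
  apply: ex_RInt_continuous => t; rewrite Rmult_0_r Rplus_0_l Rmult_1_r => ht; apply: path_cont => //.
  split; first by apply: Rle_trans (proj1 ht); apply: Rmin_glb; lra.
  by apply: Rle_trans (proj2 ht) _; apply: Rmax_lub; lra.
have := RInt_comp_lin (V:=C_R_CompleteNormedModule) _ u v 0 1 hex.
have := RInt_correct (V:=C_R_CompleteNormedModule) _ _ _ hex.
rewrite Rmult_0_r Rplus_0_l Rmult_1_r => h e2.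
apply: (is_CInt_val _ _ _ _ _ h); rewrite /seg_int -e2; apply: (RInt_ext (V:=C_R_CompleteNormedModule)) => t _.
rewrite scalCR -ec -ed /seg !RtoC_plus !RtoC_mult Cmult_assoc; congr (_ * f _)%C; ring.
Qed.

Lemma seg_int_split a b m : S a -> S b -> m = seg a b (1/2) -> (seg_int f a b = seg_int f a m + seg_int f m b)%C.
Proof.
move=> ha hb em.
have hm : S m by rewrite em; apply: hS => //; lra.
have h1 := seg_int_lin (1/2) 0 a b a m ha hb ha hm (seg0 a b).
have h2 := seg_int_lin (1/2) (1/2) a b m b ha hb hm hb (Logic.eq_sym em).
rewrite Rplus_0_r in h1; rewrite (_ : 1/2+1/2 = 1) in h2; last lra.
apply: is_CInt_unique; apply: (is_RInt_Chasles (V:=C_R_NormedModule)).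
  by apply: h1 => //; lra.
by apply: h2; [exact: seg1 | lra | lra].
Qed.

Lemma seg_int_rev a b : S a -> S b -> seg_int f b a = (- seg_int f a b)%C.
Proof.
move=> ha hb.
have h := seg_int_lin (-1) 1 a b b a ha hb hb ha (seg1 a b).
rewrite (_ : -1 + 1 = 0) in h; last lra.
have {}h := h (seg0 a b) ltac:(lra) ltac:(lra).
have h2 := is_RInt_swap (V:=C_R_NormedModule) _ _ _ _ h.
have e : seg_int f a b = (- seg_int f b a)%C by exact: (is_CInt_unique _ _ _ _ h2).
by rewrite e; ring.
Qed.

End SegInt.

(** * Goursat's theorem *)

Lemma RtoC_neq (r : R) : r <> 0 -> RtoC r <> 0.
Proof. by move=> h e; apply: h; apply: RtoC_inj. Qed.

Lemma Cmod_triangle3 (x y z : C) : Cmod (x + y + z)%C <= Cmod x + Cmod y + Cmod z.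
Proof. by apply: Rle_trans (Cmod_triangle _ _) _; apply: Rplus_le_compat_r; exact: Cmod_triangle. Qed.

Lemma Cmod_sym (x y : C) : Cmod (x - y)%C = Cmod (y - x)%C.
Proof. by rewrite -Cmod_opp; congr Cmod; ring. Qed.

Lemma Cmod_dist (x y z : C) : Cmod (x - z)%C <= Cmod (x - y)%C + Cmod (y - z)%C.
Proof. by rewrite (_ : x - z = (x - y) + (y - z))%C; [exact: Cmod_triangle | ring]. Qed.

Lemma C_cauchy (u : nat -> C) (b : nat -> R) : is_lim_seq b 0 ->
  (forall n m, (n <= m)%nat -> Cmod (u m - u n)%C <= b n) ->
  exists p : C, forall eps, 0 < eps -> exists N, forall n, (N <= n)%nat -> Cmod (u n - p)%C < eps.
Proof.
move=> hb hu.
have hb' : forall eps : posreal, exists N, forall n, (N <= n)%nat -> b n < eps.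
  move=> eps; have /is_lim_seq_spec h := hb; have [N hN] := h eps.
  by exists N => n hn; have := hN n hn; rewrite Rminus_0_r => /Rabs_def2 [].
have cau : forall (q : C -> R), (forall x y, Rabs (q x - q y) <= Cmod (x - y)%C) ->
    exists l, is_lim_seq (fun n => q (u n)) (Finite l).
  move=> q hq; apply/ex_lim_seq_cauchy_corr => eps; have [N hN] := hb' eps.
  exists N => n m hn hm; case: (Nat.le_ge_cases n m) => h.
    by apply: Rle_lt_trans (hq _ _) _; rewrite Cmod_sym; apply: Rle_lt_trans (hu _ _ h) _; apply: hN.
  by apply: Rle_lt_trans (hq _ _) _; apply: Rle_lt_trans (hu _ _ h) _; apply: hN.
have [x hx] := cau Re (fun x y => re_le_Cmod (x - y)%C).
have [y hy] := cau Im (fun x y => Rle_trans _ _ _ (Rmax_r _ _) (Rmax_Cmod (x - y)%C)).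
exists (x, y) => eps he; have he2 : 0 < eps / 2 by lra.
have /is_lim_seq_spec h1 := hx; have /is_lim_seq_spec h2 := hy.
have [N1 k1] := h1 (mkposreal _ he2); have [N2 k2] := h2 (mkposreal _ he2).
exists (N1 + N2)%nat => n hn.
have a1 := k1 n ltac:(lia); have a2 := k2 n ltac:(lia); simpl in a1, a2.
have -> : (u n - (x, y))%C = (RtoC (Re (u n) - x) + RtoC (Im (u n) - y) * Ci)%C.
  by case: (u n) => p q; rewrite /Cminus /Cplus /Copp /Cmult /=; f_equal; ring.
by apply: Rle_lt_trans (Cmod_triangle _ _) _; rewrite Cmod_mult Cmod_Ci !Cmod_R; lra.
Qed.

Section Goursat.
Variables (S : C -> Prop) (f : C -> C).
Hypothesis hS : convex S.
Hypothesis hC : forall p : C, (forall eps, 0 < eps -> exists z, S z /\ Cmod (z - p)%C < eps) -> S p.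
Hypothesis hf : forall z, S z -> exists l : C, isD f z l.

(** The integral of the affine function is explicit, as it has a primitive. With [be] the derivative
    of [f] this controls small triangles; with [be] zero it differentiates the primitive of [f]. *)
Lemma seg_int_approx (al be a b : C) (M : R) : S a -> S b ->
  (forall t, 0 <= t <= 1 -> Cmod (f (seg a b t) - (al + be * seg a b t))%C <= M) ->
  Cmod (seg_int f a b - (al * (b - a) + be * (b * b - a * a) / 2))%C <= M * Cmod (b - a)%C.
Proof.
move=> ha hb h.
pose g (z : C) := (al + be * z)%C; pose Q (z : C) := (al * z + be * (z * z) / 2)%C.
have dg : forall z, isD g z be.
  move=> z; apply: (isD_val _ _ _ _ (isD_plus _ _ _ _ _ (isD_const al z) (isD_scal be _ _ _ (isD_id z)))).
  by ring.
have dQ : forall z, isD Q z (g z).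
  move=> z; apply: (isD_ext (fun z => al * z + (be / 2) * (z * z))%C).
    by move=> w; rewrite /Q; field.
  apply: (isD_val _ _ _ _ (isD_plus _ _ _ _ _ (isD_scal al _ _ _ (isD_id z))
     (isD_scal (be/2)%C _ _ _ (isD_mult _ _ _ _ _ (isD_id z) (isD_id z))))).
  by rewrite /g; field.
have eg : seg_int g a b = (al * (b - a) + be * (b * b - a * a) / 2)%C.
  rewrite (seg_int_FTC S g hS (fun z _ => ex_intro _ be (dg z)) Q) //; rewrite /Q; field.
have i1 := seg_int_is S f hS hf a b ha hb.
have i2 := seg_int_is S g hS (fun z _ => ex_intro _ be (dg z)) a b ha hb.
have i3 := is_RInt_minus (V:=C_R_NormedModule) _ _ _ _ _ _ i1 i2.
rewrite eg in i3.
have hbnd : forall t, 0 <= t <= 1 ->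
    Cmod ((b - a) * f (seg a b t) - (b - a) * g (seg a b t))%C <= M * Cmod (b - a)%C.
  move=> t ht; rewrite (_ : _ - _ = (b - a) * (f (seg a b t) - g (seg a b t)))%C; last by ring.
  by rewrite Cmod_mult Rmult_comm; apply: Rmult_le_compat_r; [exact: Cmod_ge_0 | exact: h].
apply: Rle_trans (is_CInt_bound _ 0 1 _ _ Rle_0_1 hbnd i3) _; lra.
Qed.

Record tri := Tri { va : C; vb : C; vc : C }.
Definition tri_integral (T : tri) : C := (seg_int f (va T) (vb T) + seg_int f (vb T) (vc T) + seg_int f (vc T) (va T))%C.
Definition midpoint (a b : C) : C := seg a b (1/2).
Definition tri_corner_a (T : tri) := Tri (va T) (midpoint (va T) (vb T)) (midpoint (vc T) (va T)).
Definition tri_corner_b (T : tri) := Tri (vb T) (midpoint (vb T) (vc T)) (midpoint (va T) (vb T)).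
Definition tri_corner_c (T : tri) := Tri (vc T) (midpoint (vc T) (va T)) (midpoint (vb T) (vc T)).
Definition tri_center (T : tri) := Tri (midpoint (va T) (vb T)) (midpoint (vb T) (vc T)) (midpoint (vc T) (va T)).
(** The central triangle is the default: if each corner carries less than a quarter of the integral,
    the centre carries more than a quarter. *)
Definition tri_child (T : tri) : tri :=
  match Rle_dec (Cmod (tri_integral T)) (4 * Cmod (tri_integral (tri_corner_a T))), Rle_dec (Cmod (tri_integral T)) (4 * Cmod (tri_integral (tri_corner_b T))),
    Rle_dec (Cmod (tri_integral T)) (4 * Cmod (tri_integral (tri_corner_c T))) with
  | left _, _, _ => tri_corner_a T
  | _, left _, _ => tri_corner_b T
  | _, _, left _ => tri_corner_c T
  | _, _, _ => tri_center T
  end.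
Definition tri_in (T : tri) := S (va T) /\ S (vb T) /\ S (vc T).
Definition tri_sides (d : R) (T : tri) :=
  Cmod (vb T - va T)%C <= d /\ Cmod (vc T - vb T)%C <= d /\ Cmod (va T - vc T)%C <= d.

Lemma midpoint_in a b : S a -> S b -> S (midpoint a b).
Proof. by move=> ha hb; apply: hS => //; lra. Qed.

Lemma midpointE a b : midpoint a b = ((a + b) / 2)%C.
Proof. by rewrite /midpoint /seg RtoC_div; [field | lra]. Qed.

Lemma tri_integral_split T : tri_in T -> (tri_integral T = tri_integral (tri_corner_a T) + tri_integral (tri_corner_b T) + tri_integral (tri_corner_c T) + tri_integral (tri_center T))%C.
Proof.
case: T => a b c [/= ha [hb hc]]; rewrite /tri_integral /tri_corner_a /tri_corner_b /tri_corner_c /tri_center /=.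
have hab := midpoint_in _ _ ha hb; have hbc := midpoint_in _ _ hb hc; have hca := midpoint_in _ _ hc ha.
rewrite (seg_int_split S f hS hf a b (midpoint a b)) // (seg_int_split S f hS hf b c (midpoint b c)) //
  (seg_int_split S f hS hf c a (midpoint c a)) //.
rewrite (seg_int_rev S f hS hf (midpoint a b) (midpoint b c)) // (seg_int_rev S f hS hf (midpoint b c) (midpoint c a)) //
  (seg_int_rev S f hS hf (midpoint c a) (midpoint a b)) //; ring.
Qed.

Lemma tri_child_in T : tri_in T -> tri_in (tri_child T).
Proof.
case: T => a b c [/= ha [hb hc]].
have hab := midpoint_in _ _ ha hb; have hbc := midpoint_in _ _ hb hc; have hca := midpoint_in _ _ hc ha.
by rewrite /tri_child; do 3? case: Rle_dec => _.
Qed.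

Lemma tri_child_integral T : tri_in T -> Cmod (tri_integral T) <= 4 * Cmod (tri_integral (tri_child T)).
Proof.
move=> h; rewrite /tri_child; do 3? case: Rle_dec => // ?.
have := tri_integral_split T h => e; have : Cmod (tri_integral T) <= Cmod (tri_integral (tri_corner_a T)) + Cmod (tri_integral (tri_corner_b T)) + Cmod (tri_integral (tri_corner_c T)) + Cmod (tri_integral (tri_center T)).
  rewrite {1}e; apply: Rle_trans (Cmod_triangle _ _) _; apply: Rplus_le_compat_r; exact: Cmod_triangle3.
lra.
Qed.

Lemma tri_child_sides d T : tri_sides d T -> tri_sides (d / 2) (tri_child T) /\ Cmod (va (tri_child T) - va T)%C <= d.
Proof.
case: T => a b c [/= h1 [h2 h3]].
have half : forall x y : C, Cmod (x - y)%C <= d -> Cmod ((x - y) / 2)%C <= d / 2.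
  move=> x y h; rewrite Cmod_div; last by apply: RtoC_neq; lra.
  rewrite Cmod_R Rabs_pos_eq; lra.
have h2' := h2; have h3' := h3; have h1' := h1.
rewrite Cmod_sym in h1'; rewrite Cmod_sym in h2'; rewrite Cmod_sym in h3'.
have d0 : 0 <= d by apply: Rle_trans h1; exact: Cmod_ge_0.
have a0 : Cmod (a - a)%C <= d by rewrite (_ : a - a = 0)%C; [rewrite Cmod_0 | ring].
have hab : Cmod ((b - a) / 2)%C <= d by apply: Rle_trans (half _ _ h1) _; lra.
rewrite /tri_child; do 3? case: Rle_dec => _; rewrite /tri_sides /=; rewrite !midpointE; (split; [repeat split|]);
  first [ exact: a0 | exact: h1 | exact: h1' | exact: h2 | exact: h2' | exact: h3 | exact: h3' |
     (rewrite (_ : _ - _ = (b - a) / 2)%C; [exact: half | field]) |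
     (rewrite (_ : _ - _ = (b - a) / 2)%C; [exact: hab | field]) |
     (rewrite (_ : _ - _ = (a - b) / 2)%C; [exact: half | field]) |
     (rewrite (_ : _ - _ = (c - b) / 2)%C; [exact: half | field]) |
     (rewrite (_ : _ - _ = (b - c) / 2)%C; [exact: half | field]) |
     (rewrite (_ : _ - _ = (c - a) / 2)%C; [exact: half | field]) |
     (rewrite (_ : _ - _ = (a - c) / 2)%C; [exact: half | field])].
Qed.

Definition tri_seq (T : tri) (n : nat) : tri := Nat.iter n tri_child T.

(* A triangle with nonzero integral has nested descendants whose integrals decay no faster
   than [4^-n], contradicting differentiability at their limit point. *)
Lemma goursat T : tri_in T -> tri_integral T = 0.
Proof.
move=> hT; case: (Ceq_dec (tri_integral T) 0) => // hne; exfalso.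
have eta : 0 < Cmod (tri_integral T) by apply/Cmod_gt_0.
pose d := Cmod (vb T - va T)%C + Cmod (vc T - vb T)%C + Cmod (va T - vc T)%C + 1.
have p1 := Cmod_ge_0 (vb T - va T)%C; have p2 := Cmod_ge_0 (vc T - vb T)%C; have p3 := Cmod_ge_0 (va T - vc T)%C.
have hd : 0 < d by rewrite /d; lra.
have hs : tri_sides d T by rewrite /tri_sides /d; lra.
have pw : forall n, 0 < (/2) ^ n by move=> n; apply: pow_lt; lra.
have hin : forall n, tri_in (tri_seq T n) by elim=> [|n IH] //=; exact: tri_child_in.
have hsd : forall n, tri_sides (d * (/2) ^ n) (tri_seq T n).
  elim=> [|n IH]; first by rewrite /= Rmult_1_r.
  have [h _] := tri_child_sides _ _ IH.
  by rewrite (_ : d * (/2) ^ Datatypes.S n = d * (/ 2) ^ n / 2) //=; field.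
have hmv : forall n, Cmod (va (tri_seq T (1 + n)) - va (tri_seq T n))%C <= d * (/2) ^ n.
  by move=> n; have [_ h] := tri_child_sides _ _ (hsd n).
have hbd : forall n, Cmod (tri_integral T) * ((/2) ^ n * (/2) ^ n) <= Cmod (tri_integral (tri_seq T n)).
  elim=> [|n IH]; first by rewrite /=; lra.
  have := tri_child_integral _ (hin n); rewrite -[tri_child _]/(tri_seq T (1 + n)) /= -/(tri_seq T n); simpl in IH; lra.
have hmm : forall n m, (n <= m)%nat -> Cmod (va (tri_seq T m) - va (tri_seq T n))%C <= 2 * d * (/2) ^ n.
  move=> n m h; have : Cmod (va (tri_seq T m) - va (tri_seq T n))%C <= 2 * d * ((/2) ^ n - (/2)^m).
    elim: h => [|m' h IH]; first by rewrite (_ : _ - _ = 0)%C; [rewrite Cmod_0; lra | ring].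
    apply: Rle_trans (Cmod_dist _ (va (tri_seq T m')) _) _.
    have := hmv m'; rewrite /= -/(tri_seq T m'); lra.
  have := pw m; nra.
have hl0 : is_lim_seq (fun n => (/2) ^ n) 0 by apply: is_lim_seq_geom; rewrite Rabs_pos_eq; lra.
have hl : forall c, is_lim_seq (fun n => c * (/2) ^ n) 0.
  by move=> c; have := is_lim_seq_scal_l _ c _ hl0; rewrite /= Rmult_0_r.
have [p hp] := C_cauchy _ _ (hl (2 * d)) hmm.
(* The closedness [hC] of the region enters here: the limit of the nested triangles must be a point
   of differentiability. *)
have Sp : S p.
  apply: hC => eps he; have [N hN] := hp eps he; exists (va (tri_seq T N)); split.
    by case: (hin N).
  exact: hN.
have hpn : forall n, Cmod (va (tri_seq T n) - p)%C <= 2 * d * (/2) ^ n.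
  move=> n; apply: Rnot_lt_le => h.
  have [N hN] := hp (Cmod (va (tri_seq T n) - p)%C - 2 * d * (/2) ^ n) ltac:(lra).
  have h1 := hN (N + n)%nat ltac:(lia); have h2 := hmm n (N + n)%nat ltac:(lia).
  have h3 := Cmod_dist (va (tri_seq T n)) (va (tri_seq T (N + n))) p.
  rewrite Cmod_sym in h2; lra.
have [l /isD_epsE hfp] := hf p Sp.
(* At depth $n$, with $x=2^{-n}$, each side contributes at most [eps] times $4dx\cdot dx$, since its
   points lie within $4dx$ of $p$. Three sides give $12$, so the constant $13$ contradicts the lower
   bound $|I|x^2$ for the integral. *)
pose eps := Cmod (tri_integral T) / (13 * d * d).
have heps : 0 < eps by apply: Rdiv_lt_0_compat => //; nra.
have [de [hde h1]] := hfp eps heps.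
have [n hn] : exists n, 4 * d * (/2) ^ n < de.
  have /is_lim_seq_spec h := hl (4 * d); have [N hN] := h (mkposreal _ hde).
  by exists N; have := hN N (le_n _); rewrite Rminus_0_r => /Rabs_def2 [].
have [Sa [Sb Sc]] := hin n; have [s1 [s2 s3]] := hsd n.
have pn := hpn n; have bn := hbd n; have := pw n.
move: Sa Sb Sc s1 s2 s3 pn bn hn; rewrite /tri_integral; move: ((/2) ^ n) (tri_seq T n) => x [a b c] /=.
move=> Sa Sb Sc s1 s2 s3 pn bn hn hx.
have hseg : forall u v, S u -> S v -> Cmod (u - p)%C <= 3 * d * x -> Cmod (v - u)%C <= d * x ->
   Cmod (seg_int f u v - ((f p - l * p) * (v - u) + l * (v * v - u * u) / 2))%C <= eps * (4 * d * x) * (d * x).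
  move=> u v Su Sv hu hv; apply: Rle_trans (_ : eps * (4 * d * x) * Cmod (v - u)%C <= _); last first.
    apply: Rmult_le_compat_l => //; apply: Rmult_le_pos; [lra | nra].
  apply: seg_int_approx => // t ht.
  have hz : Cmod (seg u v t - p)%C <= 4 * d * x.
    rewrite (_ : seg u v t - p = (u - p) + t * (v - u))%C; last by rewrite /seg; ring.
    apply: Rle_trans (Cmod_triangle _ _) _; rewrite Cmod_mult Cmod_R Rabs_pos_eq; last lra.
    have := Cmod_ge_0 (v - u)%C; nra.
  rewrite (_ : _ - _ = f (seg u v t) - f p - (seg u v t - p) * l)%C; last ring.
  apply: Rle_trans (h1 _ _) _; first lra.
  apply: Rmult_le_compat_l; lra.
have hdx : 0 < d * x by nra.
have ka := hseg a b Sa Sb ltac:(lra) s1.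
have kb := hseg b c Sb Sc.
have kc := hseg c a Sc Sa.
have {}kb := kb ltac:(apply: Rle_trans (Cmod_dist _ a _) _; lra) s2.
have {}kc := kc ltac:(apply: Rle_trans (Cmod_dist _ a _) _; rewrite Cmod_sym; lra) s3.
move: bn; rewrite (_ : seg_int f a b + seg_int f b c + seg_int f c a =
  (seg_int f a b - ((f p - l * p) * (b - a) + l * (b * b - a * a) / 2)) +
  (seg_int f b c - ((f p - l * p) * (c - b) + l * (c * c - b * b) / 2)) +
  (seg_int f c a - ((f p - l * p) * (a - c) + l * (a * a - c * c) / 2)))%C; last by field.
move=> bn; have := Rle_trans _ _ _ bn (Cmod_triangle3 _ _ _).
have e : eps * (13 * d * d) = Cmod (tri_integral T) by rewrite /eps; field; lra.
have : 0 < eps * d * d * x * x by do 4! apply: Rmult_lt_0_compat => //.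
rewrite /tri_integral in e; rewrite -e; nra.
Qed.

Lemma seg_int_path z0 z w : S z0 -> S z -> S w -> (seg_int f z0 w - seg_int f z0 z = seg_int f z w)%C.
Proof.
move=> h0 hz hw; have := goursat (Tri z0 z w) (conj h0 (conj hz hw)).
rewrite /tri_integral /= (seg_int_rev S f hS hf z0 w) // => e.
have -> : seg_int f z w = (seg_int f z0 z + seg_int f z w + - seg_int f z0 w + (seg_int f z0 w - seg_int f z0 z))%C by ring.
rewrite e; ring.
Qed.

Lemma seg_int_primitive z0 z r : S z0 -> 0 < r -> (forall w, Cmod (w - z)%C < r -> S w) -> isD (seg_int f z0) z (f z).
Proof.
move=> h0 hr hw.
have hz : S z by apply: hw; rewrite (_ : z - z = 0)%C; [rewrite Cmod_0 | ring].
have [l hl] := hf z hz; apply/isD_epsE => eps he.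
have [d [hd h1]] := isD_cont _ _ _ hl eps he.
exists (Rmin r d); split; first exact: Rmin_pos.
move=> w h; have Sw := hw w (Rlt_le_trans _ _ _ h (Rmin_l _ _)).
rewrite seg_int_path // (_ : (w - z) * f z = f z * (w - z) + 0 * (w * w - z * z) / 2)%C; last by field.
apply: seg_int_approx => // t ht.
rewrite (_ : f z + 0 * seg z w t = f z)%C; last ring.
apply: Rlt_le; apply: h1; rewrite (_ : seg z w t - z = t * (w - z))%C; last by rewrite /seg; ring.
have := Rlt_le_trans _ _ _ h (Rmin_r _ _); have := Cmod_ge_0 (w - z)%C.
rewrite Cmod_mult Cmod_R Rabs_pos_eq; [nra | lra].
Qed.

End Goursat.

Lemma convex_cball z0 r : convex (fun z => Cmod (z - z0)%C <= r).
Proof.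
move=> a b t ha hb ht.
rewrite (_ : seg a b t - z0 = RtoC (1 - t) * (a - z0) + t * (b - z0))%C; last by rewrite /seg RtoC_minus; ring.
apply: Rle_trans (Cmod_triangle _ _) _; rewrite !Cmod_mult !Cmod_R !Rabs_pos_eq; try lra.
nra.
Qed.

Lemma primitive_ball f z0 r : 0 < r -> (forall z, Cmod (z - z0)%C <= r -> exists l : C, isD f z l) ->
  exists F : C -> C, forall z, Cmod (z - z0)%C < r -> isD F z (f z).
Proof.
move=> hr hf; exists (seg_int f z0) => z hz.
apply: (seg_int_primitive _ f (convex_cball z0 r) _ hf z0 z (r - Cmod (z - z0)%C)); try lra.
- move=> p hp; apply: Rnot_lt_le => h; have [w [h1 h2]] := hp (Cmod (p - z0)%C - r) ltac:(lra).
  have := Cmod_dist p w z0; rewrite Cmod_sym in h2; lra.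
- by rewrite (_ : z0 - z0 = 0)%C; [rewrite Cmod_0; lra | ring].
- move=> w hw; have := Cmod_dist w z z0; lra.
Qed.

(** * Curves, and integrals depending on a parameter *)

Lemma isDR_plus (f g : R -> C) t (l m : C) : isDR f t l -> isDR g t m ->
  isDR (fun s => f s + g s)%C t (l + m)%C.
Proof. exact: (is_derive_plus (V:=C_R_NormedModule)). Qed.

Lemma isDR_minus (f g : R -> C) t (l m : C) : isDR f t l -> isDR g t m ->
  isDR (fun s => f s - g s)%C t (l - m)%C.
Proof. exact: (is_derive_minus (V:=C_R_NormedModule)). Qed.

(** Polarization: $fg=((f+g)^2-(f-g)^2)/4$ reduces the product to squares, which are compositions
    with the holomorphic $w\mapsto w^2$. *)
Lemma isDR_mult (f g : R -> C) t (l m : C) : isDR f t l -> isDR g t m ->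
  isDR (fun s => f s * g s)%C t (l * g t + f t * m)%C.
Proof.
move=> hf hg.
have sq : forall u l, isDR u t l -> isDR (fun s => u s * u s)%C t (2 * u t * l)%C.
  move=> u k hu; have := isD_path (fun w => w * w)%C u t _ k (isD_mult _ _ _ _ _ (isD_id _) (isD_id _)) hu.
  by rewrite (_ : k * _ = 2 * u t * k)%C; last ring.
have h := isDR_scal (/4) _ _ _ (isDR_minus _ _ _ _ _ (sq _ _ (isDR_plus _ _ _ _ _ hf hg)) (sq _ _ (isDR_minus _ _ _ _ _ hf hg))).
rewrite (_ : l * g t + f t * m = / 4 * (2 * (f t + g t) * (l + m) - 2 * (f t - g t) * (l - m)))%C; last by field.
apply: (is_derive_ext _ _ _ _ _ h) => s.
change (/4 * ((f s + g s) * (f s + g s) - (f s - g s) * (f s - g s)) = f s * g s)%C; field.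
Qed.

Lemma isDR_const (c : C) t : isDR (fun _ => c) t (RtoC 0).
Proof. exact: (is_derive_const (V:=C_R_NormedModule)). Qed.

Lemma isDR_val (f : R -> C) t (l m : C) : isDR f t l -> l = m -> isDR f t m.
Proof. by move=> h <-. Qed.

Lemma is_CInt_scal (c : C) (g : R -> C) a b (l : C) : is_CInt g a b l ->
  is_CInt (fun t => c * g t)%C a b (c * l)%C.
Proof.
move=> h.
have h1 := is_RInt_fct_extend_fst (U:=R_NormedModule) (V:=R_NormedModule) _ _ _ _ h.
have h2 := is_RInt_fct_extend_snd (U:=R_NormedModule) (V:=R_NormedModule) _ _ _ _ h.
apply: (is_RInt_fct_extend_pair (U:=R_NormedModule) (V:=R_NormedModule)).
- have := is_RInt_minus _ _ _ _ _ _ (is_RInt_scal _ _ _ (fst c) _ h1) (is_RInt_scal _ _ _ (snd c) _ h2).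
  by apply.
- have := is_RInt_plus _ _ _ _ _ _ (is_RInt_scal _ _ _ (fst c) _ h2) (is_RInt_scal _ _ _ (snd c) _ h1).
  by apply.
Qed.

Lemma is_CInt_minus (f g : R -> C) a b (l m : C) : is_CInt f a b l -> is_CInt g a b m ->
  is_CInt (fun t => f t - g t)%C a b (l - m)%C.
Proof. exact: (is_RInt_minus (V:=C_R_NormedModule)). Qed.

(** A second-order remainder that is uniform in $t$ integrates to $(b-a)K|w-z|^2$, which is
    $o(|w-z|)$. All differentiations under the integral sign below have this form. *)
Lemma isD_CInt (g : C -> R -> C) (g1 : R -> C) (z : C) (a b K d : R) : a <= b -> 0 < d ->
  (forall z' t, Cmod (z' - z)%C < d -> a <= t <= b -> continuous (U:=C_R_NormedModule) (g z') t) ->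
  (forall t, a <= t <= b -> continuous (U:=C_R_NormedModule) g1 t) ->
  (forall z' t, Cmod (z' - z)%C < d -> a <= t <= b ->
     Cmod (g z' t - g z t - (z' - z) * g1 t)%C <= K * Cmod (z' - z)%C ^ 2) ->
  isD (fun z' => CInt (g z') a b) z (CInt g1 a b).
Proof.
move=> hab hd hc hc1 hK; apply/isD_epsE => eps he.
have z0 : Cmod (z - z)%C < d by rewrite (_ : z - z = 0)%C; [rewrite Cmod_0 | ring].
pose M := (b - a) * Rabs K + 1.
have hM : 0 < M by have := Rabs_pos K; rewrite /M; nra.
exists (Rmin d (eps / M)); split; first by apply: Rmin_pos => //; apply: Rdiv_lt_0_compat.
move=> w hw; have hw1 := Rlt_le_trans _ _ _ hw (Rmin_l _ _); have hw2 := Rlt_le_trans _ _ _ hw (Rmin_r _ _).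
have i1 := ex_CInt (g w) a b hab (fun t ht => hc w t hw1 ht).
have i2 := ex_CInt (g z) a b hab (fun t ht => hc z t z0 ht).
have i3 := is_CInt_scal (w - z)%C _ _ _ _ (ex_CInt g1 a b hab hc1).
have i4 := is_CInt_minus _ _ _ _ _ _ (is_CInt_minus _ _ _ _ _ _ i1 i2) i3.
apply: Rle_trans (is_CInt_bound _ _ _ _ _ hab (fun t ht => hK w t hw1 ht) i4) _.
have p := Cmod_ge_0 (w - z)%C; have := Rle_abs K; have := Rabs_pos K => q1 q2.
have : Cmod (w - z)%C * M <= eps.
  apply: Rlt_le; apply (Rmult_lt_compat_r M) in hw2 => //.
  by rewrite /Rdiv Rmult_assoc Rinv_l in hw2; lra.
rewrite /M => h; apply: Rle_trans (_ : (Cmod (w - z)%C * ((b - a) * Rabs K + 1)) * Cmod (w - z)%C <= _); last first.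
  exact: Rmult_le_compat_r.
have : (b - a) * K <= (b - a) * Rabs K by apply: Rmult_le_compat_l; lra.
move=> h3; have : 0 <= Cmod (w - z)%C ^ 2 by exact: pow2_ge_0.
nra.
Qed.

(** With $a=1/(\zeta-w)$, $b=1/(\zeta-z)$ and $h=w-z$ the relation $a=b+hab$ is the resolvent
    identity; the estimate is the second-order Taylor bound for $(\zeta-z)^{-p}$, uniform as long as
    $a$ and $b$ stay bounded. *)
Lemma kernel_bound (A : R) (p : nat) : 0 <= A -> exists M, 0 <= M /\ forall a b h : C,
  Cmod a <= A -> Cmod b <= A -> (a = b + h * a * b)%C ->
  Cmod (a ^ p - b ^ p - INR p * h * b ^ S p)%C <= M * Cmod h ^ 2.
Proof.
move=> hA; elim: p => [|p [M [hM IH]]].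
  exists 0; split; first lra; move=> a b h _ _ _ /=.
  rewrite (_ : _ - _ = 0)%C; [rewrite Cmod_0; lra | ring].
have hP := pow_le A (S (S p)) hA.
exists (M * A + INR (S p) * A * A ^ S (S p)); split.
  have := pos_INR (S p) => h; apply: Rplus_le_le_0_compat; first nra.
  by apply: Rmult_le_pos => //; apply: Rmult_le_pos.
move=> a b h ha hb e; have {}IH := IH a b h ha hb e.
have -> : (a ^ S p - b ^ S p - INR (S p) * h * b ^ S (S p) =
  (a ^ p - b ^ p - INR p * h * b ^ S p) * a + (INR (S p) * h * h * a * b ^ S (S p)))%C.
  rewrite S_INR RtoC_plus [(a ^ S p)%C]/= [(b ^ S (S p))%C]/= [(b ^ S p)%C]/=.
  have r : (a - b - h * a * b = 0)%C by rewrite {1}e; ring.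
  set x := (a ^ p)%C; set y := (b ^ p)%C; set n := RtoC (INR p).
  transitivity ((x - y - n * h * (b * y)) * a + (n + 1) * h * h * a * (b * (b * y))
    + y * (1 + (n + 1) * h * b) * (a - b - h * a * b))%C; first ring.
  rewrite r; ring.
apply: Rle_trans (Cmod_triangle _ _) _; rewrite !Cmod_mult Cmod_R Cmod_pow.
have hn := pos_INR (S p); rewrite (Rabs_pos_eq _ hn).
have q1 := Cmod_ge_0 a; have q2 := Cmod_ge_0 h.
have q3 : Cmod b ^ S (S p) <= A ^ S (S p) by apply: pow_incr; split; [exact: Cmod_ge_0 | ].
have q4 : 0 <= Cmod b ^ S (S p) by apply: pow_le; exact: Cmod_ge_0.
rewrite Rmult_plus_distr_r; apply: Rplus_le_compat.
  rewrite (_ : M * A * _ = (M * Cmod h ^ 2) * A); last ring.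
  by apply: Rmult_le_compat => //; exact: Cmod_ge_0.
rewrite (_ : INR (S p) * Cmod h * Cmod h * Cmod a * Cmod b ^ S (S p) = (INR (S p) * Cmod h ^ 2) * (Cmod a * Cmod b ^ S (S p))); last by rewrite /=; ring.
rewrite (_ : INR (S p) * A * A ^ S (S p) * Cmod h ^ 2 = (INR (S p) * Cmod h ^ 2) * (A * A ^ S (S p))); last ring.
apply: Rmult_le_compat_l; first by apply: Rmult_le_pos => //; apply: pow2_ge_0.
exact: Rmult_le_compat.
Qed.

(** * Cauchy's formula *)

Lemma isDR_RtoC (u : R -> R) t (a : R) : is_derive u t a -> isDR (fun s => RtoC (u s)) t (RtoC a).
Proof.
case=> _ h; apply/isDR_epsE => eps he.
have [d hd] := h t (fun P h => h) (mkposreal _ he).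
exists d; split; first by case: d {hd}.
move=> s hs; have := hd s hs.
rewrite -RtoC_minus -RtoC_mult -RtoC_minus Cmod_R; exact.
Qed.

Lemma Cmod_minus_le (x y : C) : Cmod x - Cmod y <= Cmod (x - y)%C.
Proof. have := Cmod_triangle (x - y)%C y; rewrite (_ : x - y + y = x)%C; [lra | ring]. Qed.

Section Circle.
Variables (z0 : C) (rho : R).
Hypothesis hrho : 0 < rho.

Definition unit_circle (t : R) : C := (RtoC (cos t) + Ci * RtoC (sin t))%C.
Definition circle (t : R) : C := (z0 + RtoC rho * unit_circle t)%C.
Definition circle_D (t : R) : C := (RtoC rho * Ci * unit_circle t)%C.

Lemma isDR_unit_circle t : isDR unit_circle t (Ci * unit_circle t)%C.
Proof.
have hc : is_derive cos t (- sin t) by auto_derive => //; ring.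
have hs : is_derive sin t (cos t) by auto_derive => //; ring.
apply: (isDR_val _ _ _ _ (isDR_plus _ _ _ _ _ (isDR_RtoC _ _ _ hc) (isDR_scal Ci _ _ _ (isDR_RtoC _ _ _ hs)))).
by rewrite /unit_circle /Ci /Cplus /Cmult /RtoC /=; f_equal; ring.
Qed.

Lemma Cmod_unit_circle t : Cmod (unit_circle t) = 1.
Proof.
rewrite /Cmod /unit_circle /= (_ : _ + _ = Rsqr (sin t) + Rsqr (cos t)); last by rewrite /Rsqr; ring.
by rewrite sin2_cos2 sqrt_1.
Qed.

Lemma isDR_circle t : isDR circle t (circle_D t).
Proof.
apply: (isDR_val _ _ _ _ (isDR_plus _ _ _ _ _ (isDR_const z0 t) (isDR_scal rho _ _ _ (isDR_unit_circle t)))).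
by rewrite /circle_D; ring.
Qed.

Lemma isDR_circle_D t : isDR circle_D t (RtoC rho * Ci * (Ci * unit_circle t))%C.
Proof. exact: isDR_scal (isDR_unit_circle t). Qed.

Lemma Cmod_circle_D t : Cmod (circle_D t) = rho.
Proof. by rewrite /circle_D !Cmod_mult Cmod_unit_circle Cmod_Ci Cmod_R Rabs_pos_eq; lra. Qed.

Lemma circle_dist z t : rho - Cmod (z - z0)%C <= Cmod (circle t - z)%C.
Proof.
rewrite (_ : circle t - z = RtoC rho * unit_circle t - (z - z0))%C; last by rewrite /circle; ring.
apply: Rle_trans (Cmod_minus_le _ _); rewrite Cmod_mult Cmod_unit_circle Cmod_R Rabs_pos_eq; lra.
Qed.

Lemma circle_neq z t : Cmod (z - z0)%C < rho -> (circle t - z)%C <> 0.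
Proof. by move=> h e; have := circle_dist z t; rewrite e Cmod_0; lra. Qed.

Lemma circle_closed : circle (2 * PI) = circle 0.
Proof. by rewrite /circle /unit_circle cos_2PI sin_2PI cos_0 sin_0. Qed.

Lemma circle_integral_primitive (G g : C -> C) : (forall t, isD G (circle t) (g (circle t))) ->
  (forall t, continuous (U:=C_R_NormedModule) (fun t => circle_D t * g (circle t))%C t) ->
  is_CInt (fun t => circle_D t * g (circle t))%C 0 (2 * PI) (RtoC 0).
Proof.
move=> hG hc; have hpi := PI_RGT_0.
apply: (is_CInt_val _ _ _ (G (circle (2 * PI)) - G (circle 0))%C); last by rewrite circle_closed; ring.
apply: (is_CInt_FTC (fun t => G (circle t))); [lra | | by move=> t _].
by move=> t _; apply: isD_path (isDR_circle t).
Qed.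

Definition cauchy_kernel (h : R -> C) (p : nat) (z : C) : C := CInt (fun t => h t * / (circle t - z) ^ p)%C 0 (2 * PI).

Lemma isDR_kernel_factor p z t : Cmod (z - z0)%C < rho -> exists l : C, isDR (fun t => / (circle t - z) ^ p)%C t l.
Proof.
move=> hz; eexists; apply: (isD_path (fun w => / (w - z) ^ p)%C circle); last exact: isDR_circle.
have h1 := isD_Cinv _ (Cpow_nz _ p (circle_neq z t hz)).
apply: (isD_comp Cinv (fun w => (w - z) ^ p)%C _ _ _ h1).
apply: (isD_comp (fun w => w ^ p)%C (fun w => w - z)%C); first exact: isD_pow.
exact: isD_minus (isD_id _) (isD_const z _).
Qed.

(** The density is an arbitrary bounded differentiable function on the circle and does not change
    under differentiation, so the formula can be iterated. *)
Lemma cauchy_kernel_D (h : R -> C) (M : R) p z :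
  (forall t, exists l : C, isDR h t l) -> (forall t, Cmod (h t) <= M) -> Cmod (z - z0)%C < rho ->
  isD (cauchy_kernel h p) z (INR p * cauchy_kernel h (S p) z)%C.
Proof.
move=> cauchy_density hM hz; have hpi := PI_RGT_0.
have cont : forall q w t, Cmod (w - z0)%C < rho ->
    continuous (U:=C_R_NormedModule) (fun t => h t * / (circle t - w) ^ q)%C t.
  move=> q w t hw; have [l hl] := cauchy_density t; have [m hm] := isDR_kernel_factor q w t hw.
  exact: isDR_continuous (isDR_mult _ _ _ _ _ hl hm).
pose d := (rho - Cmod (z - z0)%C) / 2; have hd : 0 < d by rewrite /d; lra.
have hA : 0 <= / d by apply: Rlt_le; apply: Rinv_0_lt_compat.
have [N [hN hk]] := kernel_bound (/ d) p hA.
have -> : (INR p * cauchy_kernel h (S p) z)%C = CInt (fun t => INR p * (h t * / (circle t - z) ^ S p))%C 0 (2 * PI).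
  symmetry; apply: is_CInt_unique; apply: is_CInt_scal; apply: ex_CInt; first lra.
  by move=> t _; apply: cont.
have near : forall w, Cmod (w - z)%C < d -> Cmod (w - z0)%C < rho /\ forall t, Cmod (/ (circle t - w))%C <= / d.
  move=> w hw; have := Cmod_dist w z z0 => h1.
  have hw0 : Cmod (w - z0)%C < rho by move: hw; rewrite /d; lra.
  split=> // t; rewrite Cmod_inv; last exact: circle_neq.
  apply: Rinv_le_contravar => //; have := circle_dist w t; move: hw; rewrite /d; lra.
apply: (isD_CInt (fun w t => h t * / (circle t - w) ^ p)%C _ z 0 (2*PI) (M * N) d) => //; first lra.
- by move=> w t hw ht; apply: cont; case: (near w hw).
- move=> t ht; have [l hl] := cauchy_density t; have [m hm] := isDR_kernel_factor (S p) z t hz.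
  exact: isDR_continuous (isDR_scal (INR p) _ _ _ (isDR_mult _ _ _ _ _ hl hm)).
- move=> w t hw ht; have [hw0 hwb] := near w hw.
  have zz : Cmod (z - z)%C < d by rewrite (_ : z - z = 0)%C; [rewrite Cmod_0 | ring].
  have [_ hzb] := near z zz.
  have n1 := circle_neq w t hw0; have n2 := circle_neq z t hz.
  have e := hk (/ (circle t - w))%C (/ (circle t - z))%C (w - z)%C (hwb t) (hzb t).
  have {}e := e ltac:(field; split; [exact n2 | exact n1]).
  rewrite -!Cpow_inv // (_ : _ - _ = h t * ((/ (circle t - w)) ^ p - (/ (circle t - z)) ^ p -
    INR p * (w - z) * (/ (circle t - z)) ^ S p))%C; last by ring.
  rewrite Cmod_mult Rmult_assoc; apply: Rmult_le_compat => //; exact: Cmod_ge_0.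
Qed.

Lemma cauchy_kernel_local_D (h : R -> C) (M : R) p (g : C -> C) (c l z : C) :
  (forall t, exists l : C, isDR h t l) -> (forall t, Cmod (h t) <= M) -> Cmod (z - z0)%C < rho ->
  (forall w, Cmod (w - z0)%C < rho -> g w = c * cauchy_kernel h p w)%C ->
  isD g z l -> l = (c * INR p * cauchy_kernel h (S p) z)%C.
Proof.
move=> cauchy_density hM hz e hg.
apply: (isD_unique _ _ _ _ hg).
apply: (isD_local (fun w => c * cauchy_kernel h p w)%C _ _ _ (rho - Cmod (z - z0)%C)); first lra.
  by move=> w hw; rewrite e //; have := Cmod_dist w z z0; lra.
apply: (isD_val _ _ _ _ (isD_scal c _ _ _ (cauchy_kernel_D h M p z cauchy_density hM hz))); ring.
Qed.

Lemma isDR_ex_circle_D t : exists l : C, isDR circle_D t l.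
Proof. by eexists; exact: isDR_circle_D. Qed.

(** The derivative in $z$ is the kernel of order 2, which vanishes because $(v-w)^{-2}$ has a
    primitive; hence the value is that at the centre, where the integrand is constantly $i$. *)
Lemma winding z : Cmod (z - z0)%C < rho -> cauchy_kernel circle_D 1 z = (2 * PI * Ci)%C.
Proof.
move=> hz; have hpi := PI_RGT_0.
have hz00 : Cmod (z0 - z0)%C = 0 by rewrite (_ : z0 - z0 = 0)%C; [rewrite Cmod_0 | ring].
have k2 : forall w, Cmod (w - z0)%C < rho -> cauchy_kernel circle_D 2 w = 0.
  move=> w hw; apply: is_CInt_unique.
  apply: (circle_integral_primitive (fun v => - / (v - w))%C (fun v => / (v - w) ^ 2)%C).
  - move=> t; have n := circle_neq w t hw.
    have h := isD_comp Cinv (fun v => v - w)%C _ _ _ (isD_Cinv _ n) (isD_minus _ _ _ _ _ (isD_id _) (isD_const w _)).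
    apply: (isD_ext (fun v => (-1) * / (v - w))%C); first by move=> v; ring.
    apply: (isD_val _ _ _ _ (isD_scal (-1) _ _ _ h)); rewrite /=; field; exact: n.
  - move=> t; have [m hm] := isDR_kernel_factor 2 w t hw.
    exact: isDR_continuous (isDR_mult _ _ _ _ _ (isDR_circle_D t) hm).
have e0 : cauchy_kernel circle_D 1 z0 = (2 * PI * Ci)%C.
  apply: is_CInt_unique; apply: (is_RInt_ext (V:=C_R_NormedModule) (fun _ => Ci)).
    move=> t _; rewrite /circle_D (_ : circle t - z0 = rho * unit_circle t)%C; last by rewrite /circle; ring.
    have n1 : unit_circle t <> 0 by apply/Cmod_gt_0; rewrite Cmod_unit_circle; lra.
    have n2 : RtoC rho <> 0 by apply: RtoC_neq; lra.
    by change (Ci = rho * Ci * unit_circle t * / (rho * unit_circle t) ^ 1)%C; rewrite Cpow_1_r; field.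
  have := is_RInt_const (V:=C_R_NormedModule) 0 (2*PI) Ci.
  by rewrite scalCR Rminus_0_r RtoC_mult.
rewrite -e0.
have : Cmod (cauchy_kernel circle_D 1 z - cauchy_kernel circle_D 1 z0)%C <= 0 * Cmod (z - z0)%C.
  have inb : forall t, 0 <= t <= 1 -> Cmod (seg z0 z t - z0)%C < rho.
    move=> t ht; rewrite (_ : seg z0 z t - z0 = t * (z - z0))%C; last by rewrite /seg; ring.
    rewrite Cmod_mult Cmod_R Rabs_pos_eq; last lra; have := Cmod_ge_0 (z - z0)%C; nra.
  apply: (seg_MVT _ (fun w => INR 1 * cauchy_kernel circle_D 2 w)%C) => t ht.
    apply: (cauchy_kernel_D _ rho); [exact: isDR_ex_circle_D | by move=> s; rewrite Cmod_circle_D; lra | exact: inb].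
  by rewrite k2; [rewrite Cmult_0_r Cmod_0; lra | exact: inb].
rewrite Rmult_0_l => h; have h2 := Cmod_ge_0 (cauchy_kernel circle_D 1 z - cauchy_kernel circle_D 1 z0)%C.
have /Cmod_eq_0 h3 : Cmod (cauchy_kernel circle_D 1 z - cauchy_kernel circle_D 1 z0)%C = 0 by lra.
by rewrite -[cauchy_kernel circle_D 1 z](_ : (cauchy_kernel circle_D 1 z - cauchy_kernel circle_D 1 z0) + cauchy_kernel circle_D 1 z0 = _)%C; [rewrite h3; ring | ring].
Qed.

Variables (f F F2 : C -> C) (B : R).
Hypothesis hF2 : forall z, Cmod (z - z0)%C < 2 * rho -> isD F2 z (F z).
Hypothesis hF : forall z, Cmod (z - z0)%C < 2 * rho -> isD F z (f z).
Hypothesis hB : forall z, Cmod (z - z0)%C < 2 * rho -> Cmod (f z) <= B.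

Lemma ball_seg u v t r : Cmod (u - z0)%C < r -> Cmod (v - z0)%C < r -> 0 <= t <= 1 -> Cmod (seg u v t - z0)%C < r.
Proof.
move=> hu hv ht; apply: Rle_lt_trans (_ : Rmax (Cmod (u - z0)%C) (Cmod (v - z0)%C) < r); last exact: Rmax_lub_lt.
by apply: (convex_cball z0 _ u v t) => //; [exact: Rmax_l | exact: Rmax_r].
Qed.

Lemma primitive_lipschitz u v : Cmod (u - z0)%C < 2 * rho -> Cmod (v - z0)%C < 2 * rho -> Cmod (F v - F u)%C <= B * Cmod (v - u)%C.
Proof.
move=> hu hv; apply: (seg_MVT F f) => t ht; [apply: hF | apply: hB]; exact: ball_seg.
Qed.

(** Mean value inequality for $F_2(w)-wF(u)$, whose derivative $F(w)-F(u)$ is at most $B|w-u|$. *)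
Lemma primitive_quadratic u v : Cmod (u - z0)%C < 2 * rho -> Cmod (v - z0)%C < 2 * rho ->
  Cmod (F2 v - F2 u - (v - u) * F u)%C <= B * Cmod (v - u)%C ^ 2.
Proof.
move=> hu hv.
have -> : (F2 v - F2 u - (v - u) * F u = (F2 v - v * F u) - (F2 u - u * F u))%C by ring.
rewrite (_ : B * Cmod (v - u)%C ^ 2 = B * Cmod (v - u)%C * Cmod (v - u)%C); last by rewrite /=; ring.
have hB0 : 0 <= B by apply: Rle_trans (hB u hu); exact: Cmod_ge_0.
apply: (seg_MVT (fun w => F2 w - w * F u)%C (fun w => F w - F u)%C) => t ht.
  have h := isD_minus _ _ _ _ _ (hF2 _ (ball_seg _ _ _ _ hu hv ht)) (isD_mult _ _ _ _ _ (isD_id (seg u v t)) (isD_const (F u) _)).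
  apply: (isD_val _ _ _ _ h); ring.
apply: Rle_trans (primitive_lipschitz _ _ hu (ball_seg _ _ _ _ hu hv ht)) _.
apply: Rmult_le_compat_l => //; rewrite (_ : seg u v t - u = t * (v - u))%C; last by rewrite /seg; ring.
rewrite Cmod_mult Cmod_R Rabs_pos_eq; last lra; have := Cmod_ge_0 (v - u)%C; nra.
Qed.

Lemma circle_radius t : Cmod (circle t - z0)%C = rho.
Proof.
by rewrite (_ : circle t - z0 = rho * unit_circle t)%C; [rewrite Cmod_mult Cmod_unit_circle Cmod_R Rabs_pos_eq; lra | rewrite /circle; ring].
Qed.

Definition cauchy_density (t : R) : C := (circle_D t * F2 (circle t))%C.

Lemma cauchy_density_D t : exists l : C, isDR cauchy_density t l.
Proof.
eexists; apply: isDR_mult; first exact: isDR_circle_D.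
by apply: isD_path (isDR_circle t); apply: hF2; rewrite circle_radius; lra.
Qed.

Lemma cauchy_density_bound : exists M, forall t, Cmod (cauchy_density t) <= M.
Proof.
have c0 : Cmod (z0 - z0)%C < 2 * rho by rewrite (_ : z0 - z0 = 0)%C; [rewrite Cmod_0; lra | ring].
exists (rho * (B * rho ^ 2 + Cmod (F2 z0) + rho * Cmod (F z0))) => t.
rewrite /cauchy_density Cmod_mult Cmod_circle_D; apply: Rmult_le_compat_l; first lra.
have := primitive_quadratic z0 (circle t) c0 ltac:(rewrite circle_radius; lra); rewrite circle_radius => h.
rewrite (_ : F2 (circle t) = (F2 (circle t) - F2 z0 - (circle t - z0) * F z0) + F2 z0 + (circle t - z0) * F z0)%C; last ring.
apply: Rle_trans (Cmod_triangle3 _ _ _) _; rewrite [Cmod ((circle t - z0) * _)]Cmod_mult circle_radius; lra.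
Qed.

(* The integral of [F2 (z + s (w - z)) / (w - z)] over the circle has zero derivative in [s]:
   at [s = 1] it is the Cauchy integral, at [s = 0] it is [F2 z] times the winding number.
   Passing to the second primitive [F2] of [f] gives the quadratic remainder needed to
   differentiate under the integral. *)
Lemma cauchy_formula z : Cmod (z - z0)%C < rho -> cauchy_kernel cauchy_density 1 z = (2 * PI * Ci * F2 z)%C.
Proof.
move=> hz; have hpi := PI_RGT_0.
pose W (s : C) t := (z + s * (circle t - z))%C.
pose phi (s : C) := CInt (fun t => F2 (W s t) * (circle_D t * / (circle t - z) ^ 1))%C 0 (2 * PI).
(* Differentiation is in a complex $s$, so $s'$ may leave $[0,1]$ by up to $1/2$. Since
   $|\zeta-z|\le2\rho$ on the circle, this moves the point by less than $\rho$, which is why the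
   hypotheses live on the disc of radius $2\rho$. *)
have win : forall (s : R) (s' : C) t, 0 <= s <= 1 -> Cmod (s' - s)%C < 1/2 -> Cmod (W s' t - z0)%C < 2 * rho.
  move=> s s' t hs hs'.
  have -> : (W s' t - z0 = (seg z (circle t) s - z0) + (s' - s) * (circle t - z))%C by rewrite /W /seg; ring.
  have h1 : Cmod (seg z (circle t) s - z0)%C <= rho.
    by apply: convex_cball => //; [lra | rewrite circle_radius; lra].
  have h2 : Cmod (circle t - z)%C <= 2 * rho.
    have := Cmod_dist (circle t) z0 z; rewrite circle_radius Cmod_sym [Cmod (z0 - z)%C]Cmod_sym [Cmod (z - circle t)%C]Cmod_sym; lra.
  apply: Rle_lt_trans (Cmod_triangle _ _) _; rewrite Cmod_mult.
  have := Cmod_ge_0 (s' - s)%C; have := Cmod_ge_0 (circle t - z)%C; nra.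
have DW : forall s t, isDR (W s) t (s * circle_D t)%C.
  move=> s t; apply: (isDR_val _ _ _ _ (isDR_plus _ _ _ _ _ (isDR_const z t) (isDR_scal s _ _ _ (isDR_minus _ _ _ _ _ (isDR_circle t) (isDR_const z t))))).
  by ring.
have zz : forall s : R, Cmod (s - s)%C < 1 / 2.
  by move=> s; rewrite (_ : s - s = 0)%C; [rewrite Cmod_0; lra | ring].
have contg : forall (s : R) t, 0 <= s <= 1 -> continuous (U:=C_R_NormedModule) (fun t => F (W s t) * circle_D t)%C t.
  move=> s t hs; apply: (isDR_continuous _ t _ (isDR_mult _ _ _ _ _ (isD_path _ _ _ _ _ (hF _ (win s s t hs (zz s))) (DW s t)) (isDR_circle_D t))).
have dphi : forall s : R, 0 <= s <= 1 -> isD phi (RtoC s) (CInt (fun t => F (W s t) * circle_D t)%C 0 (2 * PI)).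
  move=> s hs.
  apply: (isD_CInt (fun s' t => F2 (W s' t) * (circle_D t * / (circle t - z) ^ 1))%C _ s 0 (2*PI) (B * (2 * rho) * rho) (1/2)); try lra.
  - move=> s' t hs' _; have [m hm] := isDR_kernel_factor 1 z t hz.
    exact: (isDR_continuous _ t _ (isDR_mult _ _ _ _ _ (isD_path _ _ _ _ _ (hF2 _ (win s s' t hs hs')) (DW s' t)) (isDR_mult _ _ _ _ _ (isDR_circle_D t) hm))).
  - by move=> t _; apply: contg.
  - move=> s' t hs' _; have n := circle_neq z t hz; rewrite Cpow_1_r.
    have h := primitive_quadratic _ _ (win s s t hs (zz s)) (win s s' t hs hs').
    have -> : (F2 (W s' t) * (circle_D t * / (circle t - z)) - F2 (W s t) * (circle_D t * / (circle t - z)) - (s' - s) * (F (W s t) * circle_D t)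
      = (F2 (W s' t) - F2 (W s t) - (W s' t - W s t) * F (W s t)) * (circle_D t * / (circle t - z)))%C.
      by rewrite /W; field.
    rewrite Cmod_mult Cmod_mult Cmod_circle_D Cmod_inv //.
    have e : (W s' t - W s t = (s' - s) * (circle t - z))%C by rewrite /W; ring.
    rewrite e Cmod_mult in h; rewrite e.
    have pn : 0 < Cmod (circle t - z)%C by apply/Cmod_gt_0.
    have h2 : Cmod (circle t - z)%C <= 2 * rho.
      have := Cmod_dist (circle t) z0 z; rewrite circle_radius [Cmod (z0 - z)%C]Cmod_sym; lra.
    have pi' : 0 < / Cmod (circle t - z)%C by exact: Rinv_0_lt_compat.
    apply: Rle_trans (_ : (B * (Cmod (s' - s)%C * Cmod (circle t - z)%C) ^ 2) * (rho * / Cmod (circle t - z)%C) <= _).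
      by apply: Rmult_le_compat_r => //; apply: Rmult_le_pos; lra.
    rewrite (_ : _ * (rho * _) = Cmod (circle t - z)%C * (B * rho * Cmod (s' - s)%C ^ 2)); last by field; lra.
    rewrite (_ : _ * (2 * rho) * rho * _ = (2 * rho) * (B * rho * Cmod (s' - s)%C ^ 2)); last ring.
    apply: Rmult_le_compat_r => //; apply: Rmult_le_pos; last exact: pow2_ge_0.
    apply: Rmult_le_pos; last lra; apply: Rle_trans (hB z _); [exact: Cmod_ge_0 | lra].
(* For $s\ne0$ the integrand is $1/s$ times the $t$-derivative of $F_2(W(s,t))$, and the circle is
   closed. At $s=0$ it is a constant times the derivative of the circle. *)
have dz : forall s : R, 0 <= s <= 1 -> CInt (fun t => F (W s t) * circle_D t)%C 0 (2 * PI) = RtoC 0.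
  move=> s hs; case: (Req_dec s 0) => [->|ns].
    apply: is_CInt_unique; apply: (is_CInt_val _ _ _ (F z * 0)%C); last ring.
    apply: (is_RInt_ext (V:=C_R_NormedModule) (fun t => F z * (circle_D t * 1))%C).
      by move=> t _; rewrite /W Cmult_0_l Cplus_0_r Cmult_1_r.
    apply: is_CInt_scal; apply: (circle_integral_primitive (fun v => v) (fun _ => RtoC 1)); first by move=> t; exact: isD_id.
    by move=> t; exact: (isDR_continuous _ t _ (isDR_mult _ _ _ _ _ (isDR_circle_D t) (isDR_const _ t))).
  have nsC : RtoC s <> 0 by exact: RtoC_neq.
  apply: is_CInt_unique; apply: (is_CInt_val _ _ _ (/ s * (F2 (W s (2*PI)%R) - F2 (W s 0)))%C); last first.
    by rewrite /W circle_closed; ring.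
  have h : is_CInt (fun t => s * (F (W s t) * circle_D t))%C 0 (2 * PI) (F2 (W s (2*PI)%R) - F2 (W s 0))%C.
    apply: (is_CInt_FTC (fun t => F2 (W s t))); first lra.
      move=> t _; apply: (isDR_val _ _ _ _ (isD_path _ _ _ _ _ (hF2 _ (win s s t hs (zz s))) (DW s t))); ring.
    move=> t _; have [m hm] : exists m : C, isDR (fun t => F (W s t) * circle_D t)%C t m.
      by eexists; exact: (isDR_mult _ _ _ _ _ (isD_path _ _ _ _ _ (hF _ (win s s t hs (zz s))) (DW s t)) (isDR_circle_D t)).
    exact: (isDR_continuous _ t _ (isDR_scal s _ _ _ hm)).
  apply: (is_RInt_ext (V:=C_R_NormedModule) _ _ _ _ _ _ (is_CInt_scal (/ s) _ _ _ _ h)) => t _.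
  by change (/ s * (s * (F (W s t) * circle_D t)) = F (W s t) * circle_D t)%C; field.
have e1 : phi 1 = cauchy_kernel cauchy_density 1 z.
  apply: (RInt_ext (V:=C_R_CompleteNormedModule)) => t _.
  rewrite /W /cauchy_density (_ : z + 1 * (circle t - z) = circle t)%C; last ring.
  by change (F2 (circle t) * (circle_D t * / (circle t - z) ^ 1) = circle_D t * F2 (circle t) * / (circle t - z) ^ 1)%C; ring.
have e0 : phi 0 = (2 * PI * Ci * F2 z)%C.
  rewrite -(winding z hz) Cmult_comm; apply: is_CInt_unique.
  apply: (is_RInt_ext (V:=C_R_NormedModule) (fun t => F2 z * (circle_D t * / (circle t - z) ^ 1))%C).
    by move=> t _; rewrite /W Cmult_0_l Cplus_0_r.
  apply: is_CInt_scal; apply: ex_CInt; first lra.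
  move=> t _; have [m hm] := isDR_kernel_factor 1 z t hz.
  exact: (isDR_continuous _ t _ (isDR_mult _ _ _ _ _ (isDR_circle_D t) hm)).
rewrite -e1 -e0.
have : Cmod (phi 1 - phi 0)%C <= 0.
  apply: (isDR_MVT (fun s : R => phi (RtoC s)) (fun _ => RtoC 0)); last by move=> *; rewrite Cmod_0; lra.
  move=> s hs; apply: (isDR_val (fun s : R => phi (RtoC s)) s (0 * 1)%C (RtoC 0)); last ring.
  rewrite -(dz s hs) Cmult_comm; apply: (isD_path phi RtoC); first by apply: dphi.
  by apply: isDR_RtoC; apply: is_derive_id.
move=> h; have h2 := Cmod_ge_0 (phi 1 - phi 0)%C.
have /Cmod_eq_0 h3 : Cmod (phi 1 - phi 0)%C = 0 by lra.
by rewrite -[phi 1](_ : (phi 1 - phi 0) + phi 0 = _)%C; [rewrite h3; ring | ring].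
Qed.

(** By Cauchy's formula $F_2$, $F$, $f$ and $f'$ are constant multiples of the kernels of order 1,
    2, 3 and 4 with one and the same density, and the last kernel is again differentiable. *)
Lemma derive_differentiable : exists l : C, isD (C_derive f) z0 l.
Proof.
have [M hM] := cauchy_density_bound; have hpi := PI_RGT_0.
have n : (2 * PI * Ci)%C <> 0.
  apply: Cmult_neq_0; last by move=> e; have := f_equal snd e; rewrite /=; lra.
  by apply: Cmult_neq_0; apply: RtoC_neq; lra.
pose c := (/ (2 * PI * Ci))%C.
have e1 : forall w, Cmod (w - z0)%C < rho -> (F2 w = c * cauchy_kernel cauchy_density 1 w)%C.
  by move=> w hw; rewrite cauchy_formula // /c; move: n; set N := (2 * PI * Ci)%C => n; field.
have e2 : forall w, Cmod (w - z0)%C < rho -> (F w = c * INR 1 * cauchy_kernel cauchy_density 2 w)%C.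
  move=> w hw; apply: (cauchy_kernel_local_D _ M 1 F2 c _ _ cauchy_density_D hM hw e1); apply: hF2; lra.
have e3 : forall w, Cmod (w - z0)%C < rho -> (f w = c * INR 1 * INR 2 * cauchy_kernel cauchy_density 3 w)%C.
  move=> w hw; apply: (cauchy_kernel_local_D _ M 2 F _ _ _ cauchy_density_D hM hw e2); apply: hF; lra.
have e4 : forall w, Cmod (w - z0)%C < rho -> (C_derive f w = c * INR 1 * INR 2 * INR 3 * cauchy_kernel cauchy_density 4 w)%C.
  move=> w hw.
  have [l hl] : exists l : C, isD f w l.
    eexists; apply: (isD_local (fun w => c * INR 1 * INR 2 * cauchy_kernel cauchy_density 3 w)%C _ _ _ (rho - Cmod (w - z0)%C)); first lra.
      by move=> v hv; rewrite e3 //; have := Cmod_dist v w z0; lra.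
    exact: isD_scal (cauchy_kernel_D _ M 3 w cauchy_density_D hM hw).
  by rewrite (isD_C_derive _ _ _ hl); apply: (cauchy_kernel_local_D _ M 3 f _ _ _ cauchy_density_D hM hw e3).
eexists; apply: (isD_local (fun w => c * INR 1 * INR 2 * INR 3 * cauchy_kernel cauchy_density 4 w)%C _ _ _ rho) => //.
  by move=> v hv; rewrite e4.
apply: isD_scal; apply: (cauchy_kernel_D _ M 4 z0 cauchy_density_D hM).
by rewrite (_ : z0 - z0 = 0)%C; [rewrite Cmod_0 | ring].
Qed.

End Circle.

Lemma derive_holomorphic (f : C -> C) (z0 : C) (r : R) : 0 < r ->
  (forall z, Cmod (z - z0)%C < r -> exists l : C, isD f z l) -> exists l : C, isD (C_derive f) z0 l.
Proof.
move=> hr hf.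
have [F hF] := primitive_ball f z0 (r / 2) ltac:(lra) (fun z hz => hf z ltac:(lra)).
have [F2 hF2] := primitive_ball F z0 (r / 4) ltac:(lra) (fun z hz => ex_intro _ _ (hF z ltac:(lra))).
have c0 : Cmod (z0 - z0)%C < r by rewrite (_ : z0 - z0 = 0)%C; [rewrite Cmod_0 | ring].
have [l hl] := hf z0 c0.
have [d [hd h1]] := isD_cont _ _ _ hl 1 Rlt_0_1.
(* $2\rho$ is at most $r/4$, where both primitives exist, and at most $d$, where continuity at $z_0$
   bounds $|f|$ by $|f(z_0)|+1$. *)
pose rho := Rmin (r / 4) d / 2.
have q1 := Rmin_l (r / 4) d; have q2 := Rmin_r (r / 4) d.
have q3 : 0 < Rmin (r / 4) d by apply: Rmin_pos; lra.
apply: (derive_differentiable z0 rho _ f F F2 (Cmod (f z0) + 1)); rewrite /rho; try lra.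
- by move=> z hz; apply: hF2; lra.
- by move=> z hz; apply: hF; lra.
- move=> z hz; have := h1 z ltac:(lra); have := Cmod_minus_le (f z) (f z0); lra.
Qed.

(** * Complex series *)

Definition Clim (u : nat -> C) (l : C) : Prop :=
  forall eps, 0 < eps -> exists N, forall n, (N <= n)%nat -> Cmod (u n - l)%C < eps.


Lemma Cminus_diag (x : C) : (x - x)%C = 0. Proof. ring. Qed.

Lemma Cmod_minus_0 (x y : C) : (forall eps, 0 < eps -> Cmod (x - y)%C < eps) -> x = y.
Proof.
move=> h; have : Cmod (x - y)%C = 0.
  have := Cmod_ge_0 (x - y)%C; case: (Rle_lt_dec (Cmod (x - y)%C) 0) => h1; first lra.
  have := h _ h1; lra.
move=> /Cmod_eq_0 e; have -> : (x = (x - y) + y)%C by ring.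
by rewrite e; ring.
Qed.

Lemma Clim_unique u l m : Clim u l -> Clim u m -> l = m.
Proof.
move=> h1 h2; apply: Cmod_minus_0 => eps he.
have [N1 k1] := h1 (eps / 2) ltac:(lra); have [N2 k2] := h2 (eps / 2) ltac:(lra).
have := k1 (N1 + N2)%nat ltac:(lia); have := k2 (N1 + N2)%nat ltac:(lia).
have := Cmod_dist l (u (N1 + N2)%nat) m; rewrite (Cmod_sym l (u _)); lra.
Qed.

Lemma Clim_const c : Clim (fun _ => c) c.
Proof. by move=> eps he; exists O => n _; rewrite Cminus_diag Cmod_0. Qed.

Lemma Clim_ext_from N0 u v l : (forall n, (N0 <= n)%nat -> u n = v n) -> Clim u l -> Clim v l.
Proof.
move=> e h eps he; have [N k] := h eps he; exists (N + N0)%nat => n hn.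
by rewrite -e; [apply: k; lia | lia].
Qed.

Lemma Clim_ext u v l : (forall n, u n = v n) -> Clim u l -> Clim v l.
Proof. by move=> e; apply: (Clim_ext_from 0). Qed.

Lemma Clim_plus u v l m : Clim u l -> Clim v m -> Clim (fun n => u n + v n)%C (l + m)%C.
Proof.
move=> h1 h2 eps he.
have [N1 k1] := h1 (eps / 2) ltac:(lra); have [N2 k2] := h2 (eps / 2) ltac:(lra).
exists (N1 + N2)%nat => n hn.
rewrite (_ : _ - _ = (u n - l) + (v n - m))%C; last ring.
have := k1 n ltac:(lia); have := k2 n ltac:(lia).
have := Cmod_triangle (u n - l)%C (v n - m)%C; lra.
Qed.

Lemma Clim_cont (f : C -> C) u (l d : C) : isD f l d -> Clim u l -> Clim (fun n => f (u n)) (f l).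
Proof.
move=> hf hu eps he; have [del [hd h]] := isD_cont _ _ _ hf eps he.
by have [N k] := hu del hd; exists N => n hn; apply: h; apply: k.
Qed.

Lemma Clim_scal c u l : Clim u l -> Clim (fun n => c * u n)%C (c * l)%C.
Proof. move=> h; exact: (Clim_cont (fun w => c * w)%C _ _ _ (isD_scal c _ _ _ (isD_id l)) h). Qed.

Lemma Clim_minus u v l m : Clim u l -> Clim v m -> Clim (fun n => u n - v n)%C (l - m)%C.
Proof.
move=> h1 /(Clim_scal (-1)) h2; rewrite (_ : l - m = l + (-1) * m)%C; last ring.
by apply: Clim_ext (Clim_plus _ _ _ _ h1 h2) => n; ring.
Qed.

Lemma Clim_mult u v l m : Clim u l -> Clim v m -> Clim (fun n => u n * v n)%C (l * m)%C.
Proof.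
move=> hu hv.
have sq : forall w x, Clim w x -> Clim (fun n => w n * w n)%C (x * x)%C.
  by move=> w x h; exact: (Clim_cont (fun z => z * z)%C _ _ _ (isD_mult _ _ _ _ _ (isD_id x) (isD_id x)) h).
have h := Clim_scal (/4) _ _ (Clim_minus _ _ _ _ (sq _ _ (Clim_plus _ _ _ _ hu hv)) (sq _ _ (Clim_minus _ _ _ _ hu hv))).
rewrite (_ : l * m = /4 * ((l + m) * (l + m) - (l - m) * (l - m)))%C; last by field.
by apply: Clim_ext h => n; field.
Qed.

Lemma Clim_inv u (l : C) : l <> 0 -> Clim u l -> Clim (fun n => / u n)%C (/ l)%C.
Proof. move=> hl h; exact: (Clim_cont Cinv _ _ _ (isD_Cinv l hl) h). Qed.

Lemma Clim_sub (phi : nat -> nat) u l : (forall n, (n <= phi n)%nat) -> Clim u l -> Clim (fun n => u (phi n)) l.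
Proof.
move=> hp h eps he; have [N k] := h eps he; exists N => n hn; apply: k.
exact: Nat.le_trans hn (hp n).
Qed.

Lemma Clim_0_le u (b : nat -> R) : (forall n, Cmod (u n) <= b n) -> is_lim_seq b 0 -> Clim u 0.
Proof.
move=> h /is_lim_seq_spec hb eps he; have [N k] := hb (mkposreal _ he).
exists N => n hn; have /Rabs_def2 [/= k1 _] := k n hn.
rewrite (_ : u n - 0 = u n)%C; last ring; have := h n; lra.
Qed.

Lemma Clim_bound u l M : Clim u l -> (forall n, Cmod (u n) <= M) -> Cmod l <= M.
Proof.
move=> h hb; apply: Rnot_lt_le => hl.
have [N k] := h (Cmod l - M) ltac:(lra); have := k N (le_n _).
rewrite Cmod_sym; have := Cmod_minus_le l (u N); have := hb N; lra.
Qed.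

Lemma Clim_RtoC (u : nat -> R) (l : R) : is_lim_seq u l <-> Clim (fun n => RtoC (u n)) l.
Proof.
split.
- move=> /is_lim_seq_spec h eps he; have [N k] := h (mkposreal _ he).
  by exists N => n hn; rewrite -RtoC_minus Cmod_R; apply: k.
- move=> h; apply/is_lim_seq_spec => eps; have [N k] := h eps (cond_pos eps).
  by exists N => n hn; have := k n hn; rewrite -RtoC_minus Cmod_R.
Qed.

Lemma Clim_Re u l : Clim u l -> is_lim_seq (fun n => Re (u n)) (Re l).
Proof.
move=> h; apply/is_lim_seq_spec => eps; have [N k] := h eps (cond_pos eps).
exists N => n hn; apply: Rle_lt_trans (k n hn); exact: (re_le_Cmod (u n - l)%C).
Qed.

Lemma Clim_Im u l : Clim u l -> is_lim_seq (fun n => Im (u n)) (Im l).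
Proof.
move=> h; apply/is_lim_seq_spec => eps; have [N k] := h eps (cond_pos eps).
exists N => n hn; apply: Rle_lt_trans (k n hn); exact: (Rle_trans _ _ _ (Rmax_r _ _) (Rmax_Cmod (u n - l)%C)).
Qed.

Lemma Clim_ReIm u l : is_lim_seq (fun n => Re (u n)) (Re l) -> is_lim_seq (fun n => Im (u n)) (Im l) -> Clim u l.
Proof.
move=> /Clim_RtoC h1 /Clim_RtoC h2.
have h := Clim_plus _ _ _ _ h1 (Clim_scal Ci _ _ h2).
have e : forall z : C, (RtoC (Re z) + Ci * RtoC (Im z) = z)%C.
  by case=> x y; rewrite /Ci /Cplus /Cmult /RtoC /=; f_equal; ring.
by rewrite e in h; apply: Clim_ext h => n.
Qed.

(** The bound is exclusive, in contrast to [sum_n], so that the empty sum exists and sums split at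
    any index. *)
Fixpoint csum (a : nat -> C) (n : nat) : C :=
  match n with O => RtoC 0 | S m => (csum a m + a m)%C end.

Fixpoint rsum (a : nat -> R) (n : nat) : R :=
  match n with O => 0 | S m => rsum a m + a m end.

Lemma csumS a n : csum a (S n) = (csum a n + a n)%C. Proof. by []. Qed.

Lemma csum_ext a b n : (forall i, (i < n)%nat -> a i = b i) -> csum a n = csum b n.
Proof.
elim: n => //= n IH h; by rewrite (IH (fun i hi => h i (Nat.lt_lt_succ_r _ _ hi))) (h n (Nat.lt_succ_diag_r n)).
Qed.

Lemma csum_plus a b n : csum (fun i => a i + b i)%C n = (csum a n + csum b n)%C.
Proof. elim: n => [|n IH] /=; [ring | rewrite IH; ring]. Qed.

Lemma csum_scal c a n : csum (fun i => c * a i)%C n = (c * csum a n)%C.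
Proof. elim: n => [|n IH] /=; [ring | rewrite IH; ring]. Qed.

Lemma csum_add a m n : csum a (m + n) = (csum a m + csum (fun i => a (m + i)%nat) n)%C.
Proof.
elim: n => [|n IH]; first by rewrite Nat.add_0_r /=; ring.
by rewrite Nat.add_succ_r /= IH; ring.
Qed.

Lemma csum_S_l a n : csum a (S n) = (a O + csum (fun i => a (S i)) n)%C.
Proof. by rewrite -Nat.add_1_l csum_add /=; ring. Qed.

Lemma csum_rev a n : csum a n = csum (fun i => a (n - 1 - i)%nat) n.
Proof.
elim: n => // n IH; rewrite [RHS]csum_S_l /= IH Nat.sub_0_r Nat.sub_0_r Cplus_comm; congr (_ + _)%C.
by apply: csum_ext => i hi; congr a; lia.
Qed.

Lemma csum_telescope (v : nat -> C) n : csum (fun i => v (S i) - v i)%C n = (v n - v O)%C.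
Proof. elim: n => [|n IH] /=; [ring | rewrite IH; ring]. Qed.

Lemma csum_rsum_bound a (b : nat -> R) m n : (forall i, Cmod (a i) <= b i) -> (m <= n)%nat ->
  Cmod (csum a n - csum a m)%C <= rsum b n - rsum b m.
Proof.
move=> h; elim=> [|k hk IH]; first by rewrite Cminus_diag Cmod_0; lra.
rewrite /= (_ : csum a k + a k - csum a m = (csum a k - csum a m) + a k)%C; last ring.
by apply: Rle_trans (Cmod_triangle _ _) _; have := h k; lra.
Qed.

Lemma rsum_sum_n b n : rsum b (S n) = sum_n b n.
Proof.
elim: n => [|n IH]; first by rewrite sum_O /= Rplus_0_l.
by rewrite sum_Sn -IH.
Qed.

Definition isS (a : nat -> C) (l : C) : Prop := Clim (csum a) l.

Lemma isS_unique a l m : isS a l -> isS a m -> l = m.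
Proof. exact: Clim_unique. Qed.

Lemma isS_ext a b l : (forall i, a i = b i) -> isS a l -> isS b l.
Proof. by move=> e; apply: Clim_ext => n; apply: csum_ext. Qed.

Lemma isS_plus a b l m : isS a l -> isS b m -> isS (fun n => a n + b n)%C (l + m)%C.
Proof. by move=> h1 h2; apply: Clim_ext (Clim_plus _ _ _ _ h1 h2) => n; rewrite csum_plus. Qed.

Lemma isS_scal c a l : isS a l -> isS (fun n => c * a n)%C (c * l)%C.
Proof. by move=> h; apply: Clim_ext (Clim_scal c _ _ h) => n; rewrite csum_scal. Qed.

Lemma isS_minus a b l m : isS a l -> isS b m -> isS (fun n => a n - b n)%C (l - m)%C.
Proof.
move=> h1 /(isS_scal (-1)) h2; rewrite (_ : l - m = l + (-1) * m)%C; last ring.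
by apply: isS_ext (isS_plus _ _ _ _ h1 h2) => n; ring.
Qed.

Lemma isS_val a l m : isS a l -> l = m -> isS a m. Proof. by move=> h <-. Qed.

Lemma isS_unshift a l : isS (fun n => a (S n)) l -> isS a (a O + l)%C.
Proof.
move=> h eps he; have [N k] := h eps he; exists (S N); case=> [|n] hn; first by lia.
rewrite csum_S_l (_ : _ - _ = csum (fun i => a (S i)) n - l)%C; last ring.
by apply: k; lia.
Qed.

Lemma isS_fin (a : nat -> C) N : (forall n, (N <= n)%nat -> a n = 0) -> isS a (csum a N).
Proof.
move=> h; apply: (Clim_ext_from N _ _ _ _ (Clim_const _)) => n hn.
by elim: hn => // m hm IH /=; rewrite -IH h // Cplus_0_r.
Qed.

Lemma CSeries_isS a l : isS a l -> CSeries a = l.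
Proof.
move=> h; rewrite /CSeries [RHS](surjective_pairing l).
have hs : forall q : C -> R, q 0%C = 0 -> (forall x y, q (x + y)%C = q x + q y) ->
    (is_lim_seq (fun n => q (csum a n)) (q l)) -> Series (fun m => q (a m)) = q l.
  move=> q q0 qa hq; apply: is_series_unique.
  have h2 := proj1 (is_lim_seq_incr_1 _ _) hq.
  apply: (is_lim_seq_ext _ _ _ _ h2) => n.
  elim: n => [|n IH]; first by rewrite sum_O /= qa q0 Rplus_0_l.
  by rewrite sum_Sn -IH [csum a (S (S n))]/= -/(csum a (S n)) qa.
by f_equal; apply: hs => //; [exact: Clim_Re | exact: Clim_Im].
Qed.

(** * Dominated convergence and exchange of summations *)

Lemma rsum_le_Series b n : (forall i, 0 <= b i) -> ex_series b -> rsum b n <= Series b.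
Proof.
move=> hb hs.
have hS : forall n, rsum b (S n) <= Series b.
  move=> {}n; rewrite rsum_sum_n; have h := Series_correct _ hs.
  apply: (is_lim_seq_incr_compare (sum_n b)) => // k; rewrite sum_Sn -[plus _ _]/(_ + _); have := hb (S k); lra.
case: n => [|n] //; have := hS 0%nat; have := hb 0%nat; rewrite /=; lra.
Qed.

Lemma rsum_lim b : ex_series b -> is_lim_seq (rsum b) (Series b).
Proof.
move=> hs; apply/is_lim_seq_incr_1; apply: (is_lim_seq_ext (sum_n b)); last exact: Series_correct.
by move=> n; rewrite rsum_sum_n.
Qed.

Section Dominated.
Variables (b : nat -> R).
Hypothesis hb : forall i, 0 <= b i.
Hypothesis hs : ex_series b.

Lemma isS_dom a : (forall i, Cmod (a i) <= b i) -> exists l, isS a l.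
Proof.
move=> ha.
have hl : is_lim_seq (fun n => Series b - rsum b n) 0.
  have := is_lim_seq_minus' _ _ _ _ (is_lim_seq_const (Series b)) (rsum_lim _ hs).
  by rewrite Rminus_diag.
have [|l h] := C_cauchy (csum a) _ hl; last by exists l.
move=> n m hnm; apply: Rle_trans (csum_rsum_bound _ _ _ _ ha hnm) _.
have := rsum_le_Series b m hb hs; lra.
Qed.

Lemma isS_tail a l n : (forall i, Cmod (a i) <= b i) -> isS a l -> Cmod (l - csum a n)%C <= Series b - rsum b n.
Proof.
move=> ha h; apply: (Clim_bound (fun m => csum a (n + m) - csum a n)%C).
  apply: Clim_minus (Clim_const _); apply: (Clim_sub (fun m => n + m)%nat) h => m; lia.
move=> m; apply: Rle_trans (csum_rsum_bound _ _ _ _ ha (Nat.le_add_r n m)) _.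
have := rsum_le_Series b (n + m) hb hs; lra.
Qed.

Lemma csum_Clim (a : nat -> nat -> C) l K : (forall n, Clim (fun N => a N n) (l n)) -> Clim (fun N => csum (a N) K) (csum l K).
Proof. move=> h; elim: K => [|K IH] /=; [exact: Clim_const | exact: Clim_plus]. Qed.

(** Dominated convergence for series. Beyond an index $K$ both tails are below [eps / 4] by the
    majorant alone; below $K$ only finitely many limits are taken. *)
Lemma tannery (a : nat -> nat -> C) l s : (forall N n, Cmod (a N n) <= b n) ->
  (forall n, Clim (fun N => a N n) (l n)) -> (forall N, isS (a N) (s N)) ->
  exists t, isS l t /\ Clim s t.
Proof.
move=> ha hl hS.
have hlb : forall n, Cmod (l n) <= b n by move=> n; apply: Clim_bound (hl n) _.
have [t ht] := isS_dom l hlb; exists t; split=> // eps he.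
have he4 : 0 < eps / 4 by lra.
have /is_lim_seq_spec hr := rsum_lim _ hs; have [K hK] := hr (mkposreal _ he4).
have /Rabs_def2 [_ /= k2] := hK K (le_n _).
have [N hN] := csum_Clim a l K hl (eps / 4) he4.
exists N => n hn; have h1 := hN n hn.
have h2 := isS_tail _ _ K (ha n) (hS n); have h3 := isS_tail _ _ K hlb ht.
rewrite (_ : s n - t = (s n - csum (a n) K) + (csum (a n) K - csum l K) + (csum l K - t))%C; last ring.
apply: Rle_lt_trans (Cmod_triangle3 _ _ _) _; rewrite Cmod_sym in h3; rewrite [Cmod (csum l K - t)]Cmod_sym Cmod_sym in h3 *.
lra.
Qed.

End Dominated.

(** Dominated convergence applied to partial row sums: for fixed $N$ they sum over $n$ to the first
    $N$ columns, and as $N\to\infty$ they tend to the rows. The product majorant makes the bound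
    $u_n\sum v$ independent of $N$. *)
Lemma fubini (a : nat -> nat -> C) (u v : nat -> R) (r c : nat -> C) :
  (forall i, 0 <= u i) -> (forall i, 0 <= v i) -> ex_series u -> ex_series v ->
  (forall n m, Cmod (a n m) <= u n * v m) ->
  (forall n, isS (a n) (r n)) -> (forall m, isS (fun n => a n m) (c m)) ->
  exists s, isS r s /\ isS c s.
Proof.
move=> hu hv su sv hb hr hc.
have sb : ex_series (fun n => u n * Series v) by apply: ex_series_scal_r.
have v0 : 0 <= Series v by exact: (rsum_le_Series v 0 hv sv).
apply: (tannery (fun n => u n * Series v) _ sb (fun N n => csum (a n) N) r (csum c)).
- by move=> i; apply: Rmult_le_pos.
- move=> N n.
  have := csum_rsum_bound (a n) (fun m => u n * v m) 0 N (hb n) (Nat.le_0_l _).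
  rewrite /= (_ : csum (a n) N - 0 = csum (a n) N)%C; last ring.
  have -> : rsum (fun m => u n * v m) N = u n * rsum v N by elim: N => [|N IH] /=; [ring | rewrite IH; ring].
  have := rsum_le_Series v N hv sv => h1 h2; have := Rmult_le_compat_l _ _ _ (hu n) h1; lra.
- by move=> n; exact: hr.
- move=> N; elim: N => [|N IH] /=.
    exact: (isS_fin (fun _ => RtoC 0) O (fun _ _ => Logic.eq_refl)).
  exact: isS_plus.
Qed.

(** * Partial fractions *)

Lemma Cexp_plus (z w : C) : Cexp (z + w)%C = (Cexp z * Cexp w)%C.
Proof.
case: z => a b; case: w => c d; rewrite /Cexp /Cplus /Cmult /Re /Im /= exp_plus cos_plus sin_plus.
by f_equal; ring.
Qed.

Lemma Cexp_0 : Cexp 0%C = 1%C.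
Proof. by rewrite /Cexp /Re /Im /= exp_0 cos_0 sin_0 /RtoC; f_equal; ring. Qed.

Lemma Cexp_neq0 z : Cexp z <> RtoC 0.
Proof.
move=> e; have : (Cexp z * Cexp (- z) = 1)%C.
  by rewrite -Cexp_plus (_ : z + - z = 0)%C; [exact: Cexp_0 | ring].
by rewrite e Cmult_0_l => /RtoC_inj; lra.
Qed.

Lemma two_pi_i_neq0 : (2 * PI * Ci)%C <> RtoC 0.
Proof.
have hpi := PI_RGT_0.
apply: Cmult_neq_0; last by move=> e; have := f_equal snd e; rewrite /=; lra.
by apply: Cmult_neq_0; apply: RtoC_neq; lra.
Qed.

Lemma Cinv_0 : (/ 0 = 0)%C.
Proof. by rewrite /Cinv /RtoC /= /Rdiv Ropp_0 !Rmult_0_l. Qed.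

(** Unconditional, since the inverse of 0 is 0. *)
Lemma Cinv_mult (x y : C) : (/ (x * y) = / x * / y)%C.
Proof.
case: (Ceq_dec x 0) => [->|hx]; first by rewrite Cmult_0_l Cinv_0 Cmult_0_l.
case: (Ceq_dec y 0) => [->|hy]; first by rewrite Cmult_0_r Cinv_0 Cmult_0_r.
by field.
Qed.

Lemma Cinv_inv (x : C) : (/ / x = x)%C.
Proof. by case: (Ceq_dec x 0) => [->|hx]; [rewrite !Cinv_0 | field]. Qed.

Definition E (z : C) : C := Cexp (2 * PI * Ci * z)%C.

Lemma E_plus z w : E (z + w)%C = (E z * E w)%C.
Proof. by rewrite /E -Cexp_plus; congr Cexp; ring. Qed.

Lemma E_1 : E 1 = 1.
Proof.
rewrite /E (_ : (2 * PI * Ci * 1)%C = (0, 2 * PI)%R).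
  by rewrite /Cexp /Re /Im /= exp_0 cos_2PI sin_2PI /RtoC; f_equal; ring.
by rewrite /Ci /Cmult /RtoC /=; f_equal; ring.
Qed.

Lemma E_half : E (/2)%C = (-1)%C.
Proof.
rewrite /E (_ : (2 * PI * Ci * /2)%C = (0, PI)).
  by rewrite /Cexp /Re /Im /= exp_0 cos_PI sin_PI /RtoC; f_equal; ring.
rewrite (_ : (2 * PI * Ci * / 2 = PI * Ci)%C); last by field.
by rewrite /Ci /Cmult /RtoC /=; f_equal; ring.
Qed.

Lemma E_periodic z : E (z + 1)%C = E z.
Proof. by rewrite E_plus E_1; ring. Qed.

Lemma E_sqr z : (E (z * /2) * E (z * /2) = E z)%C.
Proof. by rewrite -E_plus; congr E; field. Qed.

Lemma isD_E z : isD E z (2 * PI * Ci * E z)%C.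
Proof.
apply: (isD_comp Cexp (fun w => 2 * PI * Ci * w)%C); first exact: isD_exp.
apply: (isD_val _ _ _ _ (isD_scal (2 * PI * Ci)%C _ _ _ (isD_id z))); ring.
Qed.

(** [X2] and [X4] are the sums of $nq^n$ and $n^3q^n$. With the constants [kappa2] and [kappa4],
    equal to $(2\pi i)^s/(s-1)!$, they give the closed side of Lipschitz's formula for
    $\sum_j(z+j)^{-s}$. *)
Definition X2 (q : C) : C := (q / (1 - q) ^ 2)%C.
Definition X4 (q : C) : C := (q * (1 + 4 * q + q * q) / (1 - q) ^ 4)%C.
Definition kappa2 : C := ((2 * PI * Ci) ^ 2)%C.
Definition kappa4 : C := ((2 * PI * Ci) ^ 4 / 6)%C.

Definition half_pow (N : nat) : C := RtoC ((/2) ^ N).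

Lemma half_pow_pos N : 0 < (/2) ^ N.
Proof. apply: pow_lt; lra. Qed.

Lemma half_pow_neq0 N : half_pow N <> RtoC 0.
Proof. by apply: RtoC_neq; have := half_pow_pos N; lra. Qed.

Lemma half_powS N : half_pow (S N) = (half_pow N * /2)%C.
Proof. rewrite /half_pow -RtoC_inv; [rewrite -RtoC_mult; congr RtoC; rewrite /=; ring | lra]. Qed.

Lemma half_pow_lim : Clim half_pow 0.
Proof. by apply/Clim_RtoC; apply: is_lim_seq_geom; rewrite Rabs_pos_eq; lra. Qed.

Lemma half_pow_two N : (half_pow N * INR (2 ^ N) = 1)%C.
Proof.
rewrite -RtoC_mult pow_INR (_ : INR 2 = 2); last by rewrite /=; lra.
by rewrite -Rpow_mult_distr Rinv_l ?pow1; [ | lra].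
Qed.

Lemma half_pow_lim_scal x : Clim (fun N => x * half_pow N)%C 0.
Proof. by have := Clim_scal x _ _ half_pow_lim; rewrite Cmult_0_r. Qed.

Lemma E_lim x : Clim (fun N => E (x * half_pow N)) 1.
Proof.
have := Clim_cont E _ _ _ (isD_E (RtoC 0)) (half_pow_lim_scal x).
by rewrite {2}/E Cmult_0_r Cexp_0.
Qed.

(** The derivative of $1-E(xt)$ at $t=0$, taken along $t=2^{-N}$. *)
Lemma E_quot_lim x : Clim (fun N => (1 - E (x * half_pow N)) / half_pow N)%C (- (2 * PI * Ci * x))%C.
Proof.
have hD : isD (fun t => E (x * t))%C (RtoC 0) (2 * PI * Ci * x)%C.
  apply: (isD_val _ _ _ _ (isD_comp E (fun t => x * t)%C _ _ _ (isD_E _) (isD_scal x _ _ _ (isD_id (RtoC 0))))).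
  by rewrite Cmult_0_r /E Cmult_0_r Cexp_0; ring.
move=> eps he; have /isD_epsE h := hD; have [d [hd h1]] := h (eps / 2) ltac:(lra).
have [N k] := half_pow_lim d hd; exists N => n hn; have h2 := h1 _ (k n hn).
move: h2; rewrite Cmult_0_r (_ : E 0 = 1); last by rewrite /E Cmult_0_r Cexp_0.
rewrite (_ : half_pow n - 0 = half_pow n)%C; last ring.
have n0 := half_pow_neq0 n.
rewrite (_ : (1 - E (x * half_pow n)) / half_pow n - - (2 * PI * Ci * x) = - ((E (x * half_pow n) - 1 - half_pow n * (2 * PI * Ci * x)) / half_pow n))%C; last by field.
rewrite Cmod_opp Cmod_div // => h2.
have p : 0 < Cmod (half_pow n) by apply/Cmod_gt_0.
apply: (Rmult_lt_reg_r (Cmod (half_pow n))) => //.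
rewrite /Rdiv Rmult_assoc Rinv_l; [nra | lra].
Qed.

Section PartialFractions.
Variables (G : C -> C) (s : nat) (z : C) (c K : R).
(** The term that $N$ applications of the duplication formula attach to the lattice point $x$. The
    bound [hbnd] on it is restricted to real parts at most $3/4$ after scaling: the functions [G] of
    interest have poles at all integers, and only the one at 0 may be approached. *)
Definition dilate (N : nat) (x : C) : C := (half_pow N ^ s * G (x * half_pow N))%C.
Hypothesis hper : forall w, G (w + 1)%C = G w.
Hypothesis hdup : forall w, E w <> 1 -> (2 ^ s * G w = G (w * /2) + G (w * /2 + /2))%C.
Hypothesis hlim : forall x, x <> RtoC 0 -> Clim (fun N => dilate N x) (/ x ^ s)%C.
Hypothesis hK : 0 <= K.
Hypothesis hbnd : forall N x, x <> RtoC 0 -> Rabs (Re x) * (/2) ^ N <= 3/4 -> Rabs (Im x) <= Rabs (Im z) ->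
  Cmod (dilate N x) <= K / Cmod x ^ s.
Hypothesis hc : 0 < c.
Hypothesis hz1 : forall j, c * INR (S j) <= Cmod (z + INR j)%C.
Hypothesis hz2 : forall j, c * INR (S j) <= Cmod (z - INR (S j))%C.
Hypothesis hEz : E z <> 1.
Hypothesis hs : (2 <= s)%nat.

(** If $E$ were 1 at level $N+1$, its square would be 1 at level $N$; at level 0 an integer shift
    leaves $E(z)\ne1$ unchanged. So the duplication formula applies at every point met. *)
Lemma E_level N j : E ((z + IZR j) * half_pow N)%C <> 1.
Proof.
elim: N => [|N IH].
  rewrite /half_pow /= Cmult_1_r E_plus.
  suff -> : E (IZR j) = 1 by rewrite Cmult_1_r.
  have hn : forall n : nat, E (INR n) = 1.
    elim=> [|n IHn]; first by rewrite /E Cmult_0_r Cexp_0.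
    by rewrite S_INR RtoC_plus E_periodic.
  case: (Z_le_gt_dec 0 j) => hj.
    by rewrite -(Z2Nat.id j hj) -INR_IZR_INZ.
  have := hn (Z.to_nat (- j)); rewrite INR_IZR_INZ Z2Nat.id; last by lia.
  move=> h; have := E_plus (IZR (- j)) (IZR j).
  rewrite h -RtoC_plus -plus_IZR Z.add_opp_diag_l /E Cmult_0_r Cexp_0 => ->; ring.
rewrite half_powS Cmult_assoc => e; apply: IH.
rewrite -E_sqr e; ring.
Qed.

Lemma dilate_dup N (x : C) j : (x = z + IZR j)%C -> dilate N x = (dilate (S N) x + dilate (S N) (x + INR (2 ^ N)))%C.
Proof.
move=> ex; rewrite /dilate.
have h := hdup (x * half_pow N)%C; rewrite {1}ex in h; have {}h := h (E_level N j).
have e : ((x + INR (2 ^ N)) * half_pow (S N) = x * half_pow N * /2 + /2)%C.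
  have := half_pow_two N => e; rewrite half_powS.
  transitivity (x * half_pow N * /2 + (half_pow N * INR (2 ^ N)) * / 2)%C; first ring.
  by rewrite e; ring.
have e2 : (x * half_pow (S N) = x * half_pow N * / 2)%C by rewrite half_powS; ring.
have n2 : (2 ^ s)%C <> RtoC 0 by apply: Cpow_nz; apply: RtoC_neq; lra.
rewrite e e2 -Cmult_plus_distr_l -h half_powS Cpow_mult_l Cpow_inv; last by apply: RtoC_neq; lra.
by field.
Qed.

Lemma G_periodic_Z w n : G (w - INR n)%C = G w.
Proof.
elim: n => [|n IH]; first by congr G; rewrite /=; ring.
rewrite -[LHS]hper -[RHS]IH; congr G; rewrite S_INR RtoC_plus; ring.
Qed.

(** The two points differ by $2^{N+1}$, the period at level $N+1$. This freedom of sign keeps the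
    lattice points centred at 0. *)
Lemma dilate_periodic N x : dilate (S N) (x + INR (2 ^ N))%C = dilate (S N) (x - INR (2 ^ N))%C.
Proof.
rewrite /dilate; congr (_ * _)%C; rewrite -(G_periodic_Z ((x + INR (2 ^ N)) * half_pow (S N)) 1); congr G.
have := half_pow_two N => e; rewrite half_powS.
transitivity (x * half_pow N * /2 + (half_pow N * INR (2 ^ N)) * / 2 - 1)%C; first by rewrite /=; ring.
transitivity (x * half_pow N * /2 - (half_pow N * INR (2 ^ N)) * / 2)%C; last by ring.
rewrite e; field.
Qed.

Definition dilate_pair (N j : nat) : C := (dilate N (z + INR j) + dilate N (z - INR (S j)))%C.

Lemma G_sum N : G z = csum (dilate_pair (S N)) (2 ^ N).
Proof.
elim: N => [|N ->].
  rewrite /= /dilate_pair -[G z](_ : dilate 0 z = _); last by rewrite /dilate /half_pow /= Cmult_1_r Cpow_1_l; ring.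
  rewrite (dilate_dup 0 z 0); last by rewrite /=; ring.
  rewrite dilate_periodic /= (_ : z + 0 = z)%C; [ring | ring].
rewrite (_ : 2 ^ S N = 2 ^ N + 2 ^ N)%nat; last by rewrite /=; lia.
(* The pair of index $j$ splits into the pair of the same index and the pair of index $2^{N+1}-1-j$;
   hence the second half is read backwards. *)
rewrite csum_add [csum (fun i => dilate_pair _ (_ + i)%nat) _]csum_rev -csum_plus.
apply: csum_ext => j hj; rewrite /dilate_pair.
have e1 : (z + INR j = z + IZR (Z.of_nat j))%C by rewrite INR_IZR_INZ.
have e2 : (z - INR (S j) = z + IZR (- Z.of_nat (S j)))%C by rewrite INR_IZR_INZ opp_IZR RtoC_opp.
rewrite (dilate_dup (S N) _ _ e1) (dilate_dup (S N) _ _ e2) dilate_periodic.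
have hI : INR (2 ^ N + (2 ^ N - 1 - j)) = INR (2 ^ S N) - INR (S j).
  by rewrite -minus_INR; [congr INR; rewrite /=; lia | rewrite /=; lia].
have -> : (z + INR j - INR (2 ^ S N) = z - INR (S (2 ^ N + (2 ^ N - 1 - j))))%C.
  have -> : INR (S (2 ^ N + (2 ^ N - 1 - j))) = INR (2 ^ S N) - INR j by rewrite S_INR hI S_INR; ring.
  rewrite RtoC_minus; ring.
have -> : (z - INR (S j) + INR (2 ^ S N) = z + INR (2 ^ N + (2 ^ N - 1 - j)))%C.
  rewrite hI RtoC_minus; ring.
ring.
Qed.

(** Comparison with a telescoping series: $1/n^2\le2(1/n-1/(n+1))$. *)
Lemma ex_series_inv2 : ex_series (fun n => / INR (S n) ^ 2).
Proof.
have h : is_series (fun n => / INR (S n) - / INR (S (S n))) 1.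
  have hl : is_lim_seq (fun n => 1 - / INR (S (S n))) (Finite (1 - 0)).
    apply: is_lim_seq_minus'; first exact: is_lim_seq_const.
    have h : is_lim_seq (fun n => INR (S (S n))) p_infty.
      apply/(is_lim_seq_incr_1 (fun n => INR (S n)) p_infty); apply/(is_lim_seq_incr_1 INR p_infty); exact: is_lim_seq_INR.
    exact: (is_lim_seq_inv _ _ h).
  rewrite Rminus_0_r in hl; apply: (is_lim_seq_ext _ _ _ _ hl) => n.
  elim: n => [|n IH]; first by rewrite sum_O /=; field.
  rewrite sum_Sn -IH -[plus _ _]/(_ + _); ring.
apply: (ex_series_le (fun n => / INR (S n) ^ 2) (fun n => 2 * (/ INR (S n) - / INR (S (S n))))).
  move=> n; have p : 0 < INR (S n) by apply: lt_0_INR; lia.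
  suff h2 : / INR (S n) ^ 2 <= 2 * (/ INR (S n) - / INR (S (S n))).
    apply: Rle_trans h2; apply: Req_le; apply: Rabs_pos_eq.
    by apply: Rlt_le; apply: Rinv_0_lt_compat; apply: pow_lt.
  rewrite [INR (S (S n))]S_INR.
  apply: (Rmult_le_reg_r (INR (S n) * (INR (S n) * (INR (S n) + 1)))); first by nra.
  have h1 : 1 <= INR (S n) by rewrite S_INR; have := pos_INR n; lra.
  rewrite (_ : / INR (S n) ^ 2 * _ = INR (S n) + 1); last by field; lra.
  rewrite (_ : 2 * _ * _ = 2 * INR (S n)); last by field; lra.
  lra.
by apply: ex_series_scal_l; exists 1.
Qed.

(* Iterating the duplication formula writes [G z] as a finite sum of dilates of [G]; each
   term tends to [1 / (z + j)^s], and the terms are dominated. *)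
Lemma partial_fractions : isS (fun j => / (z + INR j) ^ s + / (z - INR (S j)) ^ s)%C (G z).
Proof.
have pS : forall j, 0 < INR (S j) by move=> j; apply: lt_0_INR; lia.
have p1 : forall j, 0 < Cmod (z + INR j)%C by move=> j; apply: Rlt_le_trans (hz1 j); have := pS j; nra.
have p2 : forall j, 0 < Cmod (z - INR (S j))%C by move=> j; apply: Rlt_le_trans (hz2 j); have := pS j; nra.
(* With $|\mathrm{Re}\,z|\le2^{N_0}/2$ and $M\ge N_0$, a point with
   $|\mathrm{Re}\,x|\le|\mathrm{Re}\,z|+2^M$ satisfies $|\mathrm{Re}\,x|/2^{M+1}\le3/4$; this is the
   origin of the constant $3/4$. *)
have [N0 hN0] : exists N0, Rabs (Re z) <= INR (2 ^ N0) / 2.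
  have [n hn] := nfloor_ex (2 * Rabs (Re z)) ltac:(have := Rabs_pos (Re z); lra).
  exists (S n).
  have : (S n < 2 ^ S n)%nat by apply: Nat.pow_gt_lin_r; lia.
  by move=> /lt_INR; rewrite S_INR; lra.
pose b (j : nat) := (2 * K / c ^ s) * / INR (S j) ^ 2.
have hb : forall j, 0 <= b j.
  move=> j; apply: Rmult_le_pos.
    by apply: Rdiv_le_0_compat; [lra | exact: pow_lt].
  by apply: Rlt_le; apply: Rinv_0_lt_compat; apply: pow_lt; exact: pS.
have sb : ex_series b by apply: ex_series_scal_l; exact: ex_series_inv2.
(* Terms past the finite sum are set to 0, so that every level is a series with sum $G(z)$. *)
pose a (N j : nat) : C := match Nat.ltb j (2 ^ (N + N0)) with true => dilate_pair (S (N + N0)) j | false => RtoC 0 end.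
have h1 : forall N n, Cmod (a N n) <= b n.
  move=> N n; rewrite /a; case: Nat.ltb_spec => hn; last by rewrite Cmod_0.
  have one : 1 <= INR (S n) by rewrite S_INR; have := pos_INR n; lra.
  have gen : forall x, c * INR (S n) <= Cmod x -> Rabs (Re x) <= Rabs (Re z) + INR (2 ^ (N + N0)) ->
     Im x = Im z -> Cmod (dilate (S (N + N0)) x) <= K / c ^ s * / INR (S n) ^ 2.
    move=> x hx hr hi.
    have px : 0 < Cmod x by apply: Rlt_le_trans hx; nra.
    apply: Rle_trans (hbnd _ _ _ _ _) _.
    - by apply/Cmod_gt_0.
    - have e : INR (2 ^ (N + N0)) * (/2) ^ (N + N0) = 1.
        rewrite pow_INR (_ : INR 2 = 2); last by rewrite /=; lra.
        by rewrite -Rpow_mult_distr Rinv_r ?pow1; [ | lra].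
      have hle : INR (2 ^ N0) <= INR (2 ^ (N + N0)) by apply: le_INR; apply: Nat.pow_le_mono_r; lia.
      rewrite [_ ^ S _]/=; have := half_pow_pos (N + N0); nra.
    - by rewrite hi; lra.
    - rewrite /Rdiv Rmult_assoc; apply: Rmult_le_compat_l => //.
      rewrite -Rinv_mult; apply: Rinv_le_contravar.
        by apply: Rmult_lt_0_compat; [exact: pow_lt | apply: pow_lt; lra].
      apply: Rle_trans (_ : (c * INR (S n)) ^ s <= _); last by apply: pow_incr; split=> //; nra.
      rewrite Rpow_mult_distr; apply: Rmult_le_compat_l; first by apply: pow_le; lra.
      exact: Rle_pow.
  rewrite /dilate_pair; apply: Rle_trans (Cmod_triangle _ _) _.
  have hlt : INR (S n) <= INR (2 ^ (N + N0)) by apply: le_INR; lia.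
  have hnn := pos_INR n; have := S_INR n => eS.
  have g1 := gen (z + INR n)%C (hz1 n); have g2 := gen (z - INR (S n))%C (hz2 n).
  have {}g1 := g1 ltac:(rewrite /Re /=; apply: Rle_trans (Rabs_triang _ _) _; rewrite (Rabs_pos_eq (INR n)) //; lra) ltac:(rewrite /Im /=; ring).
  have {}g2 := g2 ltac:(rewrite [Re _]/= -/(INR (S n)) ; apply: Rle_trans (Rabs_triang _ _) _; rewrite Rabs_Ropp (Rabs_pos_eq (INR (S n))) /Re; lra) ltac:(rewrite /Im /=; ring).
  rewrite /b (_ : 2 * K / c ^ s = K / c ^ s + K / c ^ s); [lra | field; apply: pow_nonzero; lra].
have h2 : forall n, Clim (fun N => a N n) (/ (z + INR n) ^ s + / (z - INR (S n)) ^ s)%C.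
  move=> n.
  have l1 := hlim (z + INR n)%C ltac:(apply/Cmod_gt_0; exact: p1).
  have l2 := hlim (z - INR (S n))%C ltac:(apply/Cmod_gt_0; exact: p2).
  have l3 := Clim_sub (fun N => S (N + N0)) _ _ ltac:(move=> m /=; lia) (Clim_plus _ _ _ _ l1 l2).
  apply: (Clim_ext_from (S n) _ _ _ _ l3) => N hN; rewrite /a.
  have : (N + N0 < 2 ^ (N + N0))%nat by apply: Nat.pow_gt_lin_r; lia.
  by case: Nat.ltb_spec => // h h'; lia.
have h3 : forall N, isS (a N) (G z).
  move=> N; rewrite (G_sum (N + N0)).
  rewrite (csum_ext _ (a N)); last by move=> i hi; rewrite /a; case: Nat.ltb_spec => //; lia.
  by apply: isS_fin => n hn; rewrite /a; case: Nat.ltb_spec => //; lia.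
have [t [ht hGt]] := tannery b hb sb a _ (fun _ => G z) h1 h2 h3.
by rewrite (Clim_unique _ _ _ (Clim_const (G z)) hGt).
Qed.

End PartialFractions.

(** * Lower bounds for $1-E(w)$ near $w=0$ *)

Lemma E_pair u v : E (u, v) = (RtoC (exp (- (2 * PI * v))) * (cos (2 * PI * u), sin (2 * PI * u)))%C.
Proof.
rewrite /E (_ : (2 * PI * Ci * (u, v))%C = (- (2 * PI * v), 2 * PI * u)%R).
  by rewrite /Cexp /Cmult /RtoC /Re /Im /=; f_equal; ring.
by rewrite /Ci /Cmult /RtoC /=; f_equal; ring.
Qed.

Lemma Cmod_E z : Cmod (E z) = exp (- (2 * PI * Im z)).
Proof.
case: z => u v; rewrite E_pair Cmod_mult Cmod_R Rabs_pos_eq; last by apply: Rlt_le; exact: exp_pos.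
rewrite [X in _ * X](_ : _ = 1) ?Rmult_1_r // /Cmod /=.
rewrite (_ : _ + _ = Rsqr (sin (2 * PI * u)) + Rsqr (cos (2 * PI * u))); last by rewrite /Rsqr; ring.
by rewrite sin2_cos2 sqrt_1.
Qed.

Lemma Cmod_E_lt z : 0 < Im z -> Cmod (E z) < 1.
Proof.
move=> h; rewrite Cmod_E -exp_0; apply: exp_increasing; have := PI_RGT_0; nra.
Qed.

Lemma Cmod2 (x y : R) : Cmod (x, y) ^ 2 = x * x + y * y.
Proof. rewrite /Cmod pow2_sqrt /=; [ring | nra]. Qed.

(** In $\sin\pi u=2\sin(\pi u/2)\cos(\pi u/2)$ with $|u|\le3/4$ the half angle is at most $3\pi/8$,
    where the cosine is smallest. *)
Definition cos_3pi8 : R := cos (3 * PI / 8).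

Lemma cos_3pi8_pos : 0 < cos_3pi8.
Proof. rewrite /cos_3pi8; have := PI_RGT_0; move=> h; apply: cos_gt_0; lra. Qed.

Lemma cos_3pi8_le1 : cos_3pi8 <= 1. Proof. exact: (proj2 (COS_bound _)). Qed.

Lemma sin_lower u : Rabs u <= 3/4 -> PI ^ 2 * cos_3pi8 ^ 4 * u ^ 2 <= sin (PI * u) ^ 2.
Proof.
move=> hu; have hpi := PI_RGT_0; have hk := cos_3pi8_pos.
have main : forall v, 0 <= v <= 3/4 -> PI * cos_3pi8 ^ 2 * v <= sin (PI * v).
  move=> v hv.
  have cdec : forall x, 0 <= x <= 3 * PI / 8 -> cos_3pi8 <= cos x.
    by move=> x hx; rewrite /cos_3pi8; apply: cos_decr_1; lra.
  rewrite (_ : PI * v = 2 * (PI * v / 2)); last lra.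
  rewrite sin_2a.
  have h1 := cdec (PI * v / 2) ltac:(nra).
  have h2 : cos_3pi8 * (PI * v / 2) <= sin (PI * v / 2).
    case: (Req_dec v 0) => [->|hv0]; first by rewrite (_ : PI * 0 / 2 = 0) ?sin_0; lra.
    have [c [hc1 hc2]] := MVT_cor2 sin cos 0 (PI * v / 2) ltac:(nra) (fun c _ => derivable_pt_lim_sin c).
    rewrite sin_0 !Rminus_0_r in hc1; rewrite hc1; apply: Rmult_le_compat_r; first nra.
    apply: cdec; nra.
  have h3 : 0 <= cos_3pi8 * (PI * v / 2) by apply: Rmult_le_pos; nra.
  have := Rmult_le_compat _ _ _ _ h3 (Rlt_le _ _ hk) h2 h1; rewrite /=; lra.
have sq : forall v, 0 <= v <= 3/4 -> PI ^ 2 * cos_3pi8 ^ 4 * v ^ 2 <= sin (PI * v) ^ 2.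
  move=> v hv; rewrite (_ : PI ^ 2 * cos_3pi8 ^ 4 * v ^ 2 = (PI * cos_3pi8 ^ 2 * v) ^ 2); last ring.
  apply: pow_incr; split; last exact: main.
  by apply: Rmult_le_pos; [apply: Rmult_le_pos; [lra | apply: pow2_ge_0] | lra].
case: (Rle_dec 0 u) => h0; first by apply: sq; rewrite Rabs_pos_eq // in hu.
have := sq (- u); rewrite Rabs_left in hu; last lra.
rewrite Ropp_mult_distr_r_reverse sin_neg (_ : (- u) ^ 2 = u ^ 2); last ring.
rewrite (_ : (- sin (PI * u)) ^ 2 = sin (PI * u) ^ 2); last ring.
by apply; lra.
Qed.

(** Write $1-e^{-y}=e^{-y/2}(e^{y/2}-e^{-y/2})$; the last factor is at least $|y|/2$ in absolute
    value because $e^x\ge1+x$. *)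
Lemma exp_lower y : exp (- y) * (y ^ 2 / 4) <= (1 - exp (- y)) ^ 2.
Proof.
set a := exp (y / 2); set b := exp (- (y / 2)).
have ab : a * b = 1 by rewrite /a /b -exp_plus Rplus_opp_r exp_0.
have e : exp (- y) = b * b by rewrite /b -exp_plus; congr exp; lra.
have ha : 1 + y / 2 <= a by exact: exp_ineq1_le.
have hb : 1 - y / 2 <= b by exact: exp_ineq1_le.
have pa : 0 < a by exact: exp_pos. have pb : 0 < b by exact: exp_pos.
rewrite e (_ : (1 - b * b) ^ 2 = b * b * (a - b) ^ 2); last first.
  rewrite (_ : b * b * (a - b) ^ 2 = (a * b - b * b) ^ 2); last ring.
  by rewrite ab.
apply: Rmult_le_compat_l; first by nra.
rewrite (_ : y ^ 2 / 4 = (y / 2) ^ 2); last by field.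
case: (Rle_dec 0 y) => hy.
  have : y / 2 <= a - b by nra.
  by move=> h; apply: pow_incr; lra.
have : - (y / 2) <= b - a by nra.
move=> h; rewrite (_ : (y / 2) ^ 2 = (- (y / 2)) ^ 2); last ring.
by rewrite (_ : (a - b) ^ 2 = (b - a) ^ 2); [apply: pow_incr; lra | ring].
Qed.

Definition sine_bound : R := PI ^ 2 * cos_3pi8 ^ 4.

Lemma sine_bound_pos : 0 < sine_bound.
Proof. by apply: Rmult_lt_0_compat; apply: pow_lt; [exact: PI_RGT_0 | exact: cos_3pi8_pos]. Qed.

(** For $w=u+iv$ and $r=|E(w)|$ one has $|1-E(w)|^2=(1-r)^2+4r\sin^2\pi u$. Keeping the factor $r$
    on the left makes the resulting bound for $E/(1-E)^2$ uniform in the imaginary part. *)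
Lemma one_minus_E_lower w : Rabs (Re w) <= 3/4 -> sine_bound * Cmod (E w) * Cmod w ^ 2 <= Cmod (1 - E w)%C ^ 2.
Proof.
case: w => u v; rewrite Cmod_E /Re /Im [fst _]/= [snd _]/= => hu; have hpi := PI_RGT_0.
have h1 := sin_lower u hu; have h2 := exp_lower (2 * PI * v).
set r := exp (- (2 * PI * v)) in h2 *.
have pr : 0 < r by exact: exp_pos.
have -> : Cmod (1 - E (u, v))%C ^ 2 = (1 - r) ^ 2 + 4 * r * sin (PI * u) ^ 2.
  rewrite E_pair -/r (_ : (1 - r * (cos (2 * PI * u), sin (2 * PI * u)))%C = (1 - r * cos (2 * PI * u), - (r * sin (2 * PI * u)))); last first.
    by rewrite /Cminus /Cplus /Copp /Cmult /RtoC /=; f_equal; ring.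
  rewrite Cmod2 (_ : 2 * PI * u = 2 * (PI * u)); last ring.
  rewrite cos_2a_sin sin_2a.
  have := sin2_cos2 (PI * u); rewrite /Rsqr => h.
  have h3 : cos (PI * u) * cos (PI * u) = 1 - sin (PI * u) * sin (PI * u) by lra.
  transitivity ((1 - r * (1 - 2 * sin (PI * u) * sin (PI * u))) ^ 2 + 4 * r * r * sin (PI * u) ^ 2 * (cos (PI * u) * cos (PI * u))); first ring.
  rewrite h3; ring.
rewrite Cmod2 /sine_bound.
have hk : PI ^ 2 * cos_3pi8 ^ 4 * v ^ 2 <= (2 * PI * v) ^ 2 / 4.
  rewrite (_ : (2 * PI * v) ^ 2 / 4 = PI ^ 2 * 1 * v ^ 2); last by field.
  apply: Rmult_le_compat_r; first exact: pow2_ge_0.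
  apply: Rmult_le_compat_l; first exact: pow2_ge_0.
  rewrite -(pow1 4); apply: pow_incr; have := cos_3pi8_pos; have := cos_3pi8_le1; lra.
have := pow2_ge_0 (sin (PI * u)); nra.
Qed.

Lemma one_minus_E_neq0 w : Rabs (Re w) <= 3/4 -> w <> RtoC 0 -> (1 - E w)%C <> RtoC 0.
Proof.
move=> h hw e; have := one_minus_E_lower w h; rewrite e Cmod_0.
have p1 : 0 < Cmod w by apply/Cmod_gt_0.
have p2 : 0 < Cmod (E w) by rewrite Cmod_E; exact: exp_pos.
have p3 := sine_bound_pos; have : 0 < sine_bound * Cmod (E w) * Cmod w ^ 2.
  by apply: Rmult_lt_0_compat; [exact: Rmult_lt_0_compat | exact: pow_lt].
rewrite (_ : 0 ^ 2 = 0); [lra | ring].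
Qed.

Lemma X2_bound w : Rabs (Re w) <= 3/4 -> w <> RtoC 0 -> Cmod (X2 (E w)) <= / sine_bound / Cmod w ^ 2.
Proof.
move=> h hw; have h1 := one_minus_E_lower w h; have h2 := one_minus_E_neq0 w h hw.
have p1 : 0 < Cmod w by apply/Cmod_gt_0. have p2 : 0 < Cmod (1 - E w)%C by apply/Cmod_gt_0.
have p3 := sine_bound_pos.
rewrite /X2 Cmod_div; last by exact: Cpow_nz.
rewrite Cmod_pow; have p4 : 0 < Cmod (1 - E w)%C ^ 2 by exact: pow_lt.
have p5 : 0 < Cmod w ^ 2 by exact: pow_lt.
apply: (Rmult_le_reg_r (Cmod (1 - E w)%C ^ 2)) => //.
rewrite /Rdiv Rmult_assoc Rinv_l ?Rmult_1_r; last lra.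
apply: (Rmult_le_reg_l (sine_bound * Cmod w ^ 2)); first exact: Rmult_lt_0_compat.
rewrite (_ : sine_bound * Cmod w ^ 2 * (/ sine_bound * / Cmod w ^ 2 * Cmod (1 - E w)%C ^ 2) = Cmod (1 - E w)%C ^ 2); last by field; lra.
lra.
Qed.

Lemma neq1_minus (q : C) : q <> RtoC 1 -> (1 - q)%C <> RtoC 0.
Proof.
move=> h e; apply: h; have -> : (q = 1 - (1 - q))%C by ring.
by rewrite e; ring.
Qed.

Lemma X4_X2 (q : C) : q <> RtoC 1 -> X4 q = (X2 q + 6 * X2 q ^ 2)%C.
Proof. by move=> h; have n := neq1_minus q h; rewrite /X4 /X2; field. Qed.

Lemma E_dup_args w : E w <> 1 -> (1 - E (w * /2) <> 0)%C /\ (1 + E (w * /2) <> 0)%C /\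
  E (w * /2 + /2)%C = (- E (w * /2))%C /\ E w = (E (w * /2) * E (w * /2))%C.
Proof.
move=> h; have e := E_sqr w; rewrite -e in h.
have e2 : E (w * /2 + /2)%C = (- E (w * /2))%C by rewrite E_plus E_half; ring.
split; last split=> //.
- move=> e3; apply: h; have -> : (E (w * /2) = 1 - (1 - E (w * /2)))%C by ring.
  by rewrite e3; ring.
- move=> e3; apply: h; have -> : (E (w * /2) = (1 + E (w * /2)) - 1)%C by ring.
  by rewrite e3; ring.
Qed.

Section Instances.
Variables (z : C) (c : R).
Hypothesis hc : 0 < c.
Hypothesis hz1 : forall j, c * INR (S j) <= Cmod (z + INR j)%C.
Hypothesis hz2 : forall j, c * INR (S j) <= Cmod (z - INR (S j))%C.
Hypothesis hEz : E z <> 1.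

Lemma Re_scal_half_pow N x : Re (x * half_pow N)%C = Re x * (/2) ^ N.
Proof. by case: x => a b; rewrite /Re /half_pow /Cmult /RtoC /=; ring. Qed.

Lemma Im_scal_half_pow N x : Im (x * half_pow N)%C = Im x * (/2) ^ N.
Proof. by case: x => a b; rewrite /Im /half_pow /Cmult /RtoC /=; ring. Qed.

Lemma Cmod_half_pow N : Cmod (half_pow N) = (/2) ^ N.
Proof. by rewrite /half_pow Cmod_R Rabs_pos_eq //; have := half_pow_pos N; lra. Qed.

Lemma hbnd_pre N x : x <> RtoC 0 -> Rabs (Re x) * (/2) ^ N <= 3/4 ->
  Rabs (Re (x * half_pow N)%C) <= 3/4 /\ (x * half_pow N)%C <> RtoC 0.
Proof.
move=> hx hr; split; last by apply: Cmult_neq_0 => //; exact: half_pow_neq0.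
by rewrite Re_scal_half_pow Rabs_mult (Rabs_pos_eq ((/2) ^ N)) //; have := half_pow_pos N; lra.
Qed.

Lemma lim_quot_neq0 x : x <> RtoC 0 -> (- (2 * PI * Ci * x))%C <> RtoC 0.
Proof.
move=> hx e; apply: (Cmult_neq_0 _ _ two_pi_i_neq0 hx).
by rewrite (_ : _ * _ = - - (2 * PI * Ci * x))%C; [rewrite e; ring | ring].
Qed.

Lemma partial_fractions2 : isS (fun j => / (z + INR j) ^ 2 + / (z - INR (S j)) ^ 2)%C (kappa2 * X2 (E z)).
Proof.
have hk := sine_bound_pos.
apply: (partial_fractions (fun z => kappa2 * X2 (E z))%C 2 z c (Cmod kappa2 * / sine_bound)) => //.
- by move=> w; rewrite E_periodic.
- move=> w /E_dup_args [n1 [n2 [-> ->]]]; rewrite /X2; field.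
  have n3 : (1 - E (w * / 2) * E (w * / 2) <> 0)%C.
    rewrite (_ : _ - _ = (1 - E (w * / 2)) * (1 + E (w * / 2)))%C; [exact: Cmult_neq_0 | ring].
  by repeat (apply: conj => //); move=> e; apply: n2; rewrite -e; ring.
- move=> x hx; have l1 := E_lim x; have l2 := E_quot_lim x; have n := lim_quot_neq0 x hx.
  have l3 := Clim_scal kappa2 _ _ (Clim_mult _ _ _ _ l1 (Clim_inv _ _ (Cmult_neq_0 _ _ n n) (Clim_mult _ _ _ _ l2 l2))).
  rewrite (_ : / x ^ 2 = kappa2 * (1 * / (- (2 * PI * Ci * x) * - (2 * PI * Ci * x))))%C; last first.
    by rewrite /kappa2; have := two_pi_i_neq0; set t := (2 * PI * Ci)%C => ht; field.
  have [N0 hN0] := half_pow_lim_scal x (3/4) ltac:(lra).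
  apply: (Clim_ext_from N0 _ _ _ _ l3) => N hN.
  have hw := hN0 N hN; rewrite (_ : x * half_pow N - 0 = x * half_pow N)%C in hw; last ring.
  have [r1 r2] : Rabs (Re (x * half_pow N)%C) <= 3/4 /\ (x * half_pow N)%C <> RtoC 0.
    by split; [apply: Rle_trans (re_le_Cmod _) _; lra | apply: Cmult_neq_0 => //; exact: half_pow_neq0].
  have h1 := one_minus_E_neq0 _ r1 r2; have h2 := half_pow_neq0 N.
  by rewrite /dilate /X2; field.
- by apply: Rmult_le_pos; [exact: Cmod_ge_0 | apply: Rlt_le; exact: Rinv_0_lt_compat].
- move=> N x hx hr hi; have [r1 r2] := hbnd_pre N x hx hr; have h := X2_bound _ r1 r2.
  rewrite /dilate Cmod_mult Cmod_pow Cmod_half_pow Cmod_mult; rewrite Cmod_mult Cmod_half_pow in h.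
  have p := half_pow_pos N; have px : 0 < Cmod x by apply/Cmod_gt_0.
  apply: Rle_trans (_ : ((/2) ^ N) ^ 2 * (Cmod kappa2 * (/ sine_bound / (Cmod x * (/2) ^ N) ^ 2)) <= _).
    apply: Rmult_le_compat_l; first exact: pow2_ge_0.
    apply: Rmult_le_compat_l => //; exact: Cmod_ge_0.
  by apply: Req_le; field; lra.
Qed.

Lemma partial_fractions4 : isS (fun j => / (z + INR j) ^ 4 + / (z - INR (S j)) ^ 4)%C (kappa4 * X4 (E z)).
Proof.
have hk := sine_bound_pos; have hk' : 0 < / sine_bound by exact: Rinv_0_lt_compat.
(* On the points considered $|w|^2\le B$, so $1/|w|^2\le B/|w|^4$; this absorbs the linear term of
   [X4_X2] in the fourth-order bound. *)
pose B := (3/4) ^ 2 + Rabs (Im z) ^ 2.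
have hB : 0 <= B by have := pow2_ge_0 (Rabs (Im z)); rewrite /B; lra.
apply: (partial_fractions (fun z => kappa4 * X4 (E z))%C 4 z c (Cmod kappa4 * (/ sine_bound * B + 6 * (/ sine_bound) ^ 2))) => //.
- by move=> w; rewrite E_periodic.
- move=> w /E_dup_args [n1 [n2 [-> ->]]]; rewrite /X4; field.
  have n3 : (1 - E (w * / 2) * E (w * / 2) <> 0)%C.
    rewrite (_ : _ - _ = (1 - E (w * / 2)) * (1 + E (w * / 2)))%C; [exact: Cmult_neq_0 | ring].
  by repeat (apply: conj => //); move=> e; apply: n2; rewrite -e; ring.
- move=> x hx; have l1 := E_lim x; have l2 := E_quot_lim x; have n := lim_quot_neq0 x hx.
  have l4 := Clim_mult _ _ _ _ l2 l2; have nn := Cmult_neq_0 _ _ n n.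
  have l5 : Clim (fun N => 1 + 4 * E (x * half_pow N) + E (x * half_pow N) * E (x * half_pow N))%C (1 + 4 * 1 + 1 * 1)%C.
    apply: Clim_plus; last exact: Clim_mult.
    apply: Clim_plus; [exact: Clim_const | exact: Clim_scal].
  have l3 := Clim_scal kappa4 _ _ (Clim_mult _ _ _ _ (Clim_mult _ _ _ _ l1 l5) (Clim_inv _ _ (Cmult_neq_0 _ _ nn nn) (Clim_mult _ _ _ _ l4 l4))).
  set L := (kappa4 * _)%C in l3.
  rewrite (_ : / x ^ 4 = L)%C; last first.
    by rewrite /L /kappa4; have := two_pi_i_neq0; set t := (2 * PI * Ci)%C => ht; field.
  have [N0 hN0] := half_pow_lim_scal x (3/4) ltac:(lra).
  apply: (Clim_ext_from N0 _ _ _ _ l3) => N hN.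
  have hw := hN0 N hN; rewrite (_ : x * half_pow N - 0 = x * half_pow N)%C in hw; last ring.
  have [r1 r2] : Rabs (Re (x * half_pow N)%C) <= 3/4 /\ (x * half_pow N)%C <> RtoC 0.
    by split; [apply: Rle_trans (re_le_Cmod _) _; lra | apply: Cmult_neq_0 => //; exact: half_pow_neq0].
  have h1 := one_minus_E_neq0 _ r1 r2; have h2 := half_pow_neq0 N.
  by rewrite /dilate /X4; field.
- apply: Rmult_le_pos; [exact: Cmod_ge_0 | have := pow2_ge_0 (/ sine_bound); nra].
- move=> N x hx hr hi; have [r1 r2] := hbnd_pre N x hx hr; have h := X2_bound _ r1 r2.
  have hE : E (x * half_pow N) <> 1.
    by move=> e; apply: (one_minus_E_neq0 _ r1 r2); rewrite e; ring.
  rewrite /dilate X4_X2 // Cmod_mult Cmod_pow Cmod_half_pow Cmod_mult.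
  have p := half_pow_pos N; have px : 0 < Cmod x by apply/Cmod_gt_0.
  have pw : 0 < Cmod (x * half_pow N)%C by apply/Cmod_gt_0.
  have hwB : Cmod (x * half_pow N)%C ^ 2 <= B.
    have hle : (/2) ^ N <= 1 by rewrite -(pow1 N); apply: pow_incr; lra.
    have r3 : Rabs (Im (x * half_pow N)%C) <= Rabs (Im z).
      rewrite Im_scal_half_pow Rabs_mult (Rabs_pos_eq ((/2) ^ N)); last lra.
      have := Rabs_pos (Im x); nra.
    move: r1 r3; case: (x * half_pow N)%C => a b; rewrite Cmod2 /B /Re /Im [fst _]/= [snd (a, b)]/= => r1 r3.
    have e1 : a * a = Rabs a ^ 2 by rewrite pow2_abs; ring.
    have e2 : b * b = Rabs b ^ 2 by rewrite pow2_abs; ring.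
    by rewrite e1 e2; apply: Rplus_le_compat; apply: pow_incr; split => //; exact: Rabs_pos.
  have e : Cmod (x * half_pow N)%C = Cmod x * (/2) ^ N by rewrite Cmod_mult Cmod_half_pow.
  set W := Cmod (x * half_pow N)%C in h pw hwB e.
  have pW2 : 0 < W ^ 2 by exact: pow_lt.
  have hX : Cmod (X2 (E (x * half_pow N)) + 6 * X2 (E (x * half_pow N)) ^ 2)%C <= (/ sine_bound * B + 6 * (/ sine_bound) ^ 2) / W ^ 4.
    apply: Rle_trans (Cmod_triangle _ _) _; rewrite Cmod_mult Cmod_pow Cmod_R Rabs_pos_eq; last lra.
    have h0 := Cmod_ge_0 (X2 (E (x * half_pow N))).
    have h2 : Cmod (X2 (E (x * half_pow N))) ^ 2 <= (/ sine_bound / W ^ 2) ^ 2 by apply: pow_incr.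
    have h3 : / sine_bound / W ^ 2 <= / sine_bound * B / W ^ 4.
      rewrite (_ : / sine_bound / W ^ 2 = / sine_bound * W ^ 2 / W ^ 4); last by field; lra.
      apply: Rmult_le_compat_r; first by apply: Rlt_le; apply: Rinv_0_lt_compat; exact: pow_lt.
      by apply: Rmult_le_compat_l; lra.
    rewrite (_ : (/ sine_bound * B + 6 * (/ sine_bound) ^ 2) / W ^ 4 = / sine_bound * B / W ^ 4 + 6 * (/ sine_bound / W ^ 2) ^ 2); [lra | by field; lra].
  apply: Rle_trans (_ : ((/2) ^ N) ^ 4 * (Cmod kappa4 * ((/ sine_bound * B + 6 * (/ sine_bound) ^ 2) / W ^ 4)) <= _).
    apply: Rmult_le_compat_l; first by apply: pow_le; lra.
    apply: Rmult_le_compat_l => //; exact: Cmod_ge_0.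
  by apply: Req_le; rewrite e; field; lra.
- lia.
Qed.

End Instances.

(** * Complex powers *)

(** In each open half-plane the cosine and sine of the arctangent bring in
    $\sqrt{1+(x/y)^2}=|z|/|y|$; on the real axis the argument is 0 or $\pi$. *)
Lemma Cexp_Clog z : z <> RtoC 0 -> Cexp (Clog z) = z.
Proof.
move=> hz; have hm : 0 < Cmod z by apply/Cmod_gt_0.
rewrite /Cexp /Clog /Re /Im [fst (_, _)]/= [snd (_, _)]/= exp_ln //.
have key : forall x y, 0 < y -> (sqrt (1 + (x / y)²) = Cmod (x, y) / y)%R.
  move=> x y hy; rewrite (_ : 1 + (x / y)² = (x ^ 2 + y ^ 2) / (y ^ 2)); last by rewrite /Rsqr; field; lra.
  rewrite sqrt_div_alt; last nra.
  by rewrite sqrt_pow2 //; lra.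
have key2 : forall x y, y < 0 -> (sqrt (1 + (x / y)²) = Cmod (x, y) / - y)%R.
  move=> x y hy; rewrite -(_ : Cmod (x, - y) = Cmod (x, y)); last first.
    by rewrite /Cmod /=; congr sqrt; ring.
  rewrite -key; last lra.
  by congr sqrt; rewrite /Rsqr; field; lra.
move: hm hz; case: z => x y; rewrite /Carg /Re /Im [fst _]/= [snd _]/= => hm hz.
case: Rlt_dec => h1.
  rewrite cos_minus sin_minus cos_PI2 sin_PI2 cos_atan sin_atan key //.
  by f_equal; field; lra.
case: Rlt_dec => h2.
  rewrite cos_minus sin_minus cos_neg sin_neg cos_PI2 sin_PI2 cos_atan sin_atan key2 //.
  by f_equal; field; lra.
have y0 : y = 0 by lra.
have e : Cmod (x, y) = Rabs x by rewrite y0 -Cmod_R.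
rewrite e; case: Rlt_dec => h3.
  by rewrite cos_PI sin_PI Rabs_left // y0; f_equal; ring.
by rewrite cos_0 sin_0 Rabs_pos_eq; [rewrite y0; f_equal; ring | lra].
Qed.

(** [isD_log] gives existence of the derivative; its value follows from $e^{\log w}=w$ near $z$. *)
Lemma isD_Clog z : Im z <> 0 -> isD Clog z (/ z)%C.
Proof.
move=> hz; have [l hl] : exists l : C, isD Clog z l := isD_log z hz.
have z0 : z <> RtoC 0 by move=> e; apply: hz; rewrite e.
have h1 := isD_comp Cexp Clog _ _ _ (isD_exp (Clog z)) hl.
rewrite Cexp_Clog // in h1.
have hm : 0 < Cmod z by apply/Cmod_gt_0.
have h2 : isD (fun w => Cexp (Clog w)) z (RtoC 1).
  apply: (isD_local (fun w => w) _ _ _ (Cmod z) hm) (isD_id z) => w hw.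
  rewrite Cexp_Clog // => e; move: hw; rewrite e -Cmod_opp (_ : - (0 - z) = z)%C; [lra | ring].
have e := isD_unique _ _ _ _ h1 h2; apply: (isD_val _ _ _ _ hl).
have -> : (l = l * z * / z)%C by field.
by rewrite e; ring.
Qed.

Lemma Crpow_plus z s t : Crpow z (s + t) = (Crpow z s * Crpow z t)%C.
Proof. by rewrite /Crpow -Cexp_plus; congr Cexp; rewrite RtoC_plus; ring. Qed.

Lemma Crpow_0 z : Crpow z 0 = 1%C.
Proof. by rewrite /Crpow Cmult_0_l Cexp_0. Qed.

Lemma Crpow_neq0 z s : Crpow z s <> RtoC 0.
Proof. exact: Cexp_neq0. Qed.

Lemma Crpow_1 z : z <> RtoC 0 -> Crpow z 1 = z.
Proof. by move=> h; rewrite /Crpow Cmult_1_l Cexp_Clog. Qed.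

Lemma Crpow_INR z n : z <> RtoC 0 -> Crpow z (INR n) = (z ^ n)%C.
Proof.
move=> h; elim: n => [|n IH]; first exact: Crpow_0.
by rewrite S_INR Crpow_plus IH Crpow_1 //= Cmult_comm.
Qed.

Lemma Crpow_opp z s : Crpow z (- s) = (/ Crpow z s)%C.
Proof.
have h := Crpow_plus z s (- s); rewrite Rplus_opp_r Crpow_0 in h.
have n := Crpow_neq0 z s.
rewrite (_ : Crpow z (- s) = / Crpow z s * (Crpow z s * Crpow z (- s)))%C; last by field.
by rewrite -h; ring.
Qed.

Lemma Im_autj g z : Im (autj g z) = IZR (sc g) * Im z.
Proof. by rewrite /autj /Im /=; ring. Qed.

(** If $c=0$ the base is the constant $d$, possibly on the branch cut, and the power is constant; if
    $c\ne0$ the base stays off the real axis, where [Clog] is differentiable. *)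
Lemma isD_Crpow_autj g s z : 0 < Im z ->
  isD (fun w => Crpow (autj g w) s) z (s * (IZR (sc g) / autj g z) * Crpow (autj g z) s)%C.
Proof.
move=> hz; have hj := autj_neq0 g z hz; case: (Req_dec (IZR (sc g)) 0) => hc.
  apply: (isD_ext (fun _ => Crpow (IZR (sd g)) s)).
    by move=> t; rewrite /autj hc; f_equal; ring.
  by apply: (isD_val _ _ _ _ (isD_const _ _)); rewrite hc; field.
have hi : Im (autj g z) <> 0.
  by rewrite Im_autj; apply: Rmult_integral_contrapositive; split => //; lra.
apply: (isD_val _ _ _ _ (isD_comp Cexp (fun w => s * Clog (autj g w))%C _ _ _ (isD_exp _)
  (isD_scal s _ _ _ (isD_comp Clog (autj g) _ _ _ (isD_Clog _ hi) (isD_lin _ _ _))))).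
by rewrite -/(Crpow (autj g z) s); field.
Qed.

(** * The transformation under S *)

(** $\mathrm{Im}(xt+y)=x\,\mathrm{Im}\,t$ bounds $|x|$, and then $|y|\le|xt+y|+|x||t|$. The constant
    $A$ collects both. *)
Lemma lattice_bound (t : C) : 0 < Im t -> exists c, 0 < c /\ forall x y : R, c * (Rabs x + Rabs y) <= Cmod (x * t + y)%C.
Proof.
move=> ht; pose A := / Im t + 1 + Cmod t * / Im t.
have hi : 0 < / Im t by exact: Rinv_0_lt_compat.
have hA : 0 < A by have := Cmod_ge_0 t; rewrite /A; nra.
exists (/ A); split; first exact: Rinv_0_lt_compat.
move=> x y; set M := Cmod _.
have h1 : Rabs x * Im t <= M.
  have e : Im (x * t + y)%C = x * Im t by rewrite /Im /=; ring.
  rewrite -(Rabs_pos_eq (Im t)); last lra.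
  rewrite -Rabs_mult -e; exact: (Rle_trans _ _ _ (Rmax_r _ _) (Rmax_Cmod (x * t + y)%C)).
have h2 : Rabs y <= M + Rabs x * Cmod t.
  rewrite -(Cmod_R y) -(Cmod_R x) -Cmod_mult.
  rewrite (_ : RtoC y = (x * t + y) - x * t)%C; last ring.
  apply: Rle_trans (Cmod_triangle _ _) _; rewrite Cmod_opp -/M; lra.
have h3 : Rabs x <= M * / Im t.
  apply: (Rmult_le_reg_r (Im t)) => //; rewrite Rmult_assoc Rinv_l; lra.
apply: (Rmult_le_reg_l A) => //; rewrite -Rmult_assoc Rinv_r ?Rmult_1_l; last lra.
have := Cmod_ge_0 t; rewrite /A; nra.
Qed.

Lemma INR_S_ge1 n : 1 <= INR (S n).
Proof. rewrite S_INR; have := pos_INR n; lra. Qed.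

(** * The values of zeta at 2 and 4 *)

Lemma zeta_ex s : (2 <= s)%nat -> exists Z, isS (fun j => / INR (S j) ^ s)%C Z.
Proof.
move=> hs; apply: (isS_dom (fun n => / INR (S n) ^ 2)).
- by move=> i; apply: Rlt_le; apply: Rinv_0_lt_compat; apply: pow_lt; have := INR_S_ge1 i; lra.
- exact: ex_series_inv2.
- move=> i; have h := INR_S_ge1 i.
  rewrite Cmod_inv; last by apply: Cpow_nz; apply: RtoC_neq; lra.
  rewrite Cmod_pow Cmod_R Rabs_pos_eq; last lra.
  by apply: Rinv_le_contravar; [apply: pow_lt; lra | apply: Rle_pow].
Qed.

(** The even terms of the zeta series are $2^{-s}$ times the whole series. *)
Lemma zeta_odd s v Z : (1 <= s)%nat -> isS (fun j => / INR (2 * j + 1) ^ s)%C v -> isS (fun j => / INR (S j) ^ s)%C Z ->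
  (Z = v + / 2 ^ s * Z)%C.
Proof.
move=> hs hv hZ.
have e : forall N, csum (fun j => / INR (S j) ^ s)%C (2 * N) =
    (csum (fun j => / INR (2 * j + 1) ^ s) N + / 2 ^ s * csum (fun j => / INR (S j) ^ s) N)%C.
  elim=> [|N IH]; first by rewrite /=; ring.
  rewrite (_ : 2 * S N = S (S (2 * N)))%nat; last lia.
  rewrite !csumS IH (_ : 2 * N + 1 = S (2 * N))%nat; last lia.
  have -> : INR (S (S (2 * N))) = 2 * INR (S N) by rewrite !S_INR mult_INR /=; ring.
  rewrite RtoC_mult Cpow_mult_l Cinv_mult; ring.
have dbl : forall m, (m <= 2 * m)%nat by move=> m; lia.
apply: (Clim_unique _ _ _ (Clim_sub (fun N => 2 * N)%nat _ _ dbl hZ)).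
by apply: Clim_ext (Clim_plus _ _ _ _ hv (Clim_scal (/ 2 ^ s) _ _ hZ)) => N; rewrite e.
Qed.

Lemma half_lattice_bound1 j : 1/2 * INR (S j) <= Cmod (/2 + INR j)%C.
Proof.
rewrite (_ : /2 + INR j = RtoC (/2 + INR j))%C; last by rewrite RtoC_plus RtoC_inv //; lra.
rewrite Cmod_R S_INR; have := pos_INR j => h; rewrite Rabs_pos_eq; lra.
Qed.

Lemma half_lattice_bound2 j : 1/2 * INR (S j) <= Cmod (/2 - INR (S j))%C.
Proof.
rewrite (_ : /2 - INR (S j) = RtoC (- (/2 + INR j)))%C; last first.
  by rewrite S_INR RtoC_opp !RtoC_plus RtoC_inv; [field | lra].
rewrite Cmod_R Rabs_Ropp S_INR; have := pos_INR j => h; rewrite Rabs_pos_eq; lra.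
Qed.

Lemma E_half_neq1 : E (/2)%C <> 1.
Proof. by rewrite E_half => /(f_equal fst) /=; lra. Qed.

(** At $z=1/2$ the two halves of the partial fraction series coincide, and $1/2+j=(2j+1)/2$; so the
    odd sum is $\frac12\,2^{-s}$ times the value there. *)
Lemma odd_of_half s G : (forall x : C, ((- x) ^ s = x ^ s)%C) ->
  isS (fun j => / (/2 + INR j) ^ s + / (/2 - INR (S j)) ^ s)%C G ->
  isS (fun j => / INR (2 * j + 1) ^ s)%C (/ 2 * / 2 ^ s * G)%C.
Proof.
move=> he h; apply: isS_ext (isS_scal (/2 * / 2 ^ s)%C _ _ h) => j.
have -> : (/2 - INR (S j) = - (/2 + INR j))%C by rewrite S_INR RtoC_plus; field.
rewrite he.
have -> : (/2 + INR j = RtoC (INR (2 * j + 1)) * / 2)%C.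
  have e : INR (2 * j + 1) = 2 * INR j + 1 by rewrite plus_INR mult_INR /=; ring.
  by rewrite e RtoC_plus RtoC_mult; field.
have n2 : RtoC 2 <> RtoC 0 by apply: RtoC_neq; lra.
have nj : RtoC (INR (2 * j + 1)) <> 0.
  by apply: RtoC_neq; rewrite plus_INR mult_INR; have := pos_INR j; rewrite [INR 2]/= [INR 1]/=; lra.
rewrite Cpow_mult_l Cpow_inv //; field; split; exact: Cpow_nz.
Qed.

Lemma Ci_sqr : (Ci * Ci = -1)%C.
Proof. by rewrite /Ci /Cmult /RtoC /Copp /=; f_equal; ring. Qed.

(** $E(1/2)=-1$ evaluates the partial fraction series at $1/2$ in closed form, and
    $Z=\frac43(Z-\frac14Z)$ recovers $\zeta(2)$ from its odd part. *)
Lemma zeta2 : isS (fun j => / INR (S j) ^ 2)%C (PI ^ 2 / 6)%C.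
Proof.
have [Z hZ] := zeta_ex 2 ltac:(lia).
have h := odd_of_half 2 _ ltac:(move=> x /=; ring) (partial_fractions2 (/2)%C (1/2) ltac:(lra) half_lattice_bound1 half_lattice_bound2 E_half_neq1).
have e := zeta_odd 2 _ _ ltac:(lia) h hZ.
apply: (isS_val _ _ _ hZ).
have -> : (Z = 4 / 3 * (Z - / 2 ^ 2 * Z))%C by field.
rewrite {1}e E_half /X2 /kappa2.
have -> : ((2 * PI * Ci) ^ 2 = - (4 * PI ^ 2))%C.
  by transitivity (4 * PI ^ 2 * (Ci * Ci))%C; [rewrite /=; ring | rewrite Ci_sqr; ring].
field; split; apply: RtoC_neq; lra.
Qed.

Lemma zeta4 : isS (fun j => / INR (S j) ^ 4)%C (PI ^ 4 / 90)%C.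
Proof.
have [Z hZ] := zeta_ex 4 ltac:(lia).
have h := odd_of_half 4 _ ltac:(move=> x /=; ring) (partial_fractions4 (/2)%C (1/2) ltac:(lra) half_lattice_bound1 half_lattice_bound2 E_half_neq1).
have e := zeta_odd 4 _ _ ltac:(lia) h hZ.
apply: (isS_val _ _ _ hZ).
have -> : (Z = 16 / 15 * (Z - / 2 ^ 4 * Z))%C by field.
rewrite {1}e E_half /X4 /kappa4.
have -> : ((2 * PI * Ci) ^ 4 = 16 * PI ^ 4)%C.
  by transitivity (16 * PI ^ 4 * (Ci * Ci) * (Ci * Ci))%C; [rewrite /=; ring | rewrite Ci_sqr; ring].
field; split; apply: RtoC_neq; lra.
Qed.

(** * Exchange of the two iterated lattice sums *)

Definition weight32 (n : nat) : R := / sqrt (INR (S n)) ^ 3.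

Lemma sqrtS_ge1 n : 1 <= sqrt (INR (S n)).
Proof. by rewrite -sqrt_1; apply: sqrt_le_1_alt; exact: INR_S_ge1. Qed.

Lemma weight32_pos n : 0 <= weight32 n.
Proof. by apply: Rlt_le; apply: Rinv_0_lt_compat; apply: pow_lt; have := sqrtS_ge1 n; lra. Qed.

(** $n^{-3/2}$ is at most 6 times the telescoping difference of $n^{-1/2}$. With $a=\sqrt n$ and
    $b=\sqrt{n+1}$ this reads $b\le6a^2(b-a)$, which follows from $(b-a)(b+a)=1$ and $b\le2a$. *)
Lemma ex_series_weight32 : ex_series weight32.
Proof.
have h : is_series (fun n => / sqrt (INR (S n)) - / sqrt (INR (S (S n)))) 1.
  have hl : is_lim_seq (fun n => 1 - / sqrt (INR (S (S n)))) (Finite (1 - 0)).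
    apply: is_lim_seq_minus'; first exact: is_lim_seq_const.
    have h : is_lim_seq (fun n => INR (S (S n))) p_infty.
      apply/(is_lim_seq_incr_1 (fun n => INR (S n)) p_infty); apply/(is_lim_seq_incr_1 INR p_infty); exact: is_lim_seq_INR.
    have h2 : is_lim_seq (fun n => sqrt (INR (S (S n)))) p_infty.
      exact: filterlim_comp h filterlim_sqrt_p.
    exact: (is_lim_seq_inv _ _ h2).
  rewrite Rminus_0_r in hl; apply: (is_lim_seq_ext _ _ _ _ hl) => n.
  elim: n => [|n IH]; first by rewrite sum_O [INR 1]/= sqrt_1; lra.
  rewrite sum_Sn -IH -[plus _ _]/(_ + _); ring.
apply: (ex_series_le weight32 (fun n => 6 * (/ sqrt (INR (S n)) - / sqrt (INR (S (S n)))))).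
  move=> n; suff h2 : weight32 n <= 6 * (/ sqrt (INR (S n)) - / sqrt (INR (S (S n)))).
    by apply: Rle_trans h2; apply: Req_le; apply: Rabs_pos_eq; exact: weight32_pos.
  rewrite /weight32; have ha := sqrtS_ge1 n; have hb := sqrtS_ge1 (S n).
  have ea := sqrt_sqrt (INR (S n)) (pos_INR _); have eb := sqrt_sqrt (INR (S (S n))) (pos_INR _).
  have eS := S_INR (S n).
  set a := sqrt (INR (S n)) in ha ea *; set b := sqrt (INR (S (S n))) in hb eb *.
  have hab : b * b = a * a + 1 by lra.
  have hb2 : b <= 2 * a by nra.
  have hlt : a < b by nra.
  apply: (Rmult_le_reg_r (a ^ 3 * b)); first by apply: Rmult_lt_0_compat; [apply: pow_lt | ]; lra.
  rewrite (_ : / a ^ 3 * (a ^ 3 * b) = b); last by field; lra.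
  rewrite (_ : 6 * (/ a - / b) * (a ^ 3 * b) = 6 * a ^ 2 * (b - a)); last by field; lra.
  have hd : (b - a) * (b + a) = 1 by lra.
  have h3 : 1 <= (b - a) * (3 * a) by nra.
  have : 2 * a * 1 <= 2 * a * ((b - a) * (3 * a)) by apply: Rmult_le_compat_l; lra.
  rewrite (_ : 2 * a * ((b - a) * (3 * a)) = 6 * a ^ 2 * (b - a)); [lra | ring].
by apply: ex_series_scal_l; exists 1.
Qed.

(** $(n+1)+j\ge\sqrt{(n+1)(j+1)}$ turns the cubic decay of the corrected terms into a product of two
    summable weights, the form of majorant that [fubini] asks for. *)
Lemma weight32_bound n j : / (INR (S n) + INR j) ^ 3 <= weight32 n * weight32 j.
Proof.
rewrite /weight32 -Rinv_mult -Rpow_mult_distr -sqrt_mult_alt; last exact: pos_INR.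
have h1 := INR_S_ge1 n; have h2 := INR_S_ge1 j; have h3 := pos_INR j; have h4 := pos_INR n.
apply: Rinv_le_contravar.
  by apply: pow_lt; apply: sqrt_lt_R0; nra.
apply: pow_incr; split; first exact: sqrt_pos.
rewrite -[X in _ <= X]sqrt_pow2; last lra.
apply: sqrt_le_1_alt; rewrite !S_INR; nra.
Qed.

Section SLaw.
Variables (s : nat) (t : C) (th : nat -> nat -> C) (A : R) (kap R1 R2 : nat -> C) (K e1 e2 Z : C).
Hypothesis ht : 0 < Im t.
Hypothesis hs : (2 <= s)%nat.
Hypothesis heven : forall x : C, ((- x) ^ s = x ^ s)%C.
Definition lat_plus (n m : nat) : C := (/ (INR (S n) * t + INR m) ^ s)%C.
Definition lat_minus (n m : nat) : C := (/ (INR (S n) * t - INR m) ^ s)%C.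
Hypothesis hth : forall n j, Cmod (lat_plus n j + lat_minus n (S j) + th n j)%C <= A * / (INR (S n) + INR j) ^ 3.
Hypothesis hth0 : forall n, isS (th n) 0.
Hypothesis hkap : forall j, isS (fun n => th n j) (kap j).
Hypothesis hK : isS kap K.
Hypothesis hR1 : forall n, isS (fun j => / (INR (S n) * t + INR j) ^ s + / (INR (S n) * t - INR (S j)) ^ s)%C (R1 n).
Hypothesis hR2 : forall n, isS (fun j => / (INR (S n) * (- / t) + INR j) ^ s + / (INR (S n) * (- / t) - INR (S j)) ^ s)%C (R2 n).
Hypothesis he1 : isS R1 e1.
Hypothesis he2 : isS R2 e2.
Hypothesis hZ : isS (fun j => / INR (S j) ^ s)%C Z.

Lemma t_neq0 : t <> RtoC 0.
Proof. by move=> e; move: ht; rewrite e /Im /=; lra. Qed.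

Lemma lattice_term_bound : exists B, forall n m (x : R), Rabs x = INR m ->
  (INR (S n) * t + x)%C <> RtoC 0 /\ Cmod (/ (INR (S n) * t + x) ^ s)%C <= B * / INR (S n) ^ 2.
Proof.
have [c [hc h]] := lattice_bound t ht; exists (/ c ^ s) => n m x hx.
have h1 := INR_S_ge1 n; have h2 := pos_INR m.
have hb := h (INR (S n)) x; rewrite hx (Rabs_pos_eq (INR (S n))) in hb; last lra.
have hp : c * INR (S n) <= Cmod (INR (S n) * t + x)%C by nra.
have n0 : (INR (S n) * t + x)%C <> RtoC 0 by apply/Cmod_gt_0; nra.
split=> //; rewrite Cmod_inv; last exact: Cpow_nz.
rewrite Cmod_pow -Rinv_mult; apply: Rinv_le_contravar.
  by apply: Rmult_lt_0_compat; apply: pow_lt; lra.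
apply: Rle_trans (_ : (c * INR (S n)) ^ s <= _); last by apply: pow_incr; nra.
rewrite Rpow_mult_distr; apply: Rmult_le_compat_l; first by apply: pow_le; lra.
exact: Rle_pow.
Qed.

(** [U] and [V] are the sums of the columns $m$ and $-m$ over the positive multiples of $t$. All
    columns share a majorant of order $n^{-2}$, so dominated convergence gives $U_m\to0$; this
    disposes of a boundary term in [S_law]. *)
Lemma UV_ex : (exists U V : nat -> C, (forall m, isS (fun n => lat_plus n m) (U m)) /\
   (forall m, isS (fun n => lat_minus n m) (V m))) /\ forall U, (forall m, isS (fun n => lat_plus n m) (U m)) -> Clim U 0.
Proof.
have [B hB] := lattice_term_bound.
have hB0 : 0 <= B.
  have [_ h] := hB O O 0 ltac:(rewrite Rabs_R0 //).
  have := Rle_trans _ _ _ (Cmod_ge_0 _) h; rewrite /= !Rmult_1_r Rinv_1; lra.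
pose b n := B * / INR (S n) ^ 2.
have b0 : forall n, 0 <= b n.
  move=> n; apply: Rmult_le_pos => //; apply: Rlt_le; apply: Rinv_0_lt_compat; apply: pow_lt.
  have := INR_S_ge1 n; lra.
have bs : ex_series b by apply: ex_series_scal_l; exact: ex_series_inv2.
have hp : forall m n, Cmod (lat_plus n m) <= b n.
  by move=> m n; case: (hB n m (INR m)) => //; rewrite Rabs_pos_eq //; exact: pos_INR.
have hq : forall m n, Cmod (lat_minus n m) <= b n.
  move=> m n; case: (hB n m (- INR m)); first by rewrite Rabs_Ropp Rabs_pos_eq //; exact: pos_INR.
  by rewrite RtoC_opp.
have chU : forall m, {l : C | isS (fun n => lat_plus n m) l}.
  move=> m; apply: ClassicalEpsilon.constructive_indefinite_description; exact: isS_dom (hp m).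
have chV : forall m, {l : C | isS (fun n => lat_minus n m) l}.
  move=> m; apply: ClassicalEpsilon.constructive_indefinite_description; exact: isS_dom (hq m).
split.
  exists (fun m => proj1_sig (chU m)), (fun m => proj1_sig (chV m)).
  by split=> m; [exact: (proj2_sig (chU m)) | exact: (proj2_sig (chV m))].
move=> U hU.
have hlim : forall n, Clim (fun m => lat_plus n m) 0.
  have [c [hc h]] := lattice_bound t ht.
  move=> n.
  have hp2 : forall m, Cmod (lat_plus n m) <= / c ^ s * (/ INR (S m)) ^ 2.
    move=> m; have h1 := INR_S_ge1 n; have h2 := pos_INR m; have h3 := INR_S_ge1 m.
    have hb := h (INR (S n)) (INR m); rewrite (Rabs_pos_eq (INR m)) // (Rabs_pos_eq (INR (S n))) in hb; last lra.
    have hp3 : c * INR (S m) <= Cmod (INR (S n) * t + INR m)%C by rewrite [INR (S m)]S_INR; nra.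
    have n0 : (INR (S n) * t + INR m)%C <> RtoC 0 by apply/Cmod_gt_0; nra.
    rewrite /lat_plus Cmod_inv; last exact: Cpow_nz.
    rewrite Cmod_pow pow_inv -Rinv_mult; apply: Rinv_le_contravar.
      by apply: Rmult_lt_0_compat; apply: pow_lt; lra.
    apply: Rle_trans (_ : (c * INR (S m)) ^ s <= _); last by apply: pow_incr; nra.
    rewrite Rpow_mult_distr; apply: Rmult_le_compat_l; first by apply: pow_le; lra.
    exact: Rle_pow.
  apply: (Clim_0_le _ _ hp2).
  have hi : is_lim_seq (fun m => / INR (S m)) 0.
    have h3 : is_lim_seq (fun n => INR (S n)) p_infty by apply/(is_lim_seq_incr_1 INR p_infty); exact: is_lim_seq_INR.
    exact: (is_lim_seq_inv _ _ h3).
  have := is_lim_seq_scal_l _ (/ c ^ s) _ (is_lim_seq_mult' _ _ _ _ hi hi).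
  rewrite /= !Rmult_0_r; apply: is_lim_seq_ext => m; ring.
have [l [hl1 hl2]] := tannery b b0 bs (fun m n => lat_plus n m) (fun _ => RtoC 0) U hp hlim hU.
by rewrite (isS_unique _ _ _ hl1 (isS_fin (fun _ => RtoC 0) O (fun _ _ => Logic.eq_refl))) in hl2.
Qed.

(* [th] is a correction that makes the double series absolutely convergent; [K] measures
   how much its two iterated sums differ. *)
Lemma S_law : (e1 + Z - K = (Z + e2) / t ^ s)%C.
Proof.
have t0 := t_neq0; have ts0 : (t ^ s)%C <> RtoC 0 by exact: Cpow_nz.
have [[U [V [hU hV]]] hUlim] := UV_ex; have {}hUlim := hUlim U hU.
(* The corrected array has row sums [R1] and column sums $U_j+V_{j+1}+\kappa_j$; removing the
   $\kappa_j$ afterwards costs exactly [K]. *)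
have hC : isS (fun j => U j + V (S j))%C (e1 - K)%C.
  have [a [ha1 ha2]] := fubini (fun n j => lat_plus n j + lat_minus n (S j) + th n j)%C (fun n => Rabs A * weight32 n) weight32
    R1 (fun j => U j + V (S j) + kap j)%C
    ltac:(move=> i; apply: Rmult_le_pos; [exact: Rabs_pos | exact: weight32_pos]) weight32_pos
    ltac:(apply: ex_series_scal_l; exact: ex_series_weight32) ex_series_weight32
    ltac:(move=> n m; apply: Rle_trans (hth n m) _; have h1 := weight32_bound n m;
      have h2 : 0 < / (INR (S n) + INR m) ^ 3 by [apply: Rinv_0_lt_compat; apply: pow_lt; have := INR_S_ge1 n; have := pos_INR m; lra];
      rewrite Rmult_assoc; apply: Rle_trans (_ : Rabs A * / (INR (S n) + INR m) ^ 3 <= _);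
      [apply: Rmult_le_compat_r; [lra | exact: Rle_abs] | apply: Rmult_le_compat_l => //; exact: Rabs_pos])
    ltac:(move=> n; apply: (isS_val _ _ _ (isS_plus _ _ _ _ (hR1 n) (hth0 n))); ring)
    ltac:(move=> m; exact: isS_plus (isS_plus _ _ _ _ (hU m) (hV (S m))) (hkap m)).
  rewrite (isS_unique _ _ _ he1 ha1).
  by apply: isS_ext (isS_minus _ _ _ _ ha2 hK) => j; ring.
(* Since $m(-1/t)+j=(jt-m)/t$, a row of the lattice of $-1/t$ is, up to $t^s$, a pair of columns of
   the lattice of $t$ together with the term $m^{-s}$ at $j=0$. *)
have hW : forall m, (R2 m / t ^ s - / INR (S m) ^ s = U (S m) + V (S m))%C.
  move=> m; pose f j := (/ (INR j * t - INR (S m)) ^ s)%C.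
  have h1 : isS (fun j => f j + lat_plus j (S m))%C (R2 m / t ^ s)%C.
    rewrite /Cdiv Cmult_comm.
    apply: isS_ext (isS_scal (/ t ^ s) _ _ (hR2 m)) => j; rewrite /f /lat_plus.
    have ea : (INR (S m) * (- / t) + INR j = (INR j * t - INR (S m)) * / t)%C by field.
    have eb : (INR (S m) * (- / t) - INR (S j) = - ((INR (S j) * t + INR (S m)) * / t))%C by field.
    rewrite ea eb heven !Cpow_mult_l Cpow_inv // !Cinv_mult Cinv_inv.
    transitivity ((t ^ s * / t ^ s) * (/ (INR j * t - INR (S m)) ^ s + / (INR (S j) * t + INR (S m)) ^ s))%C; first ring.
    by rewrite Cinv_r //; ring.
  have h2 : isS (fun j => f j + lat_plus j (S m))%C (/ INR (S m) ^ s + V (S m) + U (S m))%C.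
    apply: isS_plus (hU (S m)).
    have -> : (/ INR (S m) ^ s = f O)%C.
      by rewrite /f (_ : INR 0 * t - INR (S m) = - INR (S m))%C ?heven //= Cmult_0_l; ring.
    apply: isS_unshift; exact: hV.
  rewrite (isS_unique _ _ _ h1 h2); ring.
(* The pairings $U_j+V_{j+1}$ and $U_{m+1}+V_{m+1}$ differ only by the ends $U_0$, which is $Z/t^s$,
   and $U_M$, which tends to 0. *)
have hsum : forall M, csum (fun j => U j + V (S j))%C M =
   (U O + csum (fun m => R2 m / t ^ s - / INR (S m) ^ s) M - U M)%C.
  elim=> [|M IH]; first by rewrite /=; ring.
  rewrite !csumS IH hW; ring.
have hl1 : isS (fun m => R2 m / t ^ s - / INR (S m) ^ s)%C (e2 / t ^ s - Z)%C.
  apply: isS_minus hZ; rewrite /Cdiv Cmult_comm.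
  by apply: isS_ext (isS_scal (/ t ^ s) _ _ he2) => m; ring.
have hl2 := Clim_minus _ _ _ _ (Clim_plus _ _ _ _ (Clim_const (U O)) hl1) hUlim.
have hl3 : Clim (csum (fun j => U j + V (S j))%C) (U O + (e2 / t ^ s - Z) - 0)%C.
  by apply: Clim_ext hl2 => M; rewrite hsum.
have e := Clim_unique _ _ _ hC hl3.
have eU : U O = (Z / t ^ s)%C.
  apply: (isS_unique _ _ _ (hU O)); rewrite /Cdiv Cmult_comm.
  apply: isS_ext (isS_scal (/ t ^ s) _ _ hZ) => n; rewrite /lat_plus /= Cplus_0_r -/(INR (S n)) Cpow_mult_l Cinv_mult; ring.
rewrite eU in e.
transitivity ((e1 - K) + Z)%C; first ring.
rewrite e; field; exact: ts0.
Qed.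

End SLaw.

(** * The logarithmic correction in weight 2 *)

Lemma Clog_diff (a b : C) (m : R) : 0 < m -> 0 < Im a -> 0 < Im b ->
  (forall s, 0 <= s <= 1 -> m <= Cmod (seg a b s)) -> Cmod (Clog b - Clog a)%C <= / m * Cmod (b - a)%C.
Proof.
move=> hm ha hb h; apply: (seg_MVT Clog Cinv) => s hs.
  apply: isD_Clog; rewrite /seg; have -> : Im (a + s * (b - a))%C = (1 - s) * Im a + s * Im b by rewrite /Im /=; ring.
  nra.
have n0 : seg a b s <> RtoC 0 by apply/Cmod_gt_0; have := h s hs; lra.
by rewrite Cmod_inv //; apply: Rinv_le_contravar => //; apply: h.
Qed.

Lemma inv_INR_lim : is_lim_seq (fun n => / INR (S n)) 0.
Proof.
have h : is_lim_seq (fun n => INR (S n)) p_infty by apply/(is_lim_seq_incr_1 INR p_infty); exact: is_lim_seq_INR.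
exact: (is_lim_seq_inv _ _ h).
Qed.

Section Correction.
Variables (t : C) (c : R).
Hypothesis ht : 0 < Im t.
Hypothesis hc : 0 < c.
Hypothesis hlat : forall x y : R, c * (Rabs x + Rabs y) <= Cmod (x * t + y)%C.

Definition lat_log (n : nat) (y : R) : C := Clog (INR n * t + y)%C.
Definition lat_log_diff (n : nat) (y : R) : C := (lat_log (S (S n)) y - lat_log (S n) y)%C.
Definition lat_log_diff2 (n : nat) (y : R) : C := (lat_log_diff n (y + 1) - lat_log_diff n y)%C.
(** The mixed second difference of the logarithm with steps $t$ and 1 is $-t/z^2$ to leading order,
    so [theta] cancels the leading part of $z^{-2}$ at two paired lattice points. *)
Definition theta (n j : nat) : C := (/ t * (lat_log_diff2 n (INR j) + lat_log_diff2 n (- INR (S j))))%C.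
Definition kappa (j : nat) : C :=
  (/ t * (- (lat_log 1 (INR j + 1) - lat_log 1 (INR j)) + - (lat_log 1 (- INR (S j) + 1) - lat_log 1 (- INR (S j)))))%C.

Lemma Im_lat x (y : R) : Im (RtoC x * t + y)%C = x * Im t.
Proof. rewrite /Im /=; ring. Qed.

Lemma lat_log_diff_bound n y : Cmod (lat_log_diff n y) <= / (c * (INR (S n) + Rabs y)) * Cmod t.
Proof.
have h1 := INR_S_ge1 n; have h2 := INR_S_ge1 (S n); have h3 := Rabs_pos y.
have e : ((INR (S (S n)) * t + y) - (INR (S n) * t + y) = t)%C by rewrite (S_INR (S n)) RtoC_plus; ring.
rewrite /lat_log_diff /lat_log; have := Clog_diff (INR (S n) * t + y)%C (INR (S (S n)) * t + y)%C (c * (INR (S n) + Rabs y)).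
rewrite e; apply.
- by apply: Rmult_lt_0_compat; lra.
- by rewrite Im_lat; nra.
- by rewrite Im_lat; nra.
- move=> s hs; rewrite /seg e.
  rewrite (_ : _ + _ = RtoC (INR (S n) + s) * t + y)%C; last by rewrite RtoC_plus; ring.
  by apply: Rle_trans (hlat _ _); apply: Rmult_le_compat_l; [lra | rewrite (Rabs_pos_eq (INR (S n) + s)); lra].
Qed.

Lemma lat_log_diff_lim n (y : nat -> R) : (forall M, Rabs (y M) = INR M) -> Clim (fun M => lat_log_diff n (y M)) 0.
Proof.
move=> hy; apply: (Clim_0_le _ (fun M => Cmod t / c * / INR (S M))); last first.
  by have := is_lim_seq_scal_l _ (Cmod t / c) _ inv_INR_lim; rewrite /= Rmult_0_r.
move=> M; apply: Rle_trans (lat_log_diff_bound _ _) _; rewrite hy.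
have h1 := INR_S_ge1 n; have h2 := pos_INR M; have h3 := Cmod_ge_0 t.
rewrite (_ : Cmod t / c * / INR (S M) = / (c * INR (S M)) * Cmod t); last first.
  by field; have := INR_S_ge1 M; lra.
apply: Rmult_le_compat_r => //; apply: Rinv_le_contravar; first by have := INR_S_ge1 M; nra.
by apply: Rmult_le_compat_l; [lra | rewrite (S_INR M); lra].
Qed.

(* The second difference telescopes along rows and along columns. *)
Lemma theta_row n : isS (theta n) 0.
Proof.
have h1 := lat_log_diff_lim n INR ltac:(move=> M; rewrite Rabs_pos_eq //; exact: pos_INR).
have h2 := lat_log_diff_lim n (fun M => - INR M) ltac:(move=> M; rewrite Rabs_Ropp Rabs_pos_eq //; exact: pos_INR).
rewrite (_ : RtoC 0 = / t * (0 - 0))%C; last ring.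
apply: Clim_ext (Clim_scal (/ t) _ _ (Clim_minus _ _ _ _ h1 h2)) => M.
rewrite /theta csum_scal; congr (_ * _)%C.
elim: M => [|M IH]; first by rewrite /= Ropp_0; ring.
rewrite csumS -IH /lat_log_diff2 -(S_INR M) (_ : - INR (S M) + 1 = - INR M); last by rewrite S_INR; ring.
ring.
Qed.

Lemma lat_log_diff2_col y : isS (fun n => lat_log_diff2 n y) (- (lat_log 1 (y + 1) - lat_log 1 y))%C.
Proof.
pose v n := (lat_log (S n) (y + 1) - lat_log (S n) y)%C.
have hv : Clim v 0.
  apply: (Clim_0_le _ (fun n => / c * / INR (S n))); last first.
    by have := is_lim_seq_scal_l _ (/ c) _ inv_INR_lim; rewrite /= Rmult_0_r.
  move=> n; have h1 := INR_S_ge1 n.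
  have e : ((INR (S n) * t + RtoC (y + 1)) - (INR (S n) * t + y) = 1)%C by rewrite RtoC_plus; ring.
  have := Clog_diff (INR (S n) * t + y)%C (INR (S n) * t + RtoC (y + 1))%C (c * INR (S n)).
  rewrite e Cmod_1 Rmult_1_r Rinv_mult; apply.
  - nra.
  - by rewrite Im_lat; nra.
  - by rewrite Im_lat; nra.
  - move=> s hs; rewrite /seg e.
    rewrite (_ : _ + _ = RtoC (INR (S n)) * t + RtoC (y + s))%C; last by rewrite RtoC_plus; ring.
    apply: Rle_trans (hlat _ _); apply: Rmult_le_compat_l; first lra.
    by rewrite (Rabs_pos_eq (INR (S n))); [have := Rabs_pos (y + s); lra | lra].
rewrite (_ : - _ = 0 - v O)%C; last by rewrite /v; ring.
apply: Clim_ext (Clim_minus _ _ _ _ hv (Clim_const (v O))) => M.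
rewrite -csum_telescope; apply: csum_ext => n _; rewrite /v /lat_log_diff2 /lat_log_diff; ring.
Qed.

Lemma theta_col j : isS (fun n => theta n j) (kappa j).
Proof. by apply: isS_scal; apply: isS_plus; exact: lat_log_diff2_col. Qed.

(** The moduli of $t+M$ and $t-M$ are both asymptotic to $M$, so the real parts cancel; the
    arguments tend to 0 and to $\pi$. *)
Lemma Clog_asymp : Clim (fun M => lat_log 1 (INR M) - lat_log 1 (- INR M))%C (- (PI * Ci))%C.
Proof.
have hpi := PI_RGT_0.
move: ht; rewrite /lat_log; case: (t) => x y; rewrite [Im _]/= => hy.
have hI : is_lim_seq INR p_infty by exact: is_lim_seq_INR.
have hi0 := is_lim_seq_inv _ _ hI ltac:(by []).
have inv0 : forall a, is_lim_seq (fun M => a * / INR M) 0.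
  by move=> a; have := is_lim_seq_scal_l _ a _ hi0; rewrite /= Rmult_0_r.
have shift : forall a, is_lim_seq (fun M => a + INR M) p_infty.
  by move=> a; apply: is_lim_seq_plus (is_lim_seq_const a) hI _.
apply: Clim_ReIm.
- have hre : forall a, is_lim_seq (fun M => ln (Cmod (a + INR M, y)) - ln (INR M)) 0.
    move=> a.
    have h1 : is_lim_seq (fun M => (1 + a * / INR M) * (1 + a * / INR M) + (y * / INR M) * (y * / INR M)) ((1 + 0) * (1 + 0) + 0 * 0).
      have p := is_lim_seq_plus' _ _ _ _ (is_lim_seq_const 1) (inv0 a).
      by apply: is_lim_seq_plus'; apply: is_lim_seq_mult'.
    rewrite (_ : (1 + 0) * (1 + 0) + 0 * 0 = 1) in h1; last ring.
    have cont : continuity_pt (fun u => ln (sqrt u)) 1.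
      apply: derivable_continuous_pt; apply: ex_derive_Reals_0; auto_derive.
      by rewrite sqrt_1; repeat split; lra.
    have h2 := is_lim_seq_continuous _ _ _ cont h1.
    rewrite sqrt_1 ln_1 in h2.
    apply: (is_lim_seq_ext_loc _ _ _ _ h2); exists 1%nat; case=> [|M] hM; first by lia.
    have hp := INR_S_ge1 M.
    have hm : 0 < Cmod (a + INR (S M), y).
      by apply/Cmod_gt_0 => e; have := f_equal snd e; rewrite /=; lra.
    rewrite -ln_div //; last lra.
    congr ln; rewrite -[X in _ / X](Rabs_pos_eq (INR (S M))); last lra.
    rewrite -(sqrt_Rsqr_abs (INR (S M))) /Cmod -sqrt_div_alt; last by rewrite /Rsqr; nra.
    by congr sqrt; rewrite /Rsqr -[fst _]/(a + INR (S M)) -[snd _]/y; field; lra.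
  have hre2 : is_lim_seq (fun M => ln (Cmod (x - INR M, y)) - ln (INR M)) 0.
    apply: (is_lim_seq_ext _ _ _ _ (hre (- x))) => M; congr (ln _ - _).
    by rewrite /Cmod /=; congr sqrt; ring.
  have h := is_lim_seq_minus' _ _ _ _ (hre x) hre2.
  rewrite (_ : Re (- (PI * Ci))%C = 0 - 0); last by rewrite /Re /=; ring.
  apply: (is_lim_seq_ext _ _ _ _ h) => M.
  rewrite (_ : (RtoC (INR 1) * (x, y) + RtoC (INR M))%C = (x + INR M, y)); last first.
    by rewrite /Cplus /Cmult /RtoC /=; f_equal; ring.
  rewrite (_ : (RtoC (INR 1) * (x, y) + RtoC (- INR M))%C = (x - INR M, y)); last first.
    by rewrite /Cplus /Cmult /RtoC /=; f_equal; ring.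
  rewrite /Clog; move: (Carg _) (Carg _) (Cmod _) (Cmod _) => p1 p2 p3 p4.
  by rewrite /=; ring.
- have hat : forall a, is_lim_seq (fun M => atan ((a + INR M) / y)) (PI / 2).
    move=> a.
    have h1 : is_lim_seq (fun M => y * / (a + INR M)) 0.
      have := is_lim_seq_scal_l _ y _ (is_lim_seq_inv _ _ (shift a) ltac:(by [])); by rewrite /= Rmult_0_r.
    have h2 := is_lim_seq_continuous atan _ _ ltac:(apply: derivable_continuous_pt; exact: derivable_pt_atan) h1.
    have h3 := is_lim_seq_minus' _ _ _ _ (is_lim_seq_const (PI / 2)) h2.
    rewrite atan_0 Rminus_0_r in h3.
    have /is_lim_seq_spec hs := shift a; have [N hN] := hs 0.
    apply: (is_lim_seq_ext_loc _ _ _ _ h3); exists N => M hM; have hp := hN M hM.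
    rewrite -atan_inv; last by apply: Rmult_lt_0_compat => //; exact: Rinv_0_lt_compat.
    by congr atan; field; lra.
  have h := is_lim_seq_minus' _ _ _ _ (proj1 (is_lim_seq_opp _ _) (hat x)) (hat (- x)).
  rewrite (_ : Im (- (PI * Ci))%C = - (PI / 2) - PI / 2); last by rewrite /Im /=; field.
  apply: (is_lim_seq_ext _ _ _ _ h) => M.
  rewrite /Clog (_ : (RtoC (INR 1) * (x, y) + RtoC (INR M))%C = (x + INR M, y)); last first.
    by rewrite /Cplus /Cmult /RtoC /=; f_equal; ring.
  rewrite (_ : (RtoC (INR 1) * (x, y) + RtoC (- INR M))%C = (x - INR M, y)); last first.
    by rewrite /Cplus /Cmult /RtoC /=; f_equal; ring.
  rewrite /Im /Cminus /Cplus /Copp [snd _]/= /Carg [Im _]/= [Re _]/=.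
  case: Rlt_dec => // _.
  rewrite (_ : (x - INR M) / y = - ((- x + INR M) / y)); last by field; lra.
  rewrite atan_opp; ring.
Qed.

(** The sum over $j<M$ telescopes to $-\frac1t(\log(t+M)-\log(t-M))$. Its limit is the quasi-modular
    defect of [E2]. *)
Lemma kappa_sum : isS kappa (PI * Ci / t)%C.
Proof.
have t0 : t <> RtoC 0 by move=> e; move: ht; rewrite e /Im /=; lra.
rewrite (_ : PI * Ci / t = - / t * - (PI * Ci))%C; last by field.
apply: Clim_ext (Clim_scal (- / t) _ _ Clog_asymp) => M.
rewrite /kappa csum_scal; transitivity (/ t * - (lat_log 1 (INR M) - lat_log 1 (- INR M)))%C; first ring.
congr (_ * _)%C; elim: M => [|M IH]; first by rewrite /= Ropp_0; ring.
rewrite csumS -IH -(S_INR M) (_ : - INR (S M) + 1 = - INR M); last by rewrite S_INR; ring.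
ring.
Qed.

Lemma lat_upper n (y : R) : Cmod (INR (S n) * t + y)%C <= (Cmod t + 1) * (INR (S n) + Rabs y).
Proof.
apply: Rle_trans (Cmod_triangle _ _) _; rewrite Cmod_mult !Cmod_R Rabs_pos_eq; last exact: pos_INR.
have := Cmod_ge_0 t; have := pos_INR (S n); have := Rabs_pos y; nra.
Qed.

(** Mean value inequality for $\psi(w)=\log(w+1)-\log w+w/z^2$ between $z$ and $z+t$. Its derivative
    is $(w(w+1)-z^2)/(z^2w(w+1))$: the numerator is $O(h)$ and the denominator at least of order
    $h^4$, with $h$ comparable to $|z|$. *)
Lemma correction_term : exists A, 0 <= A /\ forall n (y : R),
  Cmod (/ (INR (S n) * t + y) ^ 2 + / t * lat_log_diff2 n y)%C <= A * / (INR (S n) + Rabs y) ^ 3.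
Proof.
have t0 : t <> RtoC 0 by move=> e; move: ht; rewrite e /Im /=; lra.
have pt : 0 < Cmod t by apply/Cmod_gt_0.
pose N := (2 * Cmod t + 1) * (Cmod t + 1) + Cmod t ^ 2 + Cmod t.
have hN : 0 < N by rewrite /N; nra.
have hc4 : 0 < c ^ 4 by exact: pow_lt.
exists (2 * N / c ^ 4); split; first by apply: Rlt_le; apply: Rdiv_lt_0_compat; lra.
move=> n y; have h1 := INR_S_ge1 n; have hy := Rabs_pos y.
set h := INR (S n) + Rabs y; have hh1 : 1 <= h by rewrite /h; lra.
set z := (INR (S n) * t + y)%C.
have hz : c * h <= Cmod z.
  by apply: Rle_trans (hlat _ _); rewrite (Rabs_pos_eq (INR (S n))) /h; lra.
have pz : 0 < Cmod z by nra.
have z0 : z <> RtoC 0 by exact/Cmod_gt_0.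
have hz2 := lat_upper n y; rewrite -/z -/h in hz2.
have hd : lat_log_diff2 n y = ((Clog (z + t + 1) - Clog (z + t)) - (Clog (z + 1) - Clog z))%C.
  rewrite /lat_log_diff2 /lat_log_diff /lat_log /z !(S_INR (S n)) !RtoC_plus.
  rewrite (_ : (INR (S n) + 1) * t + (y + 1) = INR (S n) * t + y + t + 1)%C; last ring.
  rewrite (_ : (INR (S n) + 1) * t + y = INR (S n) * t + y + t)%C; last ring.
  rewrite (_ : INR (S n) * t + (y + 1) = INR (S n) * t + y + 1)%C; last ring.
  ring.
have Imz : Im z = INR (S n) * Im t by rewrite /z Im_lat.
have inw : forall s, 0 <= s <= 1 -> seg z (z + t) s = (RtoC (INR (S n) + s) * t + y)%C.
  by move=> s hs; rewrite /seg /z RtoC_plus; ring.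
have hw1 : forall s, 0 <= s <= 1 -> c * h <= Cmod (seg z (z + t) s).
  move=> s hs; rewrite inw //; apply: Rle_trans (hlat _ _); apply: Rmult_le_compat_l; first lra.
  by rewrite /h (Rabs_pos_eq (INR (S n) + s)); lra.
(* Passing from $y$ to $y+1$ can lose 1 from $|y|$; the summand $n+1\ge1$ makes up for it at the
   price of a factor 2. *)
have hw2 : forall s, 0 <= s <= 1 -> c * h / 2 <= Cmod (seg z (z + t) s + 1)%C.
  move=> s hs; rewrite inw // (_ : _ + _ + 1 = RtoC (INR (S n) + s) * t + RtoC (y + 1))%C; last by rewrite !RtoC_plus; ring.
  apply: Rle_trans (hlat _ _); rewrite /Rdiv Rmult_assoc; apply: Rmult_le_compat_l; first lra.
  rewrite /h (Rabs_pos_eq (INR (S n) + s)); last lra.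
  have := Rabs_triang (y + 1) (- 1); rewrite Rabs_Ropp Rabs_R1 (_ : y + 1 + -1 = y); last ring.
  have := Rabs_pos (y + 1); lra.
pose psi w := ((Clog (w + 1) - Clog w) + w * / z ^ 2)%C.
pose dpsi w := ((/ (w + 1) - / w) + / z ^ 2)%C.
have K : Cmod (psi (z + t) - psi z)%C <= (2 * N / c ^ 4 * / h ^ 3) * Cmod (z + t - z)%C.
  apply: (seg_MVT psi dpsi) => s hs.
    have hi : 0 < Im (seg z (z + t) s) by rewrite inw // Im_lat; nra.
    have hi1 : Im (seg z (z + t) s + 1)%C <> 0.
      by rewrite (_ : Im (_ + _)%C = Im (seg z (z + t) s)); [lra | rewrite /Im /=; ring].
    apply: (isD_val _ _ _ _ (isD_plus _ _ _ _ _ (isD_minus _ _ _ _ _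
      (isD_comp Clog (fun w => w + 1)%C _ _ _ (isD_Clog _ hi1) (isD_plus _ _ _ _ _ (isD_id _) (isD_const 1 _)))
      (isD_Clog _ (Rgt_not_eq _ _ hi))) (isD_mult _ _ _ _ _ (isD_id _) (isD_const (/ z ^ 2)%C _)))).
    by rewrite /dpsi; ring.
  have g1 := hw1 s hs; have g2 := hw2 s hs; rewrite /dpsi.
  have ew : seg z (z + t) s = (z + s * t)%C by rewrite /seg; ring.
  set w := seg z (z + t) s in g1 g2 ew *.
  have pw : 0 < Cmod w by nra. have pw1 : 0 < Cmod (w + 1)%C by nra.
  have w0 : w <> RtoC 0 by exact/Cmod_gt_0. have w1 : (w + 1)%C <> RtoC 0 by exact/Cmod_gt_0.
  have -> : (/ (w + 1) - / w + / z ^ 2 = (2 * s * z * t + s * s * t * t + z + s * t) / (z ^ 2 * (w * (w + 1))))%C.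
    rewrite (_ : 2 * s * z * t + s * s * t * t + z + s * t = w * (w + 1) - z ^ 2)%C; last by rewrite ew /=; ring.
    by field.
  have nz : (z ^ 2 * (w * (w + 1)))%C <> RtoC 0.
    by apply: Cmult_neq_0; [exact: Cpow_nz | exact: Cmult_neq_0].
  rewrite Cmod_div // Cmod_mult Cmod_pow Cmod_mult.
  have hnum : Cmod (2 * s * z * t + s * s * t * t + z + s * t)%C <= N * h.
    apply: Rle_trans (Cmod_triangle _ _) _; apply: Rle_trans (Rplus_le_compat_r _ _ _ (Cmod_triangle3 _ _ _)) _.
    rewrite !Cmod_mult !Cmod_R (Rabs_pos_eq s) ?(Rabs_pos_eq 2); try lra.
    have b1 : 2 * s * Cmod z * Cmod t <= 2 * Cmod t * ((Cmod t + 1) * h).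
      rewrite (_ : 2 * s * Cmod z * Cmod t = 2 * Cmod t * (s * Cmod z)); last ring.
      by apply: Rmult_le_compat_l; nra.
    have b2 : s * s * Cmod t * Cmod t <= Cmod t ^ 2 * h.
      rewrite (_ : s * s * Cmod t * Cmod t = Cmod t ^ 2 * (s * s)); last ring.
      by apply: Rmult_le_compat_l; [exact: pow2_ge_0 | nra].
    have b3 : s * Cmod t <= Cmod t * h by nra.
    rewrite /N; lra.
  have hden : c ^ 4 * h ^ 4 / 2 <= Cmod z ^ 2 * (Cmod w * Cmod (w + 1)%C).
    rewrite (_ : c ^ 4 * h ^ 4 / 2 = (c * h) ^ 2 * ((c * h) * (c * h / 2))); last by field.
    have p0 : 0 <= c * h by nra.
    apply: Rmult_le_compat.
    - exact: pow2_ge_0.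
    - by apply: Rmult_le_pos; lra.
    - by apply: pow_incr.
    - by apply: Rmult_le_compat; lra.
  have pden : 0 < c ^ 4 * h ^ 4 / 2.
    by apply: Rdiv_lt_0_compat; [apply: Rmult_lt_0_compat; apply: pow_lt; lra | lra].
  apply: Rle_trans (_ : N * h * / (c ^ 4 * h ^ 4 / 2) <= _).
    apply: Rmult_le_compat => //; first exact: Cmod_ge_0.
      by apply: Rlt_le; apply: Rinv_0_lt_compat; lra.
    exact: Rinv_le_contravar.
  by apply: Req_le; field; lra.
have -> : (/ z ^ 2 + / t * lat_log_diff2 n y = / t * (psi (z + t) - psi z))%C.
  by rewrite hd /psi; field.
rewrite Cmod_mult Cmod_inv //.
rewrite (_ : z + t - z = t)%C in K; last ring.
apply: (Rmult_le_reg_l (Cmod t)) => //; rewrite -Rmult_assoc Rinv_r; lra.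
Qed.

End Correction.

(** * Power sums and Lambert series *)

Lemma cube_geom_bound r : 0 <= r < 1 -> exists B rho, 0 <= B /\ 0 <= rho < 1 /\
  forall n, INR (S n) ^ 3 * r ^ n <= B * rho ^ n.
Proof.
(* The choice gives $(1+x)^3r\le(1+7x)r<1$, as $7x=\frac78(1-r)$; and $x(n+1)\le(1+x)^n$ trades the
   cube for a factor $(1+x)^{3n}$. *)
move=> hr; pose x := (1 - r) / 8; have hx : 0 < x <= 1 by rewrite /x; lra.
exists (/ x ^ 3), ((1 + x) ^ 3 * r); split; [|split].
- by apply: Rlt_le; apply: Rinv_0_lt_compat; apply: pow_lt; lra.
- have h3 : (1 + x) ^ 3 <= 1 + 7 * x by nra.
  have h4 : 0 <= (1 + x) ^ 3 by apply: pow_le; lra.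
  split; first nra.
  have : (1 + x) ^ 3 * r <= (1 + 7 * x) * r by apply: Rmult_le_compat_r; lra.
  have -> : (1 + 7 * x) * r = r + 7 * r * (1 - r) / 8 by rewrite /x; field.
  nra.
- move=> n; have hn : x * INR (S n) <= (1 + x) ^ n.
    rewrite S_INR; elim: n => [|n IH]; first by rewrite /=; lra.
    have h1 : 1 <= (1 + x) ^ n by apply: pow_R1_Rle; lra.
    rewrite S_INR -tech_pow_Rmult; nra.
  have h0 : 0 <= x * INR (S n) by have := INR_S_ge1 n; nra.
  have := pow_incr _ _ 3 (conj h0 hn); rewrite Rpow_mult_distr => h.
  have hrn : 0 <= r ^ n by apply: pow_le; lra.
  rewrite Rpow_mult_distr -!pow_mult Nat.mul_comm pow_mult -Rmult_assoc; apply: Rmult_le_compat_r => //.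
  have px : 0 < x ^ 3 by apply: pow_lt; lra.
  apply: (Rmult_le_reg_l (x ^ 3)) => //; rewrite -Rmult_assoc Rinv_r; [|lra].
  by rewrite Rmult_1_l.
Qed.

Lemma ex_series_geo B rho : 0 <= rho < 1 -> ex_series (fun n => B * rho ^ n).
Proof. by move=> h; apply: ex_series_scal_l; apply: ex_series_geom; rewrite Rabs_pos_eq; lra. Qed.

Lemma power_sum_ex (u : C) p : (p <= 3)%nat -> Cmod u < 1 -> exists l, isS (fun n => INR (S n) ^ p * u ^ n)%C l.
Proof.
move=> hp hu; have [B [rho [hB [hr h]]]] := cube_geom_bound (Cmod u) (conj (Cmod_ge_0 _) hu).
apply: (isS_dom (fun n => B * rho ^ n)).
- by move=> n; apply: Rmult_le_pos => //; apply: pow_le; lra.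
- exact: ex_series_geo.
- move=> n; apply: Rle_trans (h n); rewrite Cmod_mult !Cmod_pow Cmod_R Rabs_pos_eq; last exact: pos_INR.
  apply: Rmult_le_compat_r; first by apply: pow_le; exact: Cmod_ge_0.
  by apply: Rle_pow => //; exact: INR_S_ge1.
Qed.

(* Abel summation: multiplying a power series by [1 - u] takes differences of the coefficients. *)
Lemma isS_difference (a : nat -> C) (u l : C) : a O = 0 -> isS (fun n => a (S n) * u ^ n)%C l ->
  isS (fun n => (a (S n) - a n) * u ^ n)%C ((1 - u) * l)%C.
Proof.
move=> a0 h.
have h2 : isS (fun n => a n * u ^ n)%C (u * l)%C.
  apply: (isS_val _ (a O * u ^ O + u * l)%C); last by rewrite a0; ring.
  apply: isS_unshift; apply: isS_ext (isS_scal u _ _ h) => n /=; ring.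
rewrite (_ : (1 - u) * l = l - u * l)%C; last ring.
by apply: isS_ext (isS_minus _ _ _ _ h h2) => n; ring.
Qed.

Section PowerSums.
Variable u : C.
Hypothesis hu : Cmod u < 1.

Lemma one_minus_neq0 : (1 - u)%C <> RtoC 0.
Proof.
move=> e; have := Cmod_minus_le 1 u; rewrite e Cmod_0 Cmod_1; lra.
Qed.

Lemma power_sum0 : isS (fun n => INR (S n) ^ 0 * u ^ n)%C (/ (1 - u))%C.
Proof.
have n1 := one_minus_neq0; have [l hl] := power_sum_ex u 0 ltac:(lia) hu.
pose a (n : nat) : C := match n with O => RtoC 0 | S _ => RtoC 1 end.
have hl' : isS (fun n => a (S n) * u ^ n)%C l by apply: isS_ext hl => n.
have h := isS_difference a u l Logic.eq_refl hl'.
have h2 : isS (fun n => (a (S n) - a n) * u ^ n)%C 1.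
  apply: (isS_val _ (csum (fun n => (a (S n) - a n) * u ^ n) 1)%C); last by rewrite /=; ring.
  by apply: isS_fin; case=> [|n] hn; [lia | rewrite /a; ring].
apply: (isS_val _ _ _ hl); have e := isS_unique _ _ _ h h2.
by rewrite (_ : l = / (1 - u) * ((1 - u) * l))%C; [rewrite e; field | field].
Qed.

(** Multiplication by $1-u$ lowers the degree of the coefficient polynomial by one, so the sums with
    exponents 1, 2 and 3 come out recursively. *)
Lemma power_sum_step p l (S0 : C) : isS (fun n => INR (S n) ^ (S p) * u ^ n)%C l ->
  isS (fun n => (INR (S n) ^ (S p) - INR n ^ (S p)) * u ^ n)%C S0 -> l = (S0 / (1 - u))%C.
Proof.
move=> hl h0; have n1 := one_minus_neq0.
have h := isS_difference (fun n => INR n ^ (S p))%C u l ltac:(by rewrite /= Cmult_0_l) hl.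
rewrite (isS_unique _ _ _ h0 h); field; exact: n1.
Qed.

Lemma power_sum1 : isS (fun n => INR (S n) ^ 1 * u ^ n)%C (/ (1 - u) ^ 2)%C.
Proof.
have n1 := one_minus_neq0; have [l hl] := power_sum_ex u 1 ltac:(lia) hu.
apply: (isS_val _ _ _ hl); rewrite (power_sum_step 0 l (/ (1 - u))%C hl); last first.
  apply: isS_ext power_sum0 => n; rewrite S_INR RtoC_plus /=; ring.
by field.
Qed.

Lemma power_sum2 : isS (fun n => INR (S n) ^ 2 * u ^ n)%C ((1 + u) / (1 - u) ^ 3)%C.
Proof.
have n1 := one_minus_neq0; have [l hl] := power_sum_ex u 2 ltac:(lia) hu.
apply: (isS_val _ _ _ hl); rewrite (power_sum_step 1 l (2 * / (1 - u) ^ 2 - / (1 - u))%C hl); last first.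
  apply: isS_ext (isS_minus _ _ _ _ (isS_scal 2 _ _ power_sum1) power_sum0) => n; rewrite S_INR RtoC_plus /=; ring.
by field.
Qed.

Lemma power_sum3 : isS (fun n => INR (S n) ^ 3 * u ^ n)%C ((1 + 4 * u + u * u) / (1 - u) ^ 4)%C.
Proof.
have n1 := one_minus_neq0; have [l hl] := power_sum_ex u 3 ltac:(lia) hu.
apply: (isS_val _ _ _ hl); rewrite (power_sum_step 2 l (3 * ((1 + u) / (1 - u) ^ 3) - 3 * / (1 - u) ^ 2 + / (1 - u))%C hl); last first.
  apply: isS_ext (isS_plus _ _ _ _ (isS_minus _ _ _ _ (isS_scal 3 _ _ power_sum2) (isS_scal 3 _ _ power_sum1)) power_sum0) => n.
  rewrite S_INR RtoC_plus /=; ring.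
by field.
Qed.

Lemma X2_series : isS (fun n => INR (S n) ^ 1 * u ^ S n)%C (X2 u).
Proof.
apply: (isS_val _ (u * / (1 - u) ^ 2)%C); last by [].
by apply: isS_ext (isS_scal u _ _ power_sum1) => n; rewrite [(u ^ S n)%C]/=; ring.
Qed.

Lemma X4_series : isS (fun n => INR (S n) ^ 3 * u ^ S n)%C (X4 u).
Proof.
apply: (isS_val _ (u * ((1 + 4 * u + u * u) / (1 - u) ^ 4))%C); last by rewrite /X4 /Cdiv; ring.
by apply: isS_ext (isS_scal u _ _ power_sum3) => n; rewrite [(u ^ S n)%C]/=; ring.
Qed.

Lemma geom_series : isS (fun n => u ^ S n)%C (u / (1 - u))%C.
Proof. by apply: isS_ext (isS_scal u _ _ power_sum0) => n; rewrite /=; ring. Qed.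

End PowerSums.

Lemma Cmod_pow_lt (q : C) n : Cmod q < 1 -> Cmod (q ^ S n)%C < 1.
Proof.
move=> h; rewrite Cmod_pow; elim: n => [|n IH]; first by rewrite /= Rmult_1_r.
rewrite -tech_pow_Rmult; have := Cmod_ge_0 q; nra.
Qed.

(** Both series are iterated sums of the array $n^pq^{nm}$: summed over $m$ it is geometric, summed
    over $n$ it is [X] at $q^m$. *)
Lemma lambert_exchange p X (q : C) : (p <= 3)%nat -> Cmod q < 1 ->
  (forall u, Cmod u < 1 -> isS (fun n => INR (S n) ^ p * u ^ S n)%C (X u)) ->
  exists s, isS (fun n => INR (S n) ^ p * q ^ S n / (1 - q ^ S n))%C s /\ isS (fun m => X (q ^ S m)%C) s.
Proof.
move=> hp hq hX; have hq0 := Cmod_ge_0 q.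
have [B [rho [hB [hr h]]]] := cube_geom_bound (Cmod q) (conj hq0 hq).
apply: (fubini (fun n m => INR (S n) ^ p * (q ^ S n) ^ S m)%C (fun n => B * rho ^ n) (fun m => Cmod q ^ m)).
- by move=> i; apply: Rmult_le_pos => //; apply: pow_le; lra.
- by move=> i; apply: pow_le.
- exact: ex_series_geo.
- by apply: ex_series_geom; rewrite Rabs_pos_eq.
- move=> n m; rewrite Cmod_mult !Cmod_pow Cmod_R Rabs_pos_eq; last exact: pos_INR.
  have a1 : INR (S n) ^ p <= INR (S n) ^ 3 by apply: Rle_pow => //; exact: INR_S_ge1.
  have a2 : (Cmod q ^ S n) ^ S m <= Cmod q ^ n * Cmod q ^ m.
    rewrite -pow_mult -pow_add.
    have -> : (S n * S m = (n + m) + S (n * m))%nat by lia.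
    rewrite pow_add -[X in _ <= X]Rmult_1_r; apply: Rmult_le_compat_l; first exact: pow_le.
    by rewrite -(pow1 (S (n * m))); apply: pow_incr; lra.
  apply: Rle_trans (_ : INR (S n) ^ 3 * (Cmod q ^ n * Cmod q ^ m) <= _).
    apply: Rmult_le_compat => //; first by apply: pow_le; exact: pos_INR.
    by apply: pow_le; apply: pow_le.
  by rewrite -Rmult_assoc; apply: Rmult_le_compat_r; [exact: pow_le | exact: h].
- move=> n; apply: (isS_val _ (INR (S n) ^ p * (q ^ S n / (1 - q ^ S n)))%C); last by rewrite /Cdiv; ring.
  by apply: isS_scal; apply: geom_series; exact: Cmod_pow_lt.
- move=> m; apply: isS_ext (hX _ (Cmod_pow_lt q m hq)) => n.
  by rewrite -!Cpow_mult_r Nat.mul_comm.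
Qed.

(** * Eisenstein series as lattice sums and their inversion *)

Lemma E_mul n z : E (INR n * z)%C = (E z ^ n)%C.
Proof.
elim: n => [|n IH]; first by rewrite /E /= Cmult_0_l Cmult_0_r Cexp_0.
by rewrite S_INR RtoC_plus (_ : (INR n + 1) * z = z + INR n * z)%C; [rewrite E_plus IH | ring].
Qed.

Lemma kap2E : kappa2 = (- (4 * PI ^ 2))%C.
Proof. by rewrite /kappa2; transitivity (4 * PI ^ 2 * (Ci * Ci))%C; [rewrite /=; ring | rewrite Ci_sqr; ring]. Qed.

Lemma kap4E : kappa4 = (16 * PI ^ 4 / 6)%C.
Proof.
rewrite /kappa4; congr (_ / _)%C.
by transitivity (16 * PI ^ 4 * (Ci * Ci) * (Ci * Ci))%C; [rewrite /=; ring | rewrite Ci_sqr; ring].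
Qed.

Lemma PI_C_neq0 : RtoC PI <> RtoC 0.
Proof. by apply: RtoC_neq; have := PI_RGT_0; lra. Qed.

(** The factor $6/\pi^2$ is $1/\zeta(2)$: with the rows in closed form this is
    $\zeta(2)E_2=\zeta(2)+\sum_{n\ge1}\sum_m(n\tau+m)^{-2}$, in this order of summation. Likewise
    $90/\pi^4=1/\zeta(4)$ in weight 4. *)
Lemma E2_lattice (tau : UHP) : exists e, isS (fun n => kappa2 * X2 (E (INR (S n) * tau)))%C e /\ E2 tau = (1 + 6 / PI ^ 2 * e)%C.
Proof.
have hq := Cmod_E_lt tau (uhp_im tau).
have [s [h1 h2]] := lambert_exchange 1 X2 (E tau) ltac:(lia) hq X2_series.
exists (kappa2 * s)%C; split.
  by apply: isS_ext (isS_scal kappa2 _ _ h2) => n; rewrite E_mul.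
rewrite /E2 (CSeries_isS _ s); last by apply: isS_ext h1 => n; rewrite Cpow_1_r.
by rewrite kap2E; have := PI_C_neq0 => hpi; field.
Qed.

Lemma E4_lattice (tau : UHP) : exists e, isS (fun n => kappa4 * X4 (E (INR (S n) * tau)))%C e /\ E4 tau = (1 + 90 / PI ^ 4 * e)%C.
Proof.
have hq := Cmod_E_lt tau (uhp_im tau).
have [s [h1 h2]] := lambert_exchange 3 X4 (E tau) ltac:(lia) hq X4_series.
exists (kappa4 * s)%C; split.
  by apply: isS_ext (isS_scal kappa4 _ _ h2) => n; rewrite E_mul.
rewrite /E4 (CSeries_isS _ s); last by apply: isS_ext h1 => n.
by rewrite kap4E; have := PI_C_neq0 => hpi; field.
Qed.

Section Rows.
Variables (t : C) (c : R).
Hypothesis ht : 0 < Im t.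
Hypothesis hc : 0 < c.
Hypothesis hlat : forall x y : R, c * (Rabs x + Rabs y) <= Cmod (x * t + y)%C.

Lemma lattice_row_hyps n : (forall j, c * INR (S j) <= Cmod (INR (S n) * t + INR j)%C) /\
  (forall j, c * INR (S j) <= Cmod (INR (S n) * t - INR (S j))%C) /\ E (INR (S n) * t)%C <> 1.
Proof.
have h1 := INR_S_ge1 n; split; [|split].
- move=> j; have hj := pos_INR j; apply: Rle_trans (hlat _ _); apply: Rmult_le_compat_l; first lra.
  rewrite (Rabs_pos_eq (INR (S n))) ?(Rabs_pos_eq (INR j)) // ?(S_INR j); lra.
- move=> j; have hj := INR_S_ge1 j; rewrite (_ : _ - _ = RtoC (INR (S n)) * t + RtoC (- INR (S j)))%C; last by rewrite RtoC_opp.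
  apply: Rle_trans (hlat _ _); apply: Rmult_le_compat_l; first lra.
  rewrite (Rabs_pos_eq (INR (S n))) ?Rabs_Ropp ?(Rabs_pos_eq (INR (S j))); lra.
- move=> e; have := Cmod_E_lt (INR (S n) * t)%C; rewrite e Cmod_1.
  have -> : Im (INR (S n) * t)%C = INR (S n) * Im t by rewrite /Im /=; ring.
  by move=> h; have := h ltac:(nra); lra.
Qed.

Lemma row2 n : isS (fun j => / (INR (S n) * t + INR j) ^ 2 + / (INR (S n) * t - INR (S j)) ^ 2)%C (kappa2 * X2 (E (INR (S n) * t))).
Proof. by have [h1 [h2 h3]] := lattice_row_hyps n; apply: (partial_fractions2 _ c). Qed.

Lemma row4 n : isS (fun j => / (INR (S n) * t + INR j) ^ 4 + / (INR (S n) * t - INR (S j)) ^ 4)%C (kappa4 * X4 (E (INR (S n) * t))).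
Proof. by have [h1 [h2 h3]] := lattice_row_hyps n; apply: (partial_fractions4 _ c). Qed.

End Rows.

(** [S_law] with the defect $\pi i/\tau$, multiplied by $\tau^2$ and divided by $\zeta(2)$: the
    defect becomes $-6i\tau/\pi=6\tau/(\pi i)$. *)
Lemma E2_S (tau tau' : UHP) : uhp_val tau' = (- / tau)%C -> E2 tau' = (tau ^ 2 * E2 tau + 6 / (PI * Ci) * tau)%C.
Proof.
move=> e; have [c [hc hl]] := lattice_bound tau (uhp_im tau); have [c' [hc' hl']] := lattice_bound tau' (uhp_im tau').
have [e1 [h1 ->]] := E2_lattice tau; have [e2 [h2 ->]] := E2_lattice tau'.
have t0 := t_neq0 tau (uhp_im tau).
have [A [hA hcor]] := correction_term tau c (uhp_im tau) hc hl.
have r2 := row2 tau' c' (uhp_im tau') hc' hl'; rewrite e in r2.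
have hth : forall n j, Cmod (lat_plus 2 tau n j + lat_minus 2 tau n (S j) + theta tau n j)%C <= (2 * A) * / (INR (S n) + INR j) ^ 3.
  move=> n j; have a1 := hcor n (INR j); have a2 := hcor n (- INR (S j)).
  rewrite RtoC_opp in a2; rewrite /lat_plus /lat_minus /theta.
  have n1 := INR_S_ge1 n; have n2 := pos_INR j.
  rewrite Rabs_Ropp (Rabs_pos_eq (INR (S j))) in a2; last exact: pos_INR.
  rewrite (Rabs_pos_eq (INR j)) // in a1.
  rewrite (_ : _ + _ + _ = (/ (INR (S n) * tau + INR j) ^ 2 + / tau * lat_log_diff2 tau n (INR j)) +
    (/ (INR (S n) * tau + - INR (S j)) ^ 2 + / tau * lat_log_diff2 tau n (- INR (S j))))%C; last by rewrite /Cminus; ring.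
  apply: Rle_trans (Cmod_triangle _ _) _.
  have : A * / (INR (S n) + INR (S j)) ^ 3 <= A * / (INR (S n) + INR j) ^ 3.
    apply: Rmult_le_compat_l => //; apply: Rinv_le_contravar; first by apply: pow_lt; lra.
    by apply: pow_incr; rewrite (S_INR j); lra.
  lra.
have law := S_law 2 tau (theta tau) _ (kappa tau) _ _ _ e1 e2 _ (uhp_im tau) ltac:(lia) ltac:(move=> x /=; ring) hth
  (theta_row tau c (uhp_im tau) hc hl) (theta_col tau c (uhp_im tau) hc hl) (kappa_sum tau (uhp_im tau))
  (row2 tau c (uhp_im tau) hc hl) r2 h1.
rewrite -e in law; have {}law := law _ h2 zeta2.
have hpi := PI_C_neq0.
have ci0 : Ci <> RtoC 0 by move=> /(f_equal snd) /=; lra.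
have e3 : (e2 = tau ^ 2 * (e1 + PI ^ 2 / 6 - PI * Ci / tau) - PI ^ 2 / 6)%C.
  rewrite law; field; exact: t0.
rewrite e3.
transitivity (tau ^ 2 * (1 + 6 / PI ^ 2 * e1) - 6 / PI * Ci * tau)%C.
  by field; repeat (split => //).
have -> : (6 / (PI * Ci) = - (6 / PI * Ci))%C.
  transitivity (6 / (PI * Ci) * (- (Ci * Ci)))%C; first by rewrite Ci_sqr; ring.
  by field.
ring.
Qed.

(** In weight 4 the terms decay faster than cubically and the double series converges absolutely, so
    the correction and its defect are 0. *)
Lemma E4_S (tau tau' : UHP) : uhp_val tau' = (- / tau)%C -> E4 tau' = (tau ^ 4 * E4 tau)%C.
Proof.
move=> e; have [c [hc hl]] := lattice_bound tau (uhp_im tau); have [c' [hc' hl']] := lattice_bound tau' (uhp_im tau').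
have [e1 [h1 ->]] := E4_lattice tau; have [e2 [h2 ->]] := E4_lattice tau'.
have t0 := t_neq0 tau (uhp_im tau).
have r2 := row4 tau' c' (uhp_im tau') hc' hl'; rewrite e in r2.
have z0 : isS (fun _ => RtoC 0) 0 by exact: (isS_fin (fun _ => RtoC 0) O (fun _ _ => Logic.eq_refl)).
have hth : forall n j, Cmod (lat_plus 4 tau n j + lat_minus 4 tau n (S j) + 0)%C <= (2 * / c ^ 4) * / (INR (S n) + INR j) ^ 3.
  move=> n j; have n1 := INR_S_ge1 n; have n2 := pos_INR j; have pc : 0 < c ^ 4 by exact: pow_lt.
  have gen : forall y : R, INR j <= Rabs y -> Cmod (/ (INR (S n) * tau + y) ^ 4)%C <= / c ^ 4 * / (INR (S n) + INR j) ^ 3.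
    move=> y hy; set h := INR (S n) + INR j.
    have hh1 : 1 <= h by rewrite /h; lra.
    have hb : c * h <= Cmod (INR (S n) * tau + y)%C.
      by apply: Rle_trans (hl _ _); apply: Rmult_le_compat_l; [lra | rewrite (Rabs_pos_eq (INR (S n))) /h; lra].
    have n0 : (INR (S n) * tau + y)%C <> RtoC 0 by apply/Cmod_gt_0; nra.
    rewrite Cmod_inv; last exact: Cpow_nz.
    rewrite Cmod_pow -Rinv_mult; apply: Rinv_le_contravar.
      by apply: Rmult_lt_0_compat => //; apply: pow_lt; lra.
    apply: Rle_trans (_ : (c * h) ^ 4 <= _); last by apply: pow_incr; nra.
    rewrite Rpow_mult_distr; apply: Rmult_le_compat_l; first lra.
    by apply: Rle_pow => //; lia.
  have g1 := gen (INR j) (Rle_abs _); have g2 := gen (- INR (S j)).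
  rewrite Rabs_Ropp (Rabs_pos_eq (INR (S j))) ?RtoC_opp in g2; last exact: pos_INR.
  have {}g2 := g2 ltac:(rewrite (S_INR j); lra).
  apply: Rle_trans (Cmod_triangle3 _ _ _) _; rewrite Cmod_0 /lat_plus /lat_minus /Cminus; lra.
have law := S_law 4 tau (fun _ _ => RtoC 0) _ (fun _ => RtoC 0) _ _ 0 e1 e2 _ (uhp_im tau) ltac:(lia) ltac:(move=> x /=; ring) hth
  (fun _ => z0) (fun _ => z0) z0 (row4 tau c (uhp_im tau) hc hl) r2 h1.
rewrite -e in law; have {}law := law _ h2 zeta4.
have hpi := PI_C_neq0.
have e3 : (e2 = tau ^ 4 * (e1 + PI ^ 4 / 90 - 0) - PI ^ 4 / 90)%C.
  rewrite law; field; exact: t0.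
by rewrite e3; field.
Qed.

(** * The full modular group *)

Lemma UHP_eq (t t' : UHP) : uhp_val t = uhp_val t' -> t = t'.
Proof. by case: t => z h; case: t' => z' h' /= e; subst z'; rewrite (proof_irrelevance _ h h'). Qed.

Lemma UHP_neq0 (t : UHP) : uhp_val t <> RtoC 0.
Proof. by move=> e; have := uhp_im t; rewrite e /Im /=; lra. Qed.

Definition shift (t : UHP) (x : R) : UHP.
Proof.
exists (t + x)%C; rewrite (_ : Im _ = Im t); first exact: uhp_im.
by rewrite /Im /=; ring.
Defined.

Definition inversion (t : UHP) : UHP.
Proof.
exists (- / t)%C; have h := uhp_im t; move: h; case: (uhp_val t) => x y; rewrite /Im /= => h.
have -> : - (- y / (x * (x * 1) + y * (y * 1))) = y / (x ^ 2 + y ^ 2) by field; nra.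
by apply: Rdiv_lt_0_compat => //; nra.
Defined.

Section AllSL2Z.
Variables (f : UHP -> C) (s : nat) (kap : C).
Hypothesis hsk : s = 2%nat \/ kap = RtoC 0.
Hypothesis heven : forall x : C, ((- x) ^ s = x ^ s)%C.
Hypothesis hT : forall t, f (shift t 1) = f t.
Hypothesis hS : forall t, f (inversion t) = (t ^ s * f t + kap * t)%C.

Lemma shift_Z t (n : Z) : f (shift t (IZR n)) = f t.
Proof.
have pos : forall m t, f (shift t (INR m)) = f t.
  elim=> [|m IH] {}t; first by congr f; apply: UHP_eq; rewrite /=; ring.
  rewrite -[RHS](IH t) -[RHS]hT; congr f; apply: UHP_eq.
  by rewrite [LHS]/= -/(INR (S m)) [RHS]/= S_INR RtoC_plus; ring.
case: (Z_le_gt_dec 0 n) => h.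
  by rewrite -(Z2Nat.id n h) -INR_IZR_INZ.
rewrite -(pos (Z.to_nat (- n)) (shift t (IZR n))) INR_IZR_INZ Z2Nat.id; last lia.
by congr f; apply: UHP_eq; rewrite /= opp_IZR RtoC_opp; ring.
Qed.

(** The extra term is compatible with products in weight 2, hence [hsk]; [E2] is the case $s=2$ and
    [E4] the case where [kap] is 0. *)
Definition law (g : SL2Z) := forall t : UHP,
  f (act g t) = (autj g t ^ s * f t + kap * IZR (sc g) * autj g t)%C.

Lemma law_c0 g : sc g = 0%Z -> law g.
Proof.
move=> hc t; have hd := sl2_det g; rewrite hc Z.mul_0_r Z.sub_0_r in hd.
have [[ea ed]|[ea ed]] : (sa g = 1 /\ sd g = 1 \/ sa g = -1 /\ sd g = -1)%Z.
  have : (sa g = 1 \/ sa g = -1)%Z by apply: Z.eq_mul_1 hd.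
  by case=> h; [left|right]; rewrite h in hd *; lia.
- rewrite -(shift_Z t (sb g)) /autj hc ed.
  have -> : act g t = shift t (IZR (sb g)).
    by apply: UHP_eq; rewrite /= /mobius /autj hc ea ed; field.
  rewrite (_ : 0 * t + 1 = 1)%C; last ring.
  rewrite Cpow_1_l shift_Z; ring.
- have -> : act g t = shift t (IZR (- sb g)).
    apply: UHP_eq; rewrite /= /mobius /autj hc ea ed opp_IZR RtoC_opp.
    by field.
  rewrite shift_Z /autj hc ed (_ : 0 * t + -1 = - (1))%C; last ring.
  rewrite heven Cpow_1_l; ring.
Qed.

(** With $q$ the quotient of $a$ by $c$ this is $S^{-1}T^{-q}g$; its lower left entry is minus the
    remainder of $a$ modulo $c$. *)
Definition reduce (g : SL2Z) : SL2Z.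
Proof.
exists (sc g) (sd g) (- (sa g - sa g / sc g * sc g))%Z (- (sb g - sa g / sc g * sd g))%Z.
have := sl2_det g; nia.
Defined.

(* Euclid's algorithm on the bottom left entry. *)
Lemma law_all g : law g.
Proof.
have main : forall N g, (Z.abs (sc g) <= Z.of_nat N)%Z -> law g.
  elim=> [|N IH] {}g hN; first by apply: law_c0; lia.
  case: (Z.eq_dec (sc g) 0) => hc; first exact: law_c0.
  have hlt : (Z.abs (sc (reduce g)) <= Z.of_nat N)%Z.
    rewrite /=; have h1 := Z.div_mod (sa g) (sc g) hc.
    have h2 : (Z.abs (sa g mod sc g) < Z.abs (sc g))%Z.
      case: (Z_lt_ge_dec 0 (sc g)) => h.
        by have := Z.mod_pos_bound (sa g) (sc g) h; lia.
      by have := Z.mod_neg_bound (sa g) (sc g) ltac:(lia); lia.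
    lia.
  have L := IH _ hlt; move=> t.
  have nj := autj_neq0 g t (uhp_im t); have nj' := autj_neq0 (reduce g) t (uhp_im t).
  have LT := L t; set w := act (reduce g) t in LT.
  have ew : (w * autj (reduce g) t = autj g t)%C.
    transitivity ((autj g t / autj (reduce g) t) * autj (reduce g) t)%C; first by [].
    by field.
  have eg : act g t = shift (inversion w) (IZR (sa g / sc g)).
    apply: UHP_eq; have nw := UHP_neq0 w.
    transitivity (- / w + RtoC (IZR (sa g / sc g)))%C; last by [].
    have -> : (/ w = autj (reduce g) t / autj g t)%C by rewrite -ew; field.
    rewrite [LHS]/= /mobius.
    have -> : (IZR (sa g) * t + IZR (sb g) = - autj (reduce g) t + IZR (sa g / sc g) * autj g t)%C.
      rewrite /autj /= !opp_IZR !minus_IZR !mult_IZR !RtoC_opp !RtoC_minus !RtoC_mult; ring.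
    by field.
  rewrite eg shift_Z hS LT.
  (* The cocycle relation for the extra term; it is the determinant condition. *)
  have key : (1 + IZR (sc (reduce g)) * autj g t = IZR (sc g) * autj (reduce g) t)%C.
    have hd := sl2_detR g.
    have hdC : (IZR (sa g) * IZR (sd g) - IZR (sb g) * IZR (sc g) = 1)%C.
      by rewrite -!RtoC_mult -RtoC_minus hd.
    rewrite -hdC /autj /= !opp_IZR !minus_IZR !mult_IZR !RtoC_opp !RtoC_minus !RtoC_mult; ring.
  have ej : (autj g t ^ s = w ^ s * autj (reduce g) t ^ s)%C by rewrite -ew Cpow_mult_l.
  case: hsk => [e2|->]; last by rewrite ej; ring.
  rewrite ej e2; transitivity (w ^ 2 * autj (reduce g) t ^ 2 * f t + kap * w * (1 + IZR (sc (reduce g)) * (w * autj (reduce g) t)))%C.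
    by rewrite /=; ring.
  rewrite ew key; rewrite -ew; ring.
by apply: (main (Z.to_nat (Z.abs (sc g)))); rewrite Z2Nat.id; lia.
Qed.

End AllSL2Z.

Lemma E2_act g t : E2 (act g t) = (autj g t ^ 2 * E2 t + 6 / (PI * Ci) * IZR (sc g) * autj g t)%C.
Proof.
apply: (law_all E2 2); first by left.
- by move=> x /=; ring.
- move=> u; rewrite /E2; congr (1 - 24 * CSeries _)%C.
  by apply: FunctionalExtensionality.functional_extensionality => m; rewrite /qpar /= -!/(E _) E_periodic.
- by move=> u; apply: E2_S.
Qed.

Lemma E4_act g t : E4 (act g t) = (autj g t ^ 4 * E4 t)%C.
Proof.
transitivity (autj g t ^ 4 * E4 t + 0 * IZR (sc g) * autj g t)%C; last ring.
apply: (law_all E4 4); first by right.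
- by move=> x /=; ring.
- move=> u; rewrite /E4; congr (1 + 240 * CSeries _)%C.
  by apply: FunctionalExtensionality.functional_extensionality => m; rewrite /qpar /= -!/(E _) E_periodic.
- by move=> u; rewrite (E4_S u) //; ring.
Qed.

(** * Holomorphy at the cusp *)

Lemma csum_isD (f : nat -> C -> C) (f' : nat -> C) z K : (forall n, isD (f n) z (f' n)) ->
  isD (fun w => csum (fun n => f n w) K) z (csum f' K).
Proof.
move=> h; elim: K => [|K IH]; first exact: isD_const.
exact: isD_plus.
Qed.

Section Weierstrass.
Variables (f : nat -> C -> C) (F : C -> C) (M : nat -> R) (z0 : C) (r : R).
Hypothesis hr : 0 < r.
Hypothesis hf : forall n z, Cmod (z - z0)%C <= r -> exists l : C, isD (f n) z l.
Hypothesis hM : forall n z, Cmod (z - z0)%C <= r -> Cmod (f n z) <= M n.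
Hypothesis sM : ex_series M.
Hypothesis hF : forall z, Cmod (z - z0)%C <= r -> isS (fun n => f n z) (F z).

Let ball z := Cmod (z - z0)%C <= r.
Let prim n := seg_int (f n) z0.

Lemma ball_center : Cmod (z0 - z0)%C <= r.
Proof. by rewrite Cminus_diag Cmod_0; lra. Qed.

Lemma M_pos n : 0 <= M n.
Proof. apply: Rle_trans (hM n z0 ball_center); exact: Cmod_ge_0. Qed.

Lemma prim_D n z : Cmod (z - z0)%C < r -> isD (prim n) z (f n z).
Proof.
move=> hz.
apply: (seg_int_primitive ball (f n) (convex_cball z0 r) _ (hf n) z0 z (r - Cmod (z - z0)%C)); try lra.
- move=> p hp; apply: Rnot_lt_le => h; have [w [h1 h2]] := hp (Cmod (p - z0)%C - r) ltac:(lra).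
  have := Cmod_dist p w z0; rewrite Cmod_sym in h2; rewrite /ball in h1; lra.
- exact: ball_center.
- move=> w hw; have := Cmod_dist w z z0; rewrite /ball; lra.
Qed.

Lemma prim_lip n u v : Cmod (u - z0)%C < r -> Cmod (v - z0)%C < r ->
  Cmod (prim n v - prim n u)%C <= M n * Cmod (v - u)%C.
Proof.
move=> hu hv; apply: (seg_MVT (prim n) (f n)) => t ht; have h := ball_seg z0 u v t r hu hv ht.
  exact: prim_D.
by apply: hM; lra.
Qed.

Lemma prim_center n : prim n z0 = 0.
Proof.
have := seg_int_bound ball (f n) (convex_cball z0 r) (hf n) z0 z0 (M n) ball_center ball_center.
rewrite Cminus_diag Cmod_0 Rmult_0_r => h.
apply: Cmod_eq_0; apply: Rle_antisym; last exact: Cmod_ge_0.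
apply: h => t ht; apply: hM; rewrite (_ : seg z0 z0 t = z0); [exact: ball_center | rewrite /seg; ring].
Qed.

Let G z := CSeries (fun n => prim n z).

Lemma G_isS z : Cmod (z - z0)%C < r -> isS (fun n => prim n z) (G z).
Proof.
move=> hz.
have [l hl] := isS_dom (fun n => r * M n) ltac:(move=> n; have := M_pos n; nra) ltac:(apply: ex_series_scal_l; exact: sM) (fun n => prim n z)
  ltac:(move=> n; have := prim_lip n z0 z ltac:(rewrite Cminus_diag Cmod_0; lra) hz;
    rewrite prim_center (_ : prim n z - 0 = prim n z)%C; [have := M_pos n; nra | ring]).
by rewrite /G (CSeries_isS _ _ hl).
Qed.

(** The first $K$ terms are differentiated one by one. The others contribute at most
    $2|w-z|\sum_{n\ge K}M_n$, since the increments of the primitives and the terms themselves are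
    both controlled by $M_n$. *)
Lemma G_D z : Cmod (z - z0)%C < r -> isD G z (F z).
Proof.
move=> hz; apply/isD_epsE => eps he.
have /is_lim_seq_spec hs := rsum_lim _ sM; have he8 : 0 < eps / 4 by lra.
have [K hK] := hs (mkposreal _ he8); have /Rabs_def2 [_ /= k2] := hK K (le_n _).
have /isD_epsE hc := csum_isD prim (fun n => f n z) z K (fun n => prim_D n z hz).
have [d [hd h1]] := hc (eps / 2) ltac:(lra).
exists (Rmin d (r - Cmod (z - z0)%C)); split; first by apply: Rmin_pos; lra.
move=> w hw; have hw1 := h1 w (Rlt_le_trans _ _ _ hw (Rmin_l _ _)).
have hwr : Cmod (w - z0)%C < r.
  have := Rlt_le_trans _ _ _ hw (Rmin_r _ _); have := Cmod_dist w z z0; lra.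
pose a n := (prim n w - prim n z - (w - z) * f n z)%C.
have hS : isS a (G w - G z - (w - z) * F z)%C.
  apply: isS_minus; first by apply: isS_minus; exact: G_isS.
  by apply: isS_scal; apply: hF; lra.
have hb : forall n, Cmod (a n) <= (2 * Cmod (w - z)%C) * M n.
  move=> n; rewrite /a; apply: Rle_trans (Cmod_triangle _ _) _; rewrite Cmod_opp Cmod_mult.
  have b1 := prim_lip n z w hz hwr; have b2 := hM n z ltac:(lra).
  have b3 := Rmult_le_compat_l _ _ _ (Cmod_ge_0 (w - z)%C) b2; lra.
have sb : ex_series (fun n => (2 * Cmod (w - z)%C) * M n) by apply: ex_series_scal_l; exact: sM.
have pb : forall n, 0 <= (2 * Cmod (w - z)%C) * M n.
  by move=> n; apply: Rmult_le_pos; [have := Cmod_ge_0 (w - z)%C; lra | exact: M_pos].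
have ht := isS_tail _ pb sb a _ K hb hS.
have er : rsum (fun n => (2 * Cmod (w - z)%C) * M n) K = (2 * Cmod (w - z)%C) * rsum M K.
  by elim: (K) => [|k IH] /=; [ring | rewrite IH; ring].
rewrite Series_scal_l er in ht.
have ec : csum a K = (csum (fun n => prim n w) K - csum (fun n => prim n z) K - (w - z) * csum (fun n => f n z) K)%C.
  by elim: (K) => [|k IH] /=; [ring | rewrite IH /a; ring].
rewrite -ec in hw1.
rewrite (_ : _ - _ = (G w - G z - (w - z) * F z - csum a K) + csum a K)%C; last by ring.
apply: Rle_trans (Cmod_triangle _ _) _.
have := Cmod_ge_0 (w - z)%C; nra.
Qed.

(* The primitives of the [f n] sum to a function with derivative [F], and derivatives of
   holomorphic functions are holomorphic. *)
Lemma weierstrass : exists l : C, isD F z0 l.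
Proof.
have [l hl] := derive_holomorphic G z0 r hr (fun z hz => ex_intro _ _ (G_D z hz)).
exists l; apply: (isD_local (C_derive G) _ _ _ r hr) hl => w hw.
exact: isD_C_derive (G_D w hw).
Qed.

End Weierstrass.

Definition disc_holomorphic (g : C -> C) := forall z, Cmod z < 1 -> exists l : C, isD g z l.

Lemma isD_quot_pow p n z : Cmod z < 1 -> exists l : C, isD (fun q => INR (S n) ^ p * q ^ S n / (1 - q ^ S n))%C z l.
Proof.
move=> hz; have n0 := one_minus_neq0 _ (Cmod_pow_lt z n hz); eexists.
apply: isD_mult; first by apply: isD_scal; exact: isD_pow.
apply: (isD_comp Cinv (fun q => 1 - q ^ S n)%C); first exact: isD_Cinv.
apply: isD_minus (isD_const _ _) (isD_pow _ _).
Qed.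

Lemma lambert_holomorphic p X : (p <= 3)%nat -> (forall u, Cmod u < 1 -> isS (fun n => INR (S n) ^ p * u ^ S n)%C (X u)) ->
  disc_holomorphic (fun q => CSeries (fun n => INR (S n) ^ p * q ^ S n / (1 - q ^ S n))%C).
Proof.
(* On the disc of radius $r$ around $z$ the modulus stays at most $R<1$, which keeps the
   denominators above $1-R$ and gives a geometric majorant. *)
move=> hp hX z hz; pose r := (1 - Cmod z) / 2; have hz0 := Cmod_ge_0 z.
have hr : 0 < r by rewrite /r; lra.
pose R := Cmod z + r; have hR : 0 <= R < 1 by rewrite /R /r; lra.
have [B [rho [hB [hrho h]]]] := cube_geom_bound R hR.
have inb : forall w, Cmod (w - z)%C <= r -> Cmod w <= R.
  by move=> w hw; rewrite (_ : w = (w - z) + z)%C; [apply: Rle_trans (Cmod_triangle _ _) _; rewrite /R; lra | ring].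
apply: (weierstrass (fun n q => INR (S n) ^ p * q ^ S n / (1 - q ^ S n))%C _ (fun n => (B * / (1 - R)) * rho ^ n) z r hr).
- by move=> n w hw; apply: isD_quot_pow; have := inb w hw; lra.
- move=> n w hw; have hw1 := inb w hw; have hlt : Cmod w < 1 by lra.
  have n0 := one_minus_neq0 _ (Cmod_pow_lt w n hlt).
  rewrite Cmod_div // Cmod_mult !Cmod_pow Cmod_R Rabs_pos_eq; last exact: pos_INR.
  have p0 := Cmod_ge_0 w.
  have b1 : Cmod w ^ S n <= R ^ S n by apply: pow_incr.
  have b2 : R ^ S n <= R.
    rewrite /= -[X in _ <= X]Rmult_1_r; apply: Rmult_le_compat_l; first lra.
    by rewrite -(pow1 n); apply: pow_incr; lra.
  have b3 : 1 - R <= Cmod (1 - w ^ S n)%C.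
    have := Cmod_minus_le 1 (w ^ S n)%C; rewrite Cmod_1 Cmod_pow; lra.
  have b4 : R ^ S n <= R ^ n by rewrite /=; have := pow_le R n ltac:(lra); nra.
  have b5 : INR (S n) ^ p * Cmod w ^ S n <= B * rho ^ n.
    apply: Rle_trans (h n); apply: Rmult_le_compat.
    - by apply: pow_le; exact: pos_INR.
    - exact: pow_le.
    - by apply: Rle_pow => //; exact: INR_S_ge1.
    - lra.
  rewrite (_ : B * / (1 - R) * rho ^ n = B * rho ^ n * / (1 - R)); last ring.
  apply: Rmult_le_compat => //.
  - by apply: Rmult_le_pos; [apply: pow_le; exact: pos_INR | exact: pow_le].
  - by apply: Rlt_le; apply: Rinv_0_lt_compat; lra.
  - by apply: Rinv_le_contravar; lra.
- by apply: ex_series_geo.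
- move=> w hw; have hw1 := inb w hw; have hlt : Cmod w < 1 by lra.
  have [s [hs _]] := lambert_exchange p X w hp hlt hX.
  by rewrite (CSeries_isS _ _ hs).
Qed.

Lemma qpar_lt (tau : UHP) : Cmod (qpar tau) < 1.
Proof. exact: Cmod_E_lt (uhp_im tau). Qed.

Lemma ext_isD (f : UHP -> C) (g : C -> C) (tau : UHP) (l : C) : (forall t : UHP, f t = g t) ->
  isD g (uhp_val tau) l -> isD (ext f) (uhp_val tau) l.
Proof.
move=> e; apply: (is_derive_ext_loc (V:=C_NormedModule)).
by apply: filter_imp (near_UHP tau) => z hz; rewrite (ext_in _ z hz) e.
Qed.

Lemma cusp_isD (f : UHP -> C) (g : C -> C) (tau : UHP) : disc_holomorphic g -> (forall t, f t = g (qpar t)) ->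
  isD (ext f) (uhp_val tau) (C_derive g (qpar tau) * (2 * PI * Ci * qpar tau))%C.
Proof.
move=> hg e; apply: (ext_isD f (fun z => g (E z))); first exact: e.
have [l hl] := hg _ (qpar_lt tau); rewrite (isD_C_derive _ _ _ hl).
have hl' : isD g (E tau) l := hl.
have h := isD_comp g E (uhp_val tau) l _ hl' (isD_E (uhp_val tau)).
by apply: (isD_val _ _ _ _ h); exact: Cmult_comm.
Qed.

Notation hwc := holomorphic_with_cusp.

Lemma hwc_intro (f : UHP -> C) (g : C -> C) : disc_holomorphic g -> (forall t, f t = g (qpar t)) -> hwc f.
Proof.
move=> hg e; split; last by exists g.
by move=> tau; eexists; exact: (cusp_isD f g tau hg e).
Qed.

Lemma hwc_elim (f : UHP -> C) : hwc f -> exists g, disc_holomorphic g /\ forall t, f t = g (qpar t).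
Proof. by case=> _ [g [h1 h2]]; exists g. Qed.

Lemma hwc_const (c : C) : hwc (fun _ => c).
Proof. by apply: (hwc_intro _ (fun _ => c)) => // z _; eexists; exact: isD_const. Qed.

Lemma hwc_plus (f g : UHP -> C) : hwc f -> hwc g -> hwc (fun t => f t + g t)%C.
Proof. exact: (subspace_plus _ holomorphic_with_cusp_subspace). Qed.

Lemma hwc_scal c (f : UHP -> C) : hwc f -> hwc (fun t => c * f t)%C.
Proof. exact: (subspace_scal _ holomorphic_with_cusp_subspace). Qed.

Lemma hwc_ext (f g : UHP -> C) : (forall t, f t = g t) -> hwc f -> hwc g.
Proof. by move=> e h; rewrite -(functional_extensionality _ _ e). Qed.

Lemma hwc_minus (f g : UHP -> C) : hwc f -> hwc g -> hwc (fun t => f t - g t)%C.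
Proof.
move=> hf /(hwc_scal (-1)) hg; apply: hwc_ext (hwc_plus _ _ hf hg) => t; ring.
Qed.

Lemma hwc_mult (f g : UHP -> C) : hwc f -> hwc g -> hwc (fun t => f t * g t)%C.
Proof.
move=> /hwc_elim [u [hu eu]] /hwc_elim [v [hv ev]].
apply: (hwc_intro _ (fun z => u z * v z)%C); last by move=> t; rewrite eu ev.
move=> z hz; have [l hl] := hu z hz; have [m hm] := hv z hz.
by eexists; exact: isD_mult hl hm.
Qed.

Lemma disc_derive g : disc_holomorphic g -> disc_holomorphic (C_derive g).
Proof.
move=> hg z hz; apply: (derive_holomorphic g z (1 - Cmod z)); first lra.
move=> w hw; apply: hg; rewrite (_ : w = (w - z) + z)%C; last ring.
by apply: Rle_lt_trans (Cmod_triangle _ _) _; lra.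
Qed.

(** In the variable $q$ the operator $D$ is $q\,d/dq$. *)
Lemma hwc_Dq (f : UHP -> C) : hwc f -> hwc (Dq f).
Proof.
move=> /hwc_elim [g [hg e]]; apply: (hwc_intro _ (fun q => q * C_derive g q)%C).
  move=> z hz; have [l hl] := disc_derive g hg z hz.
  by eexists; exact: isD_mult (isD_id z) hl.
move=> t; rewrite /Dq (isD_C_derive _ _ _ (cusp_isD f g t hg e)).
have := two_pi_i_neq0; set c := (2 * PI * Ci)%C => hc; field; exact: hc.
Qed.

Lemma hwc_E2 : hwc E2.
Proof.
have h := lambert_holomorphic 1 X2 ltac:(lia) X2_series.
apply: (hwc_intro _ (fun q => 1 - 24 * CSeries (fun n => INR (S n) ^ 1 * q ^ S n / (1 - q ^ S n)))%C).
  move=> z hz; have [l hl] := h z hz; eexists.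
  exact: isD_minus (isD_const _ _) (isD_scal 24 _ _ _ hl).
move=> t; rewrite /E2; congr (1 - 24 * CSeries _)%C; apply: functional_extensionality => n.
by rewrite Cpow_1_r.
Qed.

Lemma hwc_E4 : hwc E4.
Proof.
have h := lambert_holomorphic 3 X4 ltac:(lia) X4_series.
apply: (hwc_intro _ (fun q => 1 + 240 * CSeries (fun n => INR (S n) ^ 3 * q ^ S n / (1 - q ^ S n)))%C) => //.
move=> z hz; have [l hl] := h z hz; eexists.
exact: isD_plus (isD_const _ _) (isD_scal 240 _ _ _ hl).
Qed.

Lemma holomorphic_Dq f : holomorphic f -> holomorphic (Dq f).
Proof.
move=> hf tau.
have near : forall z, Cmod (z - tau)%C < Im tau -> 0 < Im z.
  move=> z hz; have := Rle_trans _ _ _ (Rmax_r _ _) (Rmax_Cmod (z - tau)%C).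
  rewrite -/(Im _) (_ : Im (z - tau)%C = Im z - Im tau); last by rewrite /Im /=; ring.
  move=> h; have := Rle_lt_trans _ _ _ h hz; rewrite Rabs_minus_sym => /Rabs_def2; lra.
have [l hl] := derive_holomorphic (ext f) tau (Im tau) (uhp_im tau) ltac:(move=> z hz; exact: (hf (mkUHP z (near z hz)))).
eexists; apply: (ext_isD _ (fun z => (/ (2 * PI * Ci)) * C_derive (ext f) z)%C); last exact: isD_scal hl.
by move=> t; rewrite /Dq /Cdiv Cmult_comm.
Qed.

(** * Equivariance *)

Notation hol := holomorphic.

Lemma hol_D f (t : UHP) : hol f -> isD (ext f) (uhp_val t) (2 * PI * Ci * Dq f t)%C.
Proof.
move=> h; have [l hl] : exists l : C, isD (ext f) (uhp_val t) l := h t.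
apply: (isD_val _ _ _ _ hl); rewrite /Dq (isD_C_derive _ _ _ hl).
by have := two_pi_i_neq0; set c := (2 * PI * Ci)%C => hc; field.
Qed.

Lemma Dq_eq f (g : C -> C) (t : UHP) (l : C) : (forall u : UHP, f u = g u) ->
  isD g (uhp_val t) (2 * PI * Ci * l)%C -> Dq f t = l.
Proof.
move=> e h; rewrite /Dq (isD_C_derive _ _ _ (ext_isD f g t _ e h)).
by have := two_pi_i_neq0; set c := (2 * PI * Ci)%C => hc; field.
Qed.

Lemma ext_val f (t : UHP) : ext f t = f t.
Proof. by rewrite (ext_in _ _ (uhp_im t)); congr f; exact: UHP_eq. Qed.

Lemma hol_intro f (g : C -> C) : (forall u : UHP, f u = g u) -> (forall t : UHP, exists l : C, isD g (uhp_val t) l) -> hol f.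
Proof. by move=> e h t; have [l hl] := h t; exists l; exact: ext_isD e hl. Qed.

Lemma hol_const c : hol (fun _ => c).
Proof. by apply: (hol_intro _ (fun _ => c)) => // t; eexists; exact: isD_const. Qed.

Lemma hol_plus f h : hol f -> hol h -> hol (fun t => f t + h t)%C.
Proof.
move=> hf half_pow; apply: (hol_intro _ (fun z => ext f z + ext h z)%C); first by move=> u; rewrite !ext_val.
by move=> t; eexists; apply: isD_plus; exact: hol_D.
Qed.

Lemma hol_minus f h : hol f -> hol h -> hol (fun t => f t - h t)%C.
Proof.
move=> hf half_pow; apply: (hol_intro _ (fun z => ext f z - ext h z)%C); first by move=> u; rewrite !ext_val.
by move=> t; eexists; apply: isD_minus; exact: hol_D.
Qed.

Lemma hol_mult f h : hol f -> hol h -> hol (fun t => f t * h t)%C.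
Proof.
move=> hf half_pow; apply: (hol_intro _ (fun z => ext f z * ext h z)%C); first by move=> u; rewrite !ext_val.
by move=> t; eexists; apply: isD_mult; exact: hol_D.
Qed.

Lemma hol_scal c f : hol f -> hol (fun t => c * f t)%C.
Proof. by move=> h; apply: hol_mult => //; exact: hol_const. Qed.

Lemma hol_E2 : hol E2. Proof. by case: hwc_E2. Qed.
Lemma hol_E4 : hol E4. Proof. by case: hwc_E4. Qed.

Lemma hol_Dqn n f : hol f -> hol (Dqn n f).
Proof. by move=> h; elim: n => [|n IH] //=; exact: holomorphic_Dq. Qed.

Lemma Dq_const c t : Dq (fun _ => c) t = 0.
Proof. by apply: (Dq_eq _ (fun _ => c)) => //; apply: (isD_val _ _ _ _ (isD_const _ _)); ring. Qed.

Lemma Dq_plus f h t : hol f -> hol h -> Dq (fun t => f t + h t)%C t = (Dq f t + Dq h t)%C.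
Proof.
move=> hf half_pow; apply: (Dq_eq _ (fun z => ext f z + ext h z)%C); first by move=> u; rewrite !ext_val.
by apply: (isD_val _ _ _ _ (isD_plus _ _ _ _ _ (hol_D _ t hf) (hol_D _ t half_pow))); ring.
Qed.

Lemma Dq_mult f h t : hol f -> hol h -> Dq (fun t => f t * h t)%C t = (Dq f t * h t + f t * Dq h t)%C.
Proof.
move=> hf half_pow; apply: (Dq_eq _ (fun z => ext f z * ext h z)%C); first by move=> u; rewrite !ext_val.
by apply: (isD_val _ _ _ _ (isD_mult _ _ _ _ _ (hol_D _ t hf) (hol_D _ t half_pow))); rewrite !ext_val; ring.
Qed.

Lemma Dq_scal c f t : hol f -> Dq (fun t => c * f t)%C t = (c * Dq f t)%C.
Proof. by move=> h; rewrite (Dq_mult _ _ _ (hol_const c) h) Dq_const; ring. Qed.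

Lemma hol_csum (f : nat -> UHP -> C) N : (forall n, hol (f n)) -> hol (fun t => csum (fun n => f n t) N).
Proof. by move=> h; elim: N => [|N IH] /=; [exact: hol_const | exact: hol_plus]. Qed.

Lemma Dq_csum (f : nat -> UHP -> C) N t : (forall n, hol (f n)) ->
  Dq (fun t => csum (fun n => f n t) N) t = csum (fun n => Dq (f n) t) N.
Proof.
move=> h; elim: N => [|N IH] /=; first exact: Dq_const.
by rewrite Dq_plus ?IH //; exact: hol_csum.
Qed.

(** The logarithmic derivative $Dj/j$ of the automorphy factor $j=c\tau+d$; it measures every
    failure of equivariance below. *)
Definition Xg (g : SL2Z) (t : UHP) : C := (IZR (sc g) / (2 * PI * Ci * autj g t))%C.

Lemma j_neq0 g (t : UHP) : autj g t <> RtoC 0.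
Proof. exact: autj_neq0 (uhp_im t). Qed.

Lemma isD_autj g z : isD (autj g) z (RtoC (IZR (sc g))).
Proof. exact: isD_lin. Qed.

Lemma isD_Xg g (t : UHP) : isD (fun z => IZR (sc g) / (2 * PI * Ci * autj g z))%C (uhp_val t) (2 * PI * Ci * - (Xg g t * Xg g t))%C.
Proof.
have n := j_neq0 g t; have hc := two_pi_i_neq0.
apply: (isD_ext (fun z => (IZR (sc g) / (2 * PI * Ci)) * / autj g z)%C).
  by move=> w; rewrite /Cdiv !Cinv_mult; ring.
apply: (isD_val _ _ _ _ (isD_scal _ _ _ _ (isD_comp Cinv (autj g) _ _ _ (isD_Cinv _ n) (isD_autj g _)))).
by rewrite /Xg; move: hc n; set c := (2 * PI * Ci)%C; set j := autj g t => hc n; field.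
Qed.

Lemma hol_Xg g : hol (Xg g).
Proof.
apply: (hol_intro _ (fun z => IZR (sc g) / (2 * PI * Ci * autj g z))%C) => // t.
by eexists; exact: isD_Xg.
Qed.

Lemma Dq_Xg g t : Dq (Xg g) t = (- (Xg g t * Xg g t))%C.
Proof. by apply: (Dq_eq _ _ _ _ _ (isD_Xg g t)). Qed.

Lemma hol_pow f r : hol f -> hol (fun t => f t ^ r)%C.
Proof. by move=> h; elim: r => [|r IH] /=; [exact: hol_const | exact: hol_mult]. Qed.

Lemma Dq_Xg_pow g r t : Dq (fun t => Xg g t ^ r)%C t = (- (INR r * Xg g t ^ S r))%C.
Proof.
elim: r => [|r IH]; first by rewrite (Dq_const 1) /=; ring.
rewrite (Dq_mult (Xg g) (fun t => Xg g t ^ r)%C); [|exact: hol_Xg|exact/hol_pow/hol_Xg].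
by rewrite IH Dq_Xg S_INR RtoC_plus [(_ ^ S (S r))%C]/= [(_ ^ S r)%C]/=; ring.
Qed.

Lemma isD_mobius_val g (t : UHP) : isD (mobius g) (uhp_val t) (/ autj g t ^ 2)%C.
Proof.
have n := j_neq0 g t.
apply: (isD_val _ _ _ _ (isD_mult _ _ _ _ _ (isD_lin (IZR (sa g)) (IZR (sb g)) (uhp_val t))
  (isD_comp Cinv (autj g) _ _ _ (isD_Cinv _ n) (isD_autj g _)))).
have hd : (IZR (sa g) * IZR (sd g) - IZR (sb g) * IZR (sc g) = 1)%C.
  by rewrite -!RtoC_mult -RtoC_minus sl2_detR.
transitivity ((IZR (sa g) * IZR (sd g) - IZR (sb g) * IZR (sc g)) / autj g t ^ 2)%C; last by rewrite hd; field.
have e : autj g t = (IZR (sc g) * t + IZR (sd g))%C by [].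
move: n e; set j := autj g t => n e.
have -> : (RtoC (IZR (sd g)) = j - IZR (sc g) * t)%C by rewrite e; ring.
by field.
Qed.

(** From $D(j^{-k})=-kXj^{-k}$ and $(\gamma\tau)'=j^{-2}$. *)
Lemma Dq_slash k g f t : hol f ->
  Dq (slash k g f) t = (slash (k + 2) g (Dq f) t - k * Xg g t * slash k g f t)%C.
Proof.
move=> hf; have n := j_neq0 g t; have hc := two_pi_i_neq0.
apply: (Dq_eq _ (fun z => Crpow (autj g z) (- k) * ext f (mobius g z))%C).
  by move=> u; rewrite /slash -[mobius g u]/(uhp_val (act g u)) ext_val.
have h := hol_D f (act g t) hf.
apply: (isD_val _ _ _ _ (isD_mult _ _ _ _ _ (isD_Crpow_autj g (- k) _ (uhp_im t))
  (isD_comp (ext f) (mobius g) _ _ _ h (isD_mobius_val g t)))).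
rewrite -[mobius g t]/(uhp_val (act g t)) ext_val /slash /Xg.
have -> : Crpow (autj g t) (- (k + 2)) = (Crpow (autj g t) (- k) * / autj g t ^ 2)%C.
  rewrite (_ : - (k + 2) = - k + - INR 2); last by rewrite /=; ring.
  by rewrite Crpow_plus (Crpow_opp _ (INR 2)) Crpow_INR.
rewrite RtoC_opp; move: hc n; set c := (2 * PI * Ci)%C; set j := autj g t => hc n; field.
by split.
Qed.

Lemma slash_mult a b g f h t : slash (a + b) g (fun t => f t * h t)%C t = (slash a g f t * slash b g h t)%C.
Proof. rewrite /slash Ropp_plus_distr Crpow_plus; ring. Qed.

Lemma slash_scal a c g f t : slash a g (fun t => c * f t)%C t = (c * slash a g f t)%C.
Proof. rewrite /slash; ring. Qed.

Lemma slash_minus a g f h t : slash a g (fun t => f t - h t)%C t = (slash a g f t - slash a g h t)%C.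
Proof. rewrite /slash; ring. Qed.

Lemma slash_csum a g (f : nat -> UHP -> C) N t : slash a g (fun t => csum (fun n => f n t) N) t = csum (fun n => slash a g (f n) t) N.
Proof. by rewrite /slash -csum_scal. Qed.

(** $6/(\pi i)=12/(2\pi i)$ turns the law of [E2] into a shift by $12X$. *)
Lemma slash_E2 g t : slash 2 g E2 t = (E2 t + 12 * Xg g t)%C.
Proof.
have n := j_neq0 g t; have hpi := PI_C_neq0.
have ci0 : Ci <> RtoC 0 by move=> /(f_equal snd) /=; lra.
have e : Crpow (autj g t) (Ropp 2) = (/ autj g t ^ 2)%C by rewrite Crpow_opp (_ : 2 = INR 2) // Crpow_INR.
rewrite /slash e E2_act /Xg; field.
by repeat split.
Qed.

Lemma slash_E4 g t : slash 4 g E4 t = E4 t.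
Proof.
have n := j_neq0 g t.
have e : Crpow (autj g t) (Ropp 4) = (/ autj g t ^ 4)%C.
  by rewrite Crpow_opp (_ : 4 = INR 4) ?Crpow_INR //= ; ring.
by rewrite /slash e E4_act; field.
Qed.

(** The defect $kX$ of $D$ and the defect $\frac k{12}\cdot12X$ of the [E2] term cancel. *)
Lemma slash_serre k g f t : hol f -> slash (k + 2) g (serre k f) t = serre k (slash k g f) t.
Proof.
move=> hf; rewrite /serre slash_minus Dq_slash //.
rewrite (_ : k + 2 = 2 + k); last ring.
rewrite (slash_mult 2 k g (fun t => (k / 12)%R * E2 t)%C f) slash_scal slash_E2.
rewrite RtoC_div; [field | lra].
Qed.

Lemma hol_serre k f : hol f -> hol (serre k f).
Proof.
move=> h; apply: hol_minus; first exact: holomorphic_Dq.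
by apply: hol_mult => //; apply: hol_scal; exact: hol_E2.
Qed.

Lemma hol_slash k g f : hol f -> hol (slash k g f).
Proof. exact: slash_holomorphic. Qed.

Lemma hol_serre_iter k r f : hol f -> hol (serre_iter k r f).
Proof. by move=> h; elim: r => [|r IH] //=; exact: hol_serre. Qed.

Lemma slash_serre_iter k r g f : hol f -> forall t, slash (k + 2 * INR r) g (serre_iter k r f) t = serre_iter k r (slash k g f) t.
Proof.
move=> hf; elim: r => [|r IH] t; first by rewrite /= Rmult_0_r Rplus_0_r.
rewrite (_ : k + 2 * INR (S r) = (k + 2 * INR r) + 2); last by rewrite S_INR; ring.
rewrite [serre_iter k (S r) f]/= slash_serre; last exact: hol_serre_iter.
by rewrite (functional_extensionality _ _ IH).
Qed.

Lemma canonicalSS k m f t : serre_canonical k (S (S m)) f t =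
  (serre (k + 2 * INR (S m)) (serre_canonical k (S m) f) t
   - (INR (S m) * (INR (S m) + k - 1) / 144)%R * E4 t * serre_canonical k m f t)%C.
Proof. by []. Qed.

(** Two consecutive orders are carried together, since the recursion reaches back two steps. *)
Lemma hol_canonical2 k r f : hol f -> hol (serre_canonical k r f) /\ hol (serre_canonical k (S r) f).
Proof.
move=> h; elim: r => [|r [h1 h2]]; first by split => //; exact: hol_serre.
split=> //; apply: hol_minus; first exact: hol_serre.
by apply: hol_mult => //; apply: hol_scal; exact: hol_E4.
Qed.

Lemma slash_canonical2 k r g f : hol f ->
  (forall t, slash (k + 2 * INR r) g (serre_canonical k r f) t = serre_canonical k r (slash k g f) t) /\
  (forall t, slash (k + 2 * INR (S r)) g (serre_canonical k (S r) f) t = serre_canonical k (S r) (slash k g f) t).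
Proof.
move=> hf; elim: r => [|r [h1 h2]].
  split=> t; first by rewrite /= Rmult_0_r Rplus_0_r.
  by rewrite [INR 1]/= Rmult_1_r; exact: slash_serre.
split=> // t; rewrite canonicalSS -[serre_canonical k (S (S r)) f]/(fun t =>
  (serre (k + 2 * INR (S r)) (serre_canonical k (S r) f) t
   - (INR (S r) * (INR (S r) + k - 1) / 144)%R * E4 t * serre_canonical k r f t)%C).
rewrite slash_minus; congr (_ - _)%C.
  rewrite (_ : k + 2 * INR (S (S r)) = (k + 2 * INR (S r)) + 2); last by rewrite (S_INR (S r)); ring.
  rewrite slash_serre; last by case: (hol_canonical2 k r f hf).
  by rewrite (functional_extensionality _ _ h2).
rewrite (_ : k + 2 * INR (S (S r)) = 4 + (k + 2 * INR r)); last by rewrite (S_INR (S r)) (S_INR r); ring.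
by rewrite (slash_mult 4 _ g (fun t => (INR (S r) * (INR (S r) + k - 1) / 144)%R * E4 t)%C) slash_scal slash_E4 h1.
Qed.

(** * Derivatives under the slash action as polynomials in $X$ *)

Section QuasiPolynomial.
Variables (k : R) (g : SL2Z) (f : UHP -> C) (Q0 : nat -> UHP -> C) (d : nat).
Hypothesis hf : hol f.
Hypothesis hQ0 : forall r, hol (Q0 r).
Hypothesis hvan : forall r, (d < r)%nat -> Q0 r = fun _ => RtoC 0.
Hypothesis hstart : forall t, slash k g f t = csum (fun r => Q0 r t * Xg g t ^ r)%C (S d).

(* [qcoef n r] is the coefficient of [X^r] in [(D^n f)|_{k + 2n} gamma], computed from
   [D X = - X^2]. *)
Fixpoint qcoef (n : nat) : nat -> UHP -> C :=
  match n with
  | O => Q0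
  | S m => fun r => match r with
    | O => Dq (qcoef m O)
    | S s => fun t => (Dq (qcoef m (S s)) t + (k + 2 * INR m - INR s)%R * qcoef m s t)%C
    end
  end.

Lemma hol_qcoef n r : hol (qcoef n r).
Proof.
elim: n r => [|n IH] [|r] /=; try exact: hQ0; try exact: holomorphic_Dq.
by apply: hol_plus; [exact: holomorphic_Dq | exact: hol_scal].
Qed.

Lemma qcoef_vanish n r : (d + n < r)%nat -> qcoef n r = fun _ => RtoC 0.
Proof.
elim: n r => [|n IH] [|r] hr /=; try lia; first by apply: hvan; lia.
apply: functional_extensionality => t; rewrite (IH (S r)); last lia.
by rewrite (IH r); [rewrite Dq_const; ring | lia].
Qed.

(** The variable $x$ is detached from its value [Xg g t], so that one may differentiate in it and
    also set it to 0. *)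
Definition qpoly (n : nat) (x : C) (t : UHP) : C := csum (fun r => qcoef n r t * x ^ r)%C (S (d + n)).

(** Each application of [Dq_slash] adds $(k+2n)X$ times the polynomial, and $D(X^r)=-rX^{r+1}$
    accounts for the shift by $-r$ in the recursion of [qcoef]; the degree grows by one. *)
Lemma slash_Dqn n t : slash (k + 2 * INR n) g (Dqn n f) t = qpoly n (Xg g t) t.
Proof.
elim: n t => [|n IH] t; first by rewrite /= Rmult_0_r Rplus_0_r hstart /qpoly Nat.add_0_r.
have hD := Dq_slash (k + 2 * INR n) g (Dqn n f) t (hol_Dqn n f hf).
rewrite (_ : k + 2 * INR (S n) = k + 2 * INR n + 2); last by rewrite S_INR; ring.
rewrite -[Dqn (S n) f]/(Dq (Dqn n f)).
have -> : slash (k + 2 * INR n + 2) g (Dq (Dqn n f)) t =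
    (Dq (slash (k + 2 * INR n) g (Dqn n f)) t + (k + 2 * INR n)%R * Xg g t * slash (k + 2 * INR n) g (Dqn n f) t)%C.
  by rewrite hD; ring.
rewrite IH (functional_extensionality _ _ IH) /qpoly.
rewrite (Dq_csum (fun r t => qcoef n r t * Xg g t ^ r)%C); last first.
  by move=> r; apply: hol_mult; [exact: hol_qcoef | exact/hol_pow/hol_Xg].
rewrite Nat.add_succ_r; set N := S (d + n).
rewrite csum_S_l -csum_scal (csum_ext (fun i => qcoef (S n) (S i) t * _)%C
  (fun i => Dq (qcoef n (S i)) t * Xg g t ^ S i + ((k + 2 * INR n)%R * Xg g t * (qcoef n i t * Xg g t ^ i) - INR i * qcoef n i t * Xg g t ^ S i))%C); last first.
  by move=> i _; rewrite /= RtoC_minus; ring.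
rewrite csum_plus; set T2 := csum _ N; rewrite [qcoef (S n) 0%nat t]/=.
have -> : (Dq (qcoef n 0) t * Xg g t ^ 0 + (csum (fun i => Dq (qcoef n (S i)) t * Xg g t ^ S i)%C N + csum
   (fun i => (k + 2 * INR n)%R * Xg g t * (qcoef n i t * Xg g t ^ i) - INR i * qcoef n i t * Xg g t ^ S i)%C N) =
   csum (fun i => Dq (qcoef n i) t * Xg g t ^ i)%C (S N) + csum
   (fun i => (k + 2 * INR n)%R * Xg g t * (qcoef n i t * Xg g t ^ i) - INR i * qcoef n i t * Xg g t ^ S i)%C N)%C.
  by rewrite (csum_S_l _ N); ring.
rewrite csumS (_ : Dq (qcoef n N) t = 0); last by rewrite qcoef_vanish ?Dq_const // /N; lia.
rewrite Cmult_0_l Cplus_0_r /T2 -!csum_plus; apply: csum_ext => i _.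
rewrite (Dq_mult (qcoef n i) (fun t => Xg g t ^ i)%C); [|exact: hol_qcoef|exact/hol_pow/hol_Xg].
by rewrite Dq_Xg_pow; ring.
Qed.

Hypothesis hbase : forall r t, (INR (S r) * qcoef 1 (S r) t = k * qcoef 0 r t)%C.

(** Coefficientwise form of $\partial_xP_{n+1}=(n+1)(n+k)P_n$, the lowering relation of
    $\mathfrak{sl}_2$. The induction applies [Dq] to the relation already known and eliminates the
    derivative of a coefficient by the recursion of [qcoef]. *)
Lemma qcoef_lower n r t : (INR (S r) * qcoef (S n) (S r) t = (INR (S n) * (INR n + k))%R * qcoef n r t)%C.
Proof.
elim: n r t => [|n IH] r t.
  by rewrite hbase (_ : INR 1 * (INR 0 + k) = k) //=; ring.
have hDf : (fun t => INR (S r) * qcoef (S n) (S r) t)%C = (fun t => (INR (S n) * (INR n + k))%R * qcoef n r t)%C.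
  by apply: functional_extensionality => u; exact: IH.
have hD : (INR (S r) * Dq (qcoef (S n) (S r)) t = (INR (S n) * (INR n + k))%R * Dq (qcoef n r) t)%C.
  by rewrite -!Dq_scal ?hDf //; exact: hol_qcoef.
rewrite -[qcoef (S (S n)) (S r) t]/(Dq (qcoef (S n) (S r)) t + (k + 2 * INR (S n) - INR r)%R * qcoef (S n) r t)%C.
rewrite Cmult_plus_distr_l hD; case: r hDf hD => [|r] _ _.
  rewrite -[Dq (qcoef n 0) t]/(qcoef (S n) 0 t) !S_INR [INR 0]/= !(RtoC_plus, RtoC_mult, RtoC_minus); ring.
have e : Dq (qcoef n (S r)) t = (qcoef (S n) (S r) t - (k + 2 * INR n - INR r)%R * qcoef n r t)%C by rewrite /=; ring.
rewrite e; have h := IH r t.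
transitivity ((INR (S n) * (INR n + k))%R * qcoef (S n) (S r) t - (k + 2 * INR n - INR r)%R * ((INR (S n) * (INR n + k))%R * qcoef n r t)
  + INR (S (S r)) * ((k + 2 * INR (S n) - INR (S r))%R * qcoef (S n) (S r) t))%C; first ring.
rewrite -h !S_INR !(RtoC_plus, RtoC_mult, RtoC_minus); ring.
Qed.

Lemma isD_polynomial (c : nat -> C) N x : isD (fun x => csum (fun r => c r * x ^ r)%C (S N)) x (csum (fun r => INR (S r) * c (S r) * x ^ r)%C N).
Proof.
elim: N => [|N IH].
  apply: (isD_ext (fun _ => c O)); first by move=> w; rewrite /=; ring.
  exact: isD_const.
have h := isD_plus _ _ _ _ _ IH (isD_scal (c (S N)) _ _ _ (isD_pow (S N) x)).
apply: (isD_val _ _ _ _ h); rewrite [csum _ (S N)]csumS (_ : (S N - 1 = N)%nat); [ring | lia].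
Qed.

Lemma qpoly_D n x t : isD (fun x => qpoly (S n) x t) x ((INR (S n) * (INR n + k))%R * qpoly n x t)%C.
Proof.
apply: (isD_val _ _ _ _ (isD_polynomial (fun r => qcoef (S n) r t) (d + S n) x)).
rewrite Nat.add_succ_r /qpoly -csum_scal; apply: csum_ext => r _.
by rewrite qcoef_lower; ring.
Qed.

Lemma qpoly_0 n t : qpoly n 0 t = Dqn n (Q0 O) t.
Proof.
rewrite /qpoly csum_S_l (csum_ext _ (fun _ => 0 * 0)%C); last by move=> i _; rewrite /=; ring.
rewrite csum_scal (_ : qcoef n 0 = Dqn n (Q0 O)); first by rewrite /=; ring.
by elim: (n) => [|m IH] //=; rewrite IH.
Qed.

End QuasiPolynomial.

(** * Equivariance of the Kaneko-Koike operators *)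

Lemma gbinomS y i : gbinom y (S i) * INR (S i) = gbinom y i * (y - INR i).
Proof. by rewrite [gbinom y (S i)]/= -/(INR (S i)); field; apply: not_0_INR. Qed.

Lemma gbinom_absorb y m : gbinom (y + 1) (S m) * INR (S m) = gbinom y m * (y + 1).
Proof.
elim: m => [|m IH]; first by rewrite /=; field.
have n1 : INR (S m) <> 0 by exact: not_0_INR.
rewrite gbinomS.
have -> : gbinom (y + 1) (S m) = gbinom y m * (y + 1) / INR (S m) by rewrite -IH; field.
have -> : gbinom y (S m) = gbinom y m * (y - INR m) / INR (S m) by rewrite -gbinomS; field.
by rewrite (S_INR m); field; rewrite -S_INR.
Qed.

Lemma gbinom_diag m : gbinom (INR m) m = 1.
Proof.
elim: m => [|m IH] //; have n1 : INR (S m) <> 0 by exact: not_0_INR.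
apply: (Rmult_eq_reg_r (INR (S m))) => //.
by rewrite {1}S_INR gbinom_absorb IH -S_INR.
Qed.

Lemma gbinom_subdiag m : gbinom (INR m + 1) m = INR m + 1.
Proof.
have h := gbinomS (INR m + 1) m; have := gbinom_diag (S m); rewrite S_INR => e.
rewrite e S_INR in h; lra.
Qed.

Lemma sum_n_csum (a : nat -> C) n : sum_n a n = csum a (S n).
Proof.
elim: n => [|n IH]; first by rewrite sum_O /= Cplus_0_l.
by rewrite sum_Sn IH.
Qed.

Section KanekoKoike.
Variables (k : R) (g : SL2Z) (f : UHP -> C) (m : nat).
Hypothesis hf : hol f.
Let F := slash k g f.
(** The starting polynomials: $f|\gamma$ has degree 0 in $X$, and $E_2|\gamma=E_2+12X$ has degree
    1. *)
Definition QF (r : nat) : UHP -> C := match r with O => slash k g f | S _ => fun _ => RtoC 0 end.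
Definition QE (r : nat) : UHP -> C := match r with O => E2 | S O => fun _ => RtoC 12 | _ => fun _ => RtoC 0 end.

Lemma hol_QF r : hol (QF r).
Proof. by case: r => [|r]; [exact: hol_slash | exact: hol_const]. Qed.

Lemma hol_QE r : hol (QE r).
Proof. by case: r => [|[|r]]; [exact: hol_E2 | exact: hol_const | exact: hol_const]. Qed.

Lemma QF_start t : slash k g f t = csum (fun r => QF r t * Xg g t ^ r)%C 1.
Proof. by rewrite /=; ring. Qed.

Lemma QE_start t : slash 2 g E2 t = csum (fun r => QE r t * Xg g t ^ r)%C 2.
Proof. by rewrite slash_E2 /=; ring. Qed.

Lemma QF_van r : (0 < r)%nat -> QF r = fun _ => RtoC 0.
Proof. by case: r => // h; lia. Qed.

Lemma QE_van r : (1 < r)%nat -> QE r = fun _ => RtoC 0.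
Proof. by case: r => [|[|r]] // h; lia. Qed.

Lemma QF_base r t : (INR (S r) * qcoef k QF 1 (S r) t = k * QF r t)%C.
Proof.
rewrite [qcoef k QF 1 (S r) t]/= Dq_const; case: r => [|r]; last by rewrite [QF (S r) t]/=; ring.
by rewrite /= Rmult_0_r Rplus_0_r Rminus_0_r; ring.
Qed.

Lemma QE_base r t : (INR (S r) * qcoef 2 QE 1 (S r) t = 2 * QE r t)%C.
Proof.
case: r => [|[|r]].
- rewrite [qcoef 2 QE 1 1 t]/= Dq_const Rmult_0_r Rplus_0_r Rminus_0_r [QE 0 t]/= [INR 1]/=; ring.
- rewrite [qcoef 2 QE 1 2 t]/= Dq_const Rmult_0_r Rplus_0_r [QE 1 t]/= !S_INR [INR 0]/= !(RtoC_plus, RtoC_minus); ring.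
- by rewrite [qcoef 2 QE 1 _ t]/= Dq_const [QE (S (S r)) t]/=; ring.
Qed.

Let PF n x t := qpoly k QF 0 n x t.
Let PE n x t := qpoly 2 QE 1 n x t.

Definition bracket_coef (i : nat) : R := (-1) ^ i * gbinom (INR m + 2 - 1) (m - i) * gbinom (INR m + k - 1) i.

Lemma bracket_coef_0 : bracket_coef 0 = INR m + 1.
Proof.
rewrite /bracket_coef Nat.sub_0_r (_ : INR m + 2 - 1 = INR m + 1); last ring.
by rewrite gbinom_subdiag /=; ring.
Qed.

(** The defining property of Rankin-Cohen coefficients: lowering the first factor of term $i+1$ and
    the second factor of term $i$ gives opposite multiples of the same product. *)
Lemma bracket_coef_S i : (i < m)%nat ->
  bracket_coef (S i) * (INR (S i) * (INR i + 2)) + bracket_coef i * (INR (m - i) * (INR (m - S i) + k)) = 0.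
Proof.
move=> hi; rewrite /bracket_coef; have e : (m - i = S (m - S i))%nat by lia.
have h1 := gbinomS (INR m + k - 1) i.
have h2 := gbinomS (INR m + 2 - 1) (m - S i); rewrite -e in h2.
have e1 : INR (m - S i) = INR m - INR i - 1 by rewrite minus_INR ?S_INR; [ring | lia].
rewrite e1 in h2; rewrite e1.
transitivity ((-1) ^ S i * gbinom (INR m + 2 - 1) (m - S i) * (INR i + 2) * (gbinom (INR m + k - 1) (S i) * INR (S i))
  + (-1) ^ i * gbinom (INR m + k - 1) i * (INR m - INR i - 1 + k) * (gbinom (INR m + 2 - 1) (m - i) * INR (m - i))); first ring.
rewrite h1 h2 /=; ring.
Qed.

(* [koike_poly t X] is the slash of the Kaneko-Koike operator and [koike_poly t 0] is the operator applied
   to the slash; the two agree because [koike_poly t] has zero derivative. *)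
Definition koike_poly (t : UHP) (x : C) : C :=
  (PF (S m) x t - ((k + INR (S m) - 1) / 12)%R * csum (fun i => bracket_coef i * (PE i x t * PF (m - i) x t))%C (S m))%C.

(** The inner terms of the differentiated bracket cancel by [bracket_coef_S]. What is left comes
    from the linear term of [E2] and is $12(m+1)P_m$; multiplied by $(k+m)/12$ it equals
    $(m+1)(m+k)P_m$, the derivative of $P_{m+1}$. *)
Lemma koike_poly_D t x : isD (koike_poly t) x (RtoC 0).
Proof.
(* Order 0 lies outside the lowering relation: there the polynomials are $E_2+12x$ and the constant
   $f|\gamma$. *)
pose dE i x := match i with O => RtoC 12 | S i' => ((INR (S i') * (INR i' + 2))%R * PE i' x t)%C end.
pose dF i x := match i with O => RtoC 0 | S i' => ((INR (S i') * (INR i' + k))%R * PF i' x t)%C end.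
have hE : forall i, isD (fun x => PE i x t) x (dE i x).
  case=> [|i]; last by exact: (qpoly_D 2 QE 1 hol_QE QE_base).
  apply: (isD_ext (fun x => E2 t + 12 * x)%C); first by move=> w; rewrite /PE /qpoly /=; ring.
  by apply: (isD_val _ _ _ _ (isD_plus _ _ _ _ _ (isD_const _ _) (isD_scal 12 _ _ _ (isD_id x)))); rewrite /=; ring.
have hFD : forall i, isD (fun x => PF i x t) x (dF i x).
  case=> [|i]; last by exact: (qpoly_D k QF 0 hol_QF QF_base).
  apply: (isD_ext (fun x => F t)%C); last exact: isD_const.
  by move=> w; rewrite /PF /qpoly /F /=; ring.
have h1 := hFD (S m).
have h2 := csum_isD (fun i x => bracket_coef i * (PE i x t * PF (m - i) x t))%C _ x (S m)
  (fun i => isD_scal (bracket_coef i) _ _ _ (isD_mult _ _ _ _ _ (hE i) (hFD (m - i)%nat))).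
apply: (isD_val _ _ _ _ (isD_minus _ _ _ _ _ h1 (isD_scal ((k + INR (S m) - 1) / 12)%R _ _ _ h2))).
rewrite (csum_ext _ (fun i => bracket_coef i * (dE i x * PF (m - i) x t) + bracket_coef i * (PE i x t * dF (m - i)%nat x))%C); last by move=> i _; ring.
rewrite csum_plus [X in (X + _)%C]csum_S_l [X in (_ + X)%C]csumS Nat.sub_diag Nat.sub_0_r.
set A := csum _ m; set B := csum _ m.
have hAB : (A + B = 0)%C.
  rewrite /A /B -csum_plus (csum_ext _ (fun _ => 0 * 0)%C); first by rewrite csum_scal; ring.
  move=> i hi; have e : (m - i = S (m - S i))%nat by lia.
  rewrite [dF (m - i)%nat x](_ : _ = ((INR (m - i) * (INR (m - S i) + k))%R * PF (m - S i) x t)%C); last by rewrite e.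
  rewrite [dE (S i) x]/= -/(INR (S i)).
  transitivity (RtoC (bracket_coef (S i) * (INR (S i) * (INR i + 2)) + bracket_coef i * (INR (m - i) * (INR (m - S i) + k)))
     * (PE i x t * PF (m - S i) x t))%C.
    by rewrite RtoC_plus !(RtoC_mult (bracket_coef _)); ring.
  by rewrite bracket_coef_S //; ring.
transitivity ((INR (S m) * (INR m + k))%R * PF m x t - ((k + INR (S m) - 1) / 12)%R * (bracket_coef 0 * 12 * PF m x t + (A + B)))%C.
  by rewrite /=; ring.
rewrite hAB bracket_coef_0 S_INR -(RtoC_mult (INR m + 1)%R 12).
have -> : ((k + (INR m + 1) - 1) / 12 = (INR m + k) / 12) by field.
transitivity (RtoC ((INR m + 1) * (INR m + k) - (INR m + k) / 12 * ((INR m + 1) * 12)) * PF m x t)%C.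
  by rewrite RtoC_minus (RtoC_mult ((INR m + k) / 12)%R); ring.
rewrite (_ : _ - _ = 0); [ring | field].
Qed.

Lemma koike_poly_const t x : koike_poly t x = koike_poly t 0.
Proof.
have h : Cmod (koike_poly t x - koike_poly t 0)%C <= 0 * Cmod (x - 0)%C.
  by apply: (seg_MVT (koike_poly t) (fun _ => RtoC 0)) => s _; [exact: koike_poly_D | rewrite Cmod_0; lra].
rewrite Rmult_0_l in h; have h2 := Cmod_ge_0 (koike_poly t x - koike_poly t 0)%C.
have /Cmod_eq_0 h3 : Cmod (koike_poly t x - koike_poly t 0)%C = 0 by lra.
by rewrite -[koike_poly t x](_ : (koike_poly t x - koike_poly t 0) + koike_poly t 0 = _)%C; [rewrite h3; ring | ring].
Qed.

Lemma kaneko_koikeS h t : kaneko_koike k (S m) h t =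
  (Dqn (S m) h t - ((k + INR (S m) - 1) / 12)%R * csum (fun i => bracket_coef i * (Dqn i E2 t * Dqn (m - i) h t))%C (S m))%C.
Proof.
rewrite /kaneko_koike /rankin_cohen sum_n_csum; congr (_ - _ * _)%C.
by apply: csum_ext => i _; rewrite /bracket_coef; ring.
Qed.

Lemma slash_kaneko_koikeS t : slash (k + 2 * INR (S m)) g (kaneko_koike k (S m) f) t = kaneko_koike k (S m) F t.
Proof.
rewrite (functional_extensionality _ _ (kaneko_koikeS f)) slash_minus slash_scal.
rewrite (slash_csum _ _ (fun i t => bracket_coef i * (Dqn i E2 t * Dqn (m - i) f t))%C).
have sF := slash_Dqn k g f QF 0 hf hol_QF QF_van QF_start.
have sE := slash_Dqn 2 g E2 QE 1 hol_E2 hol_QE QE_van QE_start.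
rewrite sF (csum_ext _ (fun i => bracket_coef i * (PE i (Xg g t) t * PF (m - i) (Xg g t) t))%C); last first.
  move=> i hi; rewrite slash_scal /PE /PF -sF -sE; congr (_ * _)%C.
  rewrite (_ : k + 2 * INR (S m) = (2 + 2 * INR i) + (k + 2 * INR (m - i))); first exact: slash_mult.
  by rewrite minus_INR ?S_INR; [ring | lia].
rewrite -[LHS]/(koike_poly t (Xg g t)) koike_poly_const kaneko_koikeS /koike_poly /PF /PE qpoly_0; congr (_ - _ * _)%C.
by apply: csum_ext => i _; rewrite !qpoly_0.
Qed.

End KanekoKoike.

Lemma slash_kaneko_koike k n g f t : hol f ->
  slash (k + 2 * INR n) g (kaneko_koike k n f) t = kaneko_koike k n (slash k g f) t.
Proof.
move=> hf; case: n => [|m]; last exact: slash_kaneko_koikeS.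
by rewrite /= Rmult_0_r Rplus_0_r.
Qed.

(** * Differential operators with coefficients holomorphic at the cusp *)

Notation op := ((UHP -> C) -> UHP -> C).

(** The order is less than [N], so that [LDO 0] means the zero operator and inductions on the order
    can start there. Operators act on bare functions and are constrained on holomorphic ones
    only. *)
Definition LDO (N : nat) (L : op) : Prop := exists a : nat -> UHP -> C, (forall s, hwc (a s)) /\
  forall f, hol f -> forall t, L f t = csum (fun s => a s t * Dqn s f t)%C N.

Definition monic (r : nat) (T : op) : Prop := exists L, LDO r L /\
  forall f, hol f -> forall t, T f t = (Dqn r f t + L f t)%C.

Lemma csum_0 n : csum (fun _ => RtoC 0) n = 0.
Proof. by elim: n => [|n IH] //=; rewrite IH; ring. Qed.

Lemma LDO_ext N L L' : (forall f, hol f -> forall t, L f t = L' f t) -> LDO N L -> LDO N L'.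
Proof. by move=> e [a [ha h]]; exists a; split=> // f hf t; rewrite -e // h. Qed.

Lemma LDO_plus N L L' : LDO N L -> LDO N L' -> LDO N (fun f t => L f t + L' f t)%C.
Proof.
move=> [a [ha h]] [a' [ha' h']]; exists (fun s t => a s t + a' s t)%C; split.
  by move=> s; exact: hwc_plus.
by move=> f hf t; rewrite h // h' // -csum_plus; apply: csum_ext => s _; ring.
Qed.

Lemma LDO_mult N L c : hwc c -> LDO N L -> LDO N (fun f t => c t * L f t)%C.
Proof.
move=> hc [a [ha h]]; exists (fun s t => c t * a s t)%C; split.
  by move=> s; exact: hwc_mult.
by move=> f hf t; rewrite h // -csum_scal; apply: csum_ext => s _; ring.
Qed.

Lemma LDO_Dqn N s : (s < N)%nat -> LDO N (Dqn s).
Proof.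
move=> hs; exists (fun i _ => if Nat.eqb i s then RtoC 1 else RtoC 0); split.
  by move=> i; case: Nat.eqb; exact: hwc_const.
move=> f hf t; rewrite (_ : N = S s + (N - S s))%nat; last lia.
rewrite csum_add csumS (csum_ext _ (fun _ => RtoC 0) s); last first.
  by move=> i hi; case: Nat.eqb_spec => e; [lia | ring].
rewrite (csum_ext _ (fun _ => RtoC 0) (N - S s)); last first.
  by move=> i hi; case: Nat.eqb_spec => e; [lia | ring].
by rewrite !csum_0 Nat.eqb_refl; ring.
Qed.

Lemma LDO_zero N : LDO N (fun _ _ => RtoC 0).
Proof.
exists (fun _ _ => RtoC 0); split; first by move=> s; exact: hwc_const.
by move=> f hf t; rewrite (csum_ext _ (fun _ => 0 * 0)%C) ?csum_scal; [ring | move=> i _; ring].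
Qed.

Lemma LDO_csum N (L : nat -> op) M : (forall i, (i < M)%nat -> LDO N (L i)) -> LDO N (fun f t => csum (fun i => L i f t) M).
Proof.
elim: M => [|M IH] h /=; first exact: LDO_zero.
apply: (LDO_plus N (fun f t => csum (fun i => L i f t) M)); last by apply: h; lia.
by apply: IH => i hi; apply: h; lia.
Qed.

Lemma LDO_widen N N' L : (N <= N')%nat -> LDO N L -> LDO N' L.
Proof.
move=> hN [a [ha h]].
apply: (LDO_ext _ (fun f t => csum (fun s => a s t * Dqn s f t)%C N)); first by move=> f hf t; rewrite h.
by apply: LDO_csum => i hi; apply: LDO_mult => //; apply: LDO_Dqn; lia.
Qed.

Lemma LDO_Dq N L : LDO N L -> LDO (S N) (fun f => Dq (L f)).
Proof.
move=> [a [ha h]].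
apply: (LDO_ext _ (fun f t => csum (fun s => Dq (a s) t * Dqn s f t + a s t * Dqn (S s) f t)%C N)).
  move=> f hf t.
  rewrite (functional_extensionality (L f) _ (h f hf)) (Dq_csum (fun s t => a s t * Dqn s f t)%C).
    apply: csum_ext => s _; rewrite Dq_mult //; [by case: (ha s) | exact: hol_Dqn].
  by move=> s; apply: hol_mult; [case: (ha s) | exact: hol_Dqn].
apply: (LDO_csum _ (fun s f t => Dq (a s) t * Dqn s f t + a s t * Dqn (S s) f t)%C) => i hi.
by apply: LDO_plus; apply: LDO_mult => //; try exact: hwc_Dq; apply: LDO_Dqn; lia.
Qed.

Lemma LDO_hol N L f : LDO N L -> hol f -> hol (L f).
Proof.
move=> [a [ha h]] hf; rewrite (functional_extensionality (L f) _ (h f hf)).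
by apply: (hol_csum (fun s t => a s t * Dqn s f t)%C) => s; apply: hol_mult; [case: (ha s) | exact: hol_Dqn].
Qed.

Lemma monic_LDO r T : monic r T -> LDO (S r) T.
Proof.
move=> [L [hL h]]; apply: (LDO_ext _ (fun f t => Dqn r f t + L f t)%C); first by move=> f hf t; rewrite h.
by apply: LDO_plus; [apply: LDO_Dqn; lia | apply: LDO_widen hL; lia].
Qed.

Lemma monic_serre j r T : monic r T -> monic (S r) (fun f => serre j (T f)).
Proof.
move=> hT; have [L [hL h]] := hT; exists (fun f t => Dq (L f) t + (- (j / 12)%R * E2 t) * T f t)%C; split.
  apply: LDO_plus; first exact: LDO_Dq.
  by apply: LDO_mult; [apply: hwc_scal; exact: hwc_E2 | exact: monic_LDO].
move=> f hf t; rewrite /serre {1}(functional_extensionality (T f) _ (h f hf)) Dq_plus.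
- by rewrite [Dqn (S r) f t]/=; ring.
- exact: hol_Dqn.
- exact: LDO_hol hL hf.
Qed.

Lemma monic_id : monic 0 (fun f => f).
Proof. by exists (fun _ _ => RtoC 0); split; [exact: LDO_zero | move=> f hf t /=; ring]. Qed.

Lemma monic_serre_iter k r : monic r (serre_iter k r).
Proof. by elim: r => [|r IH]; [exact: monic_id | exact: (monic_serre _ _ (serre_iter k r))]. Qed.

Lemma monic_plus r T L : monic r T -> LDO r L -> monic r (fun f t => T f t + L f t)%C.
Proof.
move=> [L' [hL' h]] hL; exists (fun f t => L' f t + L f t)%C; split; first exact: LDO_plus.
by move=> f hf t; rewrite h //; ring.
Qed.

Lemma monic_ext r T T' : (forall f t, T f t = T' f t) -> monic r T -> monic r T'.
Proof. by move=> e [L [hL h]]; exists L; split=> // f hf t; rewrite -e h. Qed.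

Lemma monic_canonical k r : monic r (serre_canonical k r) /\ monic (S r) (serre_canonical k (S r)).
Proof.
elim: r => [|r [h1 h2]]; first by split; [exact: monic_id | exact: (monic_serre k 0 (fun f => f) monic_id)].
split=> //.
apply: (monic_ext _ (fun f t => serre (k + 2 * INR (S r)) (serre_canonical k (S r) f) t
   + (- (INR (S r) * (INR (S r) + k - 1) / 144)%R * E4 t) * serre_canonical k r f t)%C).
  by move=> f t; rewrite canonicalSS; ring.
apply: monic_plus; first exact: monic_serre.
apply: LDO_mult; first by apply: hwc_scal; exact: hwc_E4.
by apply: LDO_widen (monic_LDO _ _ h1); lia.
Qed.

Lemma hwc_Dqn n f : hwc f -> hwc (Dqn n f).
Proof. by move=> h; elim: n => [|n IH] //=; exact: hwc_Dq. Qed.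

Lemma monic_kaneko_koike k r : monic r (kaneko_koike k r).
Proof.
case: r => [|m]; first exact: monic_id.
apply: (monic_ext _ (fun f t => Dqn (S m) f t + - ((k + INR (S m) - 1) / 12)%R *
  csum (fun i => (bracket_coef k m i * Dqn i E2 t) * Dqn (m - i) f t) (S m))%C).
  move=> f t; rewrite kaneko_koikeS (csum_ext _ (fun i => bracket_coef k m i * (Dqn i E2 t * Dqn (m - i) f t))%C); first ring.
  by move=> i _; ring.
apply: (monic_plus _ (Dqn (S m))).
  by exists (fun _ _ => RtoC 0); split; [exact: LDO_zero | move=> f hf t; ring].
apply: LDO_mult; first exact: hwc_const.
apply: (LDO_csum _ (fun i f t => (bracket_coef k m i * Dqn i E2 t) * Dqn (m - i) f t)%C) => i hi.
apply: LDO_mult; last by apply: LDO_Dqn; lia.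
by apply: hwc_scal; apply: hwc_Dqn; exact: hwc_E2.
Qed.

(** * The isomorphism *)

Section Vanishing.
Variable t0 : UHP.

(** $n!/(2\pi i)^n$, the value of $D^n(\tau-\tau_0)^n$. *)
Fixpoint lead (n : nat) : C :=
  match n with O => RtoC 1 | S m => (INR (S m) / (2 * PI * Ci) * lead m)%C end.

Lemma lead_neq0 n : lead n <> RtoC 0.
Proof.
elim: n => [|n IH] /=; first by apply: RtoC_neq; lra.
apply: Cmult_neq_0 => //; apply: Cmult_neq_0.
  by apply: RtoC_neq; exact: (not_0_INR (S n)).
by move=> e; have := two_pi_i_neq0; rewrite -(Cinv_inv (2 * PI * Ci)) e Cinv_0.
Qed.

Definition lin (t : UHP) : C := (t - t0)%C.

Lemma isD_linear t : isD (fun z => z - t0)%C (uhp_val t) (RtoC 1).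
Proof. by apply: (isD_val _ _ _ _ (isD_minus _ _ _ _ _ (isD_id _) (isD_const _ _))); ring. Qed.

Lemma hol_lin : hol lin.
Proof. by apply: (hol_intro _ (fun z => z - t0)%C) => // t; eexists; exact: isD_linear. Qed.

Lemma Dq_lin t : Dq lin t = (/ (2 * PI * Ci))%C.
Proof.
apply: (Dq_eq _ (fun z => z - t0)%C) => //; apply: (isD_val _ _ _ _ (isD_linear t)).
by rewrite Cinv_r //; exact: two_pi_i_neq0.
Qed.

Lemma Dq_lin_pow n t : Dq (fun t => lin t ^ S n)%C t = (INR (S n) / (2 * PI * Ci) * lin t ^ n)%C.
Proof.
elim: n => [|n IH].
  transitivity (Dq lin t); first by congr (Dq _ t); apply: functional_extensionality => u; rewrite /=; ring.
  by rewrite Dq_lin /= /Cdiv; ring.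
rewrite (Dq_mult lin (fun t => lin t ^ S n)%C); [|exact: hol_lin|exact/hol_pow/hol_lin].
by rewrite IH Dq_lin (S_INR (S n)) RtoC_plus [(lin t ^ S n)%C]/= /Cdiv; ring.
Qed.

(** If $u$ is $(\tau-\tau_0)^{n+1}$ times $h$, then $Du$ is $(\tau-\tau_0)^n$ times a holomorphic
    cofactor whose value at $\tau_0$ is $(n+1)/(2\pi i)$ times that of $h$. *)
Lemma Dqn_vanish n (u h : UHP -> C) : hol h -> (forall t, u t = lin t ^ n * h t)%C ->
  (forall s, (s < n)%nat -> Dqn s u t0 = 0) /\ (Dqn n u t0 = lead n * h t0)%C.
Proof.
elim: n u h => [|n IH] u h half_pow hu; first by split=> [s hs|]; [lia | rewrite /= hu /=; ring].
pose h' t := (INR (S n) / (2 * PI * Ci) * h t + lin t * Dq h t)%C.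
have hh' : hol h'.
  by apply: hol_plus; [exact: hol_scal | apply: hol_mult; [exact: hol_lin | exact: holomorphic_Dq]].
have hD : forall t, (Dq u t = lin t ^ n * h' t)%C.
  move=> t; rewrite (functional_extensionality _ _ hu) (Dq_mult (fun t => lin t ^ S n)%C) //; last exact/hol_pow/hol_lin.
  by rewrite Dq_lin_pow /h' [(lin t ^ S n)%C]/=; ring.
have [h1 h2] := IH _ _ hh' hD.
have hsw : forall s, Dqn (S s) u = Dqn s (Dq u) by move=> s; exact: Nat.iter_succ_r.
have l0 : lin t0 = 0 by rewrite /lin; ring.
split.
- case=> [|s] hs; first by rewrite /= hu l0 /=; ring.
  by rewrite hsw; apply: h1; lia.
- by rewrite hsw h2 /h' l0 [lead (S n)]/= /=; ring.
Qed.

Lemma LDO_vanish N L n u h : LDO N L -> (N <= n)%nat -> hol h -> (forall t, u t = lin t ^ n * h t)%C -> L u t0 = 0.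
Proof.
move=> [a [ha hL]] hN half_pow hu; have [h1 _] := Dqn_vanish n u h half_pow hu.
rewrite hL; last first.
  rewrite (functional_extensionality _ _ hu); apply: (hol_mult (fun t => lin t ^ n)%C) => //; exact/hol_pow/hol_lin.
rewrite (csum_ext _ (fun _ => RtoC 0)) ?csum_0 // => i hi; rewrite h1; [ring | lia].
Qed.

Lemma monic_vanish n T u h : monic n T -> hol h -> (forall t, u t = lin t ^ n * h t)%C -> T u t0 = (lead n * h t0)%C.
Proof.
move=> [L [hL hT]] half_pow hu; have [_ h2] := Dqn_vanish n u h half_pow hu.
rewrite hT; last first.
  rewrite (functional_extensionality _ _ hu); apply: (hol_mult (fun t => lin t ^ n)%C) => //; exact/hol_pow/hol_lin.
by rewrite h2 (LDO_vanish n L n u h) //; ring.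
Qed.

End Vanishing.

(** The source of the nonvanishing factor: under the slash action a zero of order $N$ at
    $\gamma\tau_0$ becomes one at $\tau_0$. *)
Lemma mobius_diff g (t t0 : UHP) : (act g t - act g t0 = (t - t0) * / (autj g t * autj g t0))%C.
Proof.
have n := j_neq0 g t; have n0 := j_neq0 g t0.
have hd : (IZR (sa g) * IZR (sd g) - IZR (sb g) * IZR (sc g) = 1)%C.
  by rewrite -!RtoC_mult -RtoC_minus sl2_detR.
rewrite /= /mobius.
transitivity ((IZR (sa g) * IZR (sd g) - IZR (sb g) * IZR (sc g)) * (t - t0) * / (autj g t * autj g t0))%C; last by rewrite hd; ring.
move: n n0; rewrite /autj => n n0; field; by split.
Qed.

Section Expansion.
Variables (T : nat -> op) (k : R).
Hypothesis hmonic : forall r, monic r (T r).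
Hypothesis hequiv : forall r g f, hol f -> forall t, slash (k + 2 * INR r) g (T r f) t = T r (slash k g f) t.

Lemma leading_modular N L a (K : Z) : (forall r, hwc (a r)) ->
  (forall f, hol f -> forall t, L f t = csum (fun s => a s t * Dqn s f t)%C (S N)) ->
  (forall g f, hol f -> forall t, L (slash k g f) t = slash (k + IZR K) g (L f) t) ->
  modular_form (K - 2 * Z.of_nat N) (a N).
Proof.
move=> ha hL hq; have [hol_a cusp_a] := ha N; split=> //; split=> // g t0.
have n0 := j_neq0 g t0.
(* Only the term of order $N$ sees a function vanishing to order $N$. This is used at $\gamma\tau_0$
   for $f$ and at $\tau_0$ for its slash. *)
have top : forall t1 u h, hol h -> (forall t, u t = lin t1 t ^ N * h t)%C -> L u t1 = (a N t1 * (lead N * h t1))%C.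
  move=> t1 u h half_pow hu; have [h1 h2] := Dqn_vanish t1 N u h half_pow hu.
  rewrite hL; last first.
    by rewrite (functional_extensionality _ _ hu); apply: (hol_mult (fun t => lin t1 t ^ N)%C) => //; exact/hol_pow/hol_lin.
  rewrite csumS h2 (csum_ext _ (fun _ => RtoC 0)) ?csum_0; first ring.
  by move=> i hi; rewrite h1 //; ring.
pose t1 := act g t0; pose f t := (lin t1 t ^ N)%C.
have hf : hol f by apply: hol_pow; exact: hol_lin.
have e1 := top t1 f (fun _ => RtoC 1) (hol_const 1) ltac:(move=> t; rewrite /f; ring).
pose h t := (Crpow (autj g t) (- k) * (/ (autj g t * autj g t0)) ^ N)%C.
have half_pow : hol h.
  apply: (hol_mult (fun t => Crpow (autj g t) (- k)) (fun t => (/ (autj g t * autj g t0)) ^ N)%C).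
    by apply: (hol_intro _ (fun z => Crpow (autj g z) (- k))) => // t; eexists; apply: isD_Crpow_autj; exact: uhp_im.
  apply: (hol_pow (fun t => / (autj g t * autj g t0))%C).
  apply: (hol_intro _ (fun z => / (autj g z * autj g t0))%C) => // t; eexists.
  apply: (isD_comp Cinv (fun z => autj g z * autj g t0)%C).
    by apply: isD_Cinv; apply: Cmult_neq_0 => //; exact: j_neq0.
  by apply: isD_mult; [exact: isD_autj | exact: isD_const].
have e2 := top t0 (slash k g f) h half_pow ltac:(move=> t; rewrite /slash /f /lin /t1 mobius_diff Cpow_mult_l /h; ring).
have e := hq g f hf t0; rewrite e2 {1}/slash -/t1 e1 in e.
have nl := lead_neq0 N.
rewrite /slash minus_IZR mult_IZR -INR_IZR_INZ -/t1.
have n1 := Crpow_neq0 (autj g t0) (- k).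
have hc : (Crpow (autj g t0) (- (k + IZR K)) * a N t1 = a N t0 * h t0)%C.
  transitivity ((Crpow (autj g t0) (- (k + IZR K)) * (a N t1 * (lead N * 1))) / lead N)%C; first by field.
  by rewrite -e; field.
(* Splitting the exponent exposes a factor $j^k$ that cancels the $j^{-k}$ in $h$; so the branch of
   the real power leaves no trace, and the weight is the integer $K-2N$. *)
have -> : (- (IZR K - 2 * INR N)) = - (k + IZR K) + k + INR (2 * N) by rewrite mult_INR /=; ring.
rewrite !Crpow_plus Crpow_INR //.
transitivity (Crpow (autj g t0) (- (k + IZR K)) * a N t1 * (Crpow (autj g t0) k * autj g t0 ^ (2 * N)))%C; first ring.
have n2 : (autj g t0 * autj g t0)%C <> RtoC 0 by exact: Cmult_neq_0.
rewrite hc /h Crpow_opp Cpow_mult_r Cpow_inv // [(autj g t0 ^ 2)%C]/= Cmult_1_r.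
have n3 := Crpow_neq0 (autj g t0) k; have n4 := Cpow_nz _ N n2.
by move: n3 n4; set x := Crpow _ _; set y := (_ ^ N)%C => n3 n4; field.
Qed.

Lemma expand N L (K : Z) : LDO N L ->
  (forall g f, hol f -> forall t, L (slash k g f) t = slash (k + IZR K) g (L f) t) ->
  exists b : nat -> UHP -> C, (forall r, (r < N)%nat -> modular_form (K - 2 * Z.of_nat r) (b r)) /\
    (forall r, (N <= r)%nat -> b r = fun _ => RtoC 0) /\
    forall f, hol f -> forall t, L f t = csum (fun r => b r t * T r f t)%C N.
Proof.
elim: N L => [|N IH] L hLDO hq.
  exists (fun _ _ => RtoC 0); split; first by move=> r; lia.
  by split=> // f hf t; have [a [_ h]] := hLDO; rewrite h.
have [a [ha hL]] := hLDO; have [M [[c [hc hM]] hT]] := hmonic N.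
have hmod := leading_modular N L a K ha hL hq.
pose L' : op := fun f t => (L f t - a N t * T N f t)%C.
have hL' : LDO N L'.
  exists (fun s t => a s t - a N t * c s t)%C; split.
    by move=> s; apply: hwc_minus => //; exact: hwc_mult.
  move=> f hf t; rewrite /L' hL // hT // hM // csumS.
  rewrite [RHS](csum_ext _ (fun s => a s t * Dqn s f t + (- a N t) * (c s t * Dqn s f t))%C N); last by move=> i _; ring.
  by rewrite csum_plus csum_scal; ring.
have hq' : forall g f, hol f -> forall t, L' (slash k g f) t = slash (k + IZR K) g (L' f) t.
  move=> g f hf t; rewrite /L' slash_minus hq //; congr (_ - _)%C.
  (* The weight $K-2N$ of $a_N$ and the target weight $k+2N$ of $T_N$ add up to $k+K$, so the
     remainder is equivariant of the same type. *)
  rewrite (_ : k + IZR K = IZR (K - 2 * Z.of_nat N) + (k + 2 * INR N)); last first.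
    by rewrite minus_IZR mult_IZR -INR_IZR_INZ; ring.
  by rewrite slash_mult hequiv //; have [_ [-> _]] := hmod.
have [b [hb [hb0 hbs]]] := IH L' hL' hq'.
exists (fun r => if Nat.eqb r N then a N else b r); split; [|split].
- by move=> r hr; case: Nat.eqb_spec => [->|e] //; apply: hb; lia.
- by move=> r hr; case: Nat.eqb_spec => e; [lia | apply: hb0; lia].
- move=> f hf t; rewrite csumS Nat.eqb_refl (csum_ext _ (fun r => b r t * T r f t)%C); last first.
    by move=> i hi; case: Nat.eqb_spec => e //; lia.
  by rewrite -hbs // /L'; ring.
Qed.

(** Triangularity: on $(\tau-\tau_0)^N$ all $T_r$ with $r<N$ vanish at $\tau_0$, while $T_N$ gives a
    nonzero number; so the top coefficient is 0 at every $\tau_0$. *)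
Lemma expansion_zero N (b : nat -> UHP -> C) :
  (forall f, hol f -> forall t, csum (fun r => b r t * T r f t)%C N = 0) -> forall r t, (r < N)%nat -> b r t = 0.
Proof.
elim: N => [|N IH] h r t hr; first by lia.
have bN : forall t0, b N t0 = 0.
  move=> t0; pose f u := (lin t0 u ^ N)%C.
  have hf : hol f by apply: hol_pow; exact: hol_lin.
  have hu : forall u, (f u = lin t0 u ^ N * 1)%C by move=> u; rewrite /f; ring.
  have := h f hf t0; rewrite csumS (monic_vanish t0 N _ f (fun _ => RtoC 1) (hmonic N) (hol_const 1) hu).
  rewrite (csum_ext _ (fun _ => RtoC 0)); last first.
    move=> i hi; rewrite (LDO_vanish t0 (S i) (T i) N f (fun _ => RtoC 1)) //; [ring | exact: monic_LDO | exact: hol_const].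
  rewrite csum_0 => e; have nl := lead_neq0 N.
  have -> : (b N t0 = (0 + b N t0 * (lead N * 1)) / lead N)%C by field.
  by rewrite e; field.
case: (Nat.eq_dec r N) => [->|e]; first exact: bN.
apply: IH; last by lia.
by move=> f hf u; have := h f hf u; rewrite csumS bN Cmult_0_l Cplus_0_r.
Qed.

Variables (n : nat) (K : Z).

Lemma expansion_csum (L : MLDO n k K) (b : direct_sum n K) : is_expansion T L b <->
  forall (f : Hol) t, operator L f t = csum (fun r => Defs.family b r t * T r f t)%C (S n).
Proof. by split=> h f t; rewrite h sum_n_csum. Qed.

Lemma expansion_unique (L : MLDO n k K) (b b' : direct_sum n K) :
  is_expansion T L b -> is_expansion T L b' -> b = b'.
Proof.
move=> /expansion_csum h /expansion_csum h'; apply: sub_eq.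
have hz : forall r t, (r < S n)%nat -> (Defs.family b r t - Defs.family b' r t = 0)%C.
  apply: (expansion_zero (S n) (fun r t => Defs.family b r t - Defs.family b' r t)%C) => f hf t.
  rewrite (csum_ext _ (fun r => Defs.family b r t * T r f t + (-1) * (Defs.family b' r t * T r f t))%C); last by move=> i _; ring.
  have e1 := h (exist _ f hf) t; have e2 := h' (exist _ f hf) t.
  by rewrite csum_plus csum_scal -e1 -e2; ring.
(* Past [n] both families are 0 by [in_direct_sum], so they agree on all of [nat]. *)
apply: functional_extensionality => r; case: (le_lt_dec r n) => hr; last first.
  have [_ hb] := proj2_sig b; have [_ hb'] := proj2_sig b'.
  by rewrite hb // hb'.
apply: functional_extensionality => t; have e := hz r t ltac:(lia).
change (Defs.family b r t = Defs.family b' r t).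
by rewrite -[LHS](_ : (Defs.family b r t - Defs.family b' r t) + Defs.family b' r t = _)%C; [rewrite e; ring | ring].
Qed.

Lemma expansion_exists (L : MLDO n k K) : exists b : direct_sum n K, is_expansion T L b.
Proof.
case: L => L [[a [ha hL]] hq].
(* [is_MLDO] constrains the coefficients up to [n] only, while [LDO] asks all of them to be
   holomorphic at the cusp; the rest are replaced by 0. *)
pose a' s := if Nat.leb s n then a s else fun _ => RtoC 0.
pose Lop : op := fun f t => csum (fun s => a' s t * Dqn s f t)%C (S n).
have eL : forall (f : Hol) t, L f t = Lop f t.
  move=> f t; rewrite hL sum_n_csum; apply: csum_ext => s hs.
  by rewrite /a'; case: Nat.leb_spec => // h; lia.
have hLop : LDO (S n) Lop.
  exists a'; split=> // s; rewrite /a'; case: Nat.leb_spec => h; [exact: ha | exact: hwc_const].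
have hqop : forall g f, hol f -> forall t, Lop (slash k g f) t = slash (k + IZR K) g (Lop f) t.
  move=> g f hf t; have h := hq g (exist _ f hf) t; rewrite eL in h.
  rewrite -[Lop (slash k g f) t]/(Lop (slash_Hol k g (exist _ f hf)) t) h.
  by rewrite /slash eL.
have [b [hb [hb0 hbs]]] := expand (S n) Lop K hLop hqop.
have hd : in_direct_sum n K b.
  by split=> r hr; [apply: hb; lia | apply: hb0; lia].
exists (exist _ b hd); apply/expansion_csum => f t.
rewrite -[operator _ f t]/(L f t) eL; apply: hbs; exact: (proj2_sig f).
Qed.

(** The converse of the expansion: it supplies the inverse map, hence surjectivity. *)
Lemma combination_MLDO (b : direct_sum n K) :
  is_MLDO n k K (fun f t => csum (fun r => Defs.family b r t * T r f t)%C (S n)).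
Proof.
have [hb _] := proj2_sig b.
have hLDO : LDO (S n) (fun f t => csum (fun r => Defs.family b r t * T r f t)%C (S n)).
  apply: (LDO_csum _ (fun r f t => Defs.family b r t * T r f t)%C) => r hr.
  have [h1 [_ h2]] := hb r ltac:(lia).
  by apply: LDO_mult; [split | apply: LDO_widen (monic_LDO _ _ (hmonic r)); lia].
split.
- have [a [ha h]] := hLDO; exists a; split=> [r _|f t]; first exact: ha.
  by rewrite h ?sum_n_csum //; exact: (proj2_sig f).
- move=> g f t; rewrite (slash_csum _ _ (fun r t => Defs.family b r t * T r f t)%C); apply: csum_ext => r hr.
  have [_ [h2 _]] := hb r ltac:(lia).
  rewrite (_ : k + IZR K = IZR (K - 2 * Z.of_nat r) + (k + 2 * INR r)); last first.
    by rewrite minus_IZR mult_IZR -INR_IZR_INZ; ring.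
  by rewrite slash_mult hequiv ?h2 //; exact: (proj2_sig f).
Qed.

(** Uniqueness makes the chosen expansion linear, since sums and multiples of expansions are
    expansions, and it identifies the expansion of a combination with the coefficients it was formed
    from. *)
Lemma expansion_isomorphism_of_monic : expansion_isomorphism T n k K.
Proof.
split.
  move=> L; have [b hb] := expansion_exists L; exists b; split=> // b' hb'; exact: expansion_unique hb hb'.
pose phi (L : MLDO n k K) := proj1_sig (constructive_indefinite_description _ (expansion_exists L)).
have hphi : forall L, is_expansion T L (phi L).
  by move=> L; exact: (proj2_sig (constructive_indefinite_description _ (expansion_exists L))).
exists phi; split=> //; split; [|split].
- move=> x y; apply: (expansion_unique (plus x y)) => //; apply/expansion_csum => f t.
  have /expansion_csum h1 := hphi x; have /expansion_csum h2 := hphi y.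
  rewrite -[operator _ f t]/(operator x f t + operator y f t)%C h1 h2 -csum_plus; apply: csum_ext => r _.
  rewrite -[Defs.family (plus _ _) r t]/(Defs.family (phi x) r t + Defs.family (phi y) r t)%C; ring.
- move=> a x; apply: (expansion_unique (scal a x)) => //; apply/expansion_csum => f t.
  have /expansion_csum h1 := hphi x.
  rewrite -[operator _ f t]/(a * operator x f t)%C h1 -csum_scal; apply: csum_ext => r _.
  rewrite -[Defs.family (scal _ _) r t]/(a * Defs.family (phi x) r t)%C; ring.
- pose psi (b : direct_sum n K) : MLDO n k K := exist _ _ (combination_MLDO b).
  have hpsi : forall b, is_expansion T (psi b) b by move=> b; apply/expansion_csum.
  exists psi.
  + move=> L; apply: sub_eq; apply: functional_extensionality => f; apply: functional_extensionality => t.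
    by have /expansion_csum h := hphi L; symmetry; exact: h.
  + by move=> b; apply: (expansion_unique (psi b)).
Qed.

End Expansion.

Theorem theorem3 (k : R) (K : Z) (n : nat) :
  expansion_isomorphism (serre_iter k) n k K /\
  expansion_isomorphism (kaneko_koike k) n k K /\
  expansion_isomorphism (serre_canonical k) n k K.
Proof.
split; [|split]; apply: expansion_isomorphism_of_monic.
- exact: monic_serre_iter.
- by move=> r g f hf t; exact: slash_serre_iter.
- exact: monic_kaneko_koike.
- by move=> r g f hf t; exact: slash_kaneko_koike.
- by move=> r; case: (monic_canonical k r).
- by move=> r g f hf t; case: (slash_canonical2 k r g f hf).
Qed.
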